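(* Let $\Gamma\subset\mathbb{C}$ be a Jordan curve with arc-length parametrization $\gamma\in C^3$. The time-reparametrized parametrization process $X^x$ with parameter $\kappa>0$, started at $x\in D$, satisfies a large deviation principle in $C_x(\mathbb{R}_+,D)$, as $\kappa\to0+$, with rate $1/\kappa$ and good rate function $$I(u)=\frac12\int_0^\infty\sum_{i=1}^N\left|\dot u_i(t)-\sum_{j:j\ne i}\mathrm{Re}\left\{\frac{\gamma'(u_i(t))}{\gamma(u_i(t))-\gamma(u_j(t))}\right\}\right|^2dt$$ for absolutely continuous $u=(u_1(t),\dots,u_N(t))_{t\ge0}$, and $I(u)=+\infty$ otherwise.
   Context: $\Gamma$ has length $l$; $\gamma:\mathbb{R}\to\Gamma$ is its $l$-periodic (counterclockwise) arc-length parametrization. $N$ is a fixed positive integer. $D=\{x\in\mathbb{R}^N:x_1<x_2<\dots<x_N<x_1+l\}$, $V(x)=-\sum_{i<j}\log|\gamma(x_i)-\gamma(x_j)|$. The time-reparametrized parametrization process $X^x$ with parameter $\kappa$ (corresponding to inverse temperature $\beta=2/\kappa$) is the strong solution, with values in $D$ (for $\kappa\le2$), of $dX(t)=\sqrt{\kappa}\,dB(t)-\nabla V(X(t))\,dt$, $X(0)=x\in D$, with $B$ an $N$-dimensional standard Brownian motion. $C_x(\mathbb{R}_+,D)$ is the space of continuous functions $\mathbb{R}_+=[0,\infty)\to D$ started at $x$, with the topology of locally uniform convergence (uniform convergence on $[0,T]$ for every $T>0$). Absolutely continuous means absolutely continuous on every compact time interval. ''Rate $1/\kappa$'' means the probabilities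 in the large deviation principle are on the scale $e^{-I/\kappa}$; a rate function is good if its sublevel sets are compact. *)

(* Defs.v *)
From HB Require Import structures.
From mathcomp Require Import all_boot all_order all_algebra complex.
From mathcomp Require Import all_classical all_reals all_analysis.

Set Implicit Arguments.
Unset Strict Implicit.
Unset Printing Implicit Defensive.

Import Order.TTheory GRing.Theory Num.Theory.
Import numFieldNormedType.Exports.
Import ComplexField.Normc.

Local Open Scope classical_set_scope.
Local Open Scope ring_scope.
Local Open Scope complex_scope.

(* Naming R[i] as a numClosedFieldType makes the topology that MathComp-Analysis
   puts on every such field available; this topology is the usual one. *)
Definition Cplx (R : realType) : numClosedFieldType := R[i].

Section Curve.
Context {R : realType}.
Implicit Types (Gamma : set (Cplx R)) (l : R) (gamma : R -> Cplx R).

Definition jordan_curve Gamma : Prop :=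
  exists f : R -> Cplx R,
    [/\ {within `[0, 1], continuous f}, f 0 = f 1,
        {in `[0, 1[ &, injective f} & f @` `[0, 1] = Gamma].

Definition C3 (f : R -> R) : Prop :=
  (forall (k : nat) (s : R), (k < 3)%N -> derivable (derive1n k f) s 1) /\
  continuous (derive1n 3 f).

(* Derivatives of curves are taken coordinatewise, because R[i] is not a normed
   module over R in the library. *)
Definition cderive gamma (s : R) : Cplx R :=
  derive1 (fun r => complex.Re (gamma r)) s
  +i* derive1 (fun r => complex.Im (gamma r)) s.

(* The winding number of gamma around every point enclosed by Gamma (i.e. lying
   in a bounded component of the complement) is 1.  The integral of
   Im (gamma' / (gamma - z)) is 2 pi times the winding number around z. *)
Definition counterclockwise Gamma l gamma : Prop :=
  forall z : Cplx R, ~ Gamma z ->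
    bounded_set (connected_component (~` Gamma) z) ->
    \int[lebesgue_measure]_(s in `[0, l])
      complex.Im (cderive gamma s / (gamma s - z)) = pi *+ 2.

Record arc_length_param Gamma l gamma : Prop := {
  alp_length : 0 < l ;
  alp_range : range gamma = Gamma ;
  alp_periodic : forall s, gamma (s + l) = gamma s ;
  alp_inj : {in `[0, l[ &, injective gamma} ;
  alp_re : C3 (fun s => complex.Re (gamma s)) ;
  alp_im : C3 (fun s => complex.Im (gamma s)) ;
  alp_speed : forall s, normc (cderive gamma s) = 1 ;
  alp_ccw : counterclockwise Gamma l gamma }.

End Curve.

Section Paths.
Context {R : realType} (N : nat).

Definition Ddom (l : R) : set 'rV[R]_N :=
  [set x | (forall i j : 'I_N, (i < j)%N -> x 0 i < x 0 j) /\
           (forall i j : 'I_N, i = 0%N :> nat -> j.+1 = N -> x 0 j < x 0 i + l)].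

Definition Venergy (gamma : R -> Cplx R) (x : 'rV[R]_N) : R :=
  - \sum_(i < N) \sum_(j < N | (i < j)%N) ln (normc (gamma (x 0 i) - gamma (x 0 j))).

Definition grad (f : 'rV[R]_N -> R) (x : 'rV[R]_N) : 'rV[R]_N :=
  \row_(i < N) 'D_(delta_mx 0 i : 'rV[R]_N) f x.

Definition initial_segments : set (set R) :=
  [set A | exists2 T : R, 0 < T & A = `[0, T]%classic].

(* Continuous functions [0, +oo[ -> D started at x.  A path is encoded as a
   function on R which is constant on ]-oo, 0]; this is a bijection with the
   functions on [0, +oo[.  The topology, inherited from {family _, R -> _}, is
   that of uniform convergence on each [0, T]. *)
Definition path_set (l : R) (x : 'rV[R]_N) :
    set {family initial_segments, R -> 'rV[R]_N} :=
  [set u | [/\ u 0 = x, forall t : R, t < 0 -> u t = x,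
               continuous (u : R -> 'rV[R]_N) & forall t : R, 0 <= t -> Ddom l (u t)]].

Definition path_space (l : R) (x : 'rV[R]_N) : topologicalType :=
  set_type (path_set l x).

Definition pval (l : R) (x : 'rV[R]_N) (u : path_space l x) : R -> 'rV[R]_N :=
  set_val u.

End Paths.

Section Rate.
Context {R : realType} (N : nat).

Definition abs_continuous (f : R -> R) (a b : R) : Prop :=
  forall e : R, 0 < e -> exists2 d : R, 0 < d &
    forall (m : nat) (s t : 'I_m -> R),
      (forall k, [/\ a <= s k, s k < t k & t k <= b]) ->
      trivIset setT (fun k => `]s k, t k[%classic) ->
      \sum_(k < m) (t k - s k) < d ->
      \sum_(k < m) `|f (t k) - f (s k)| < e.

Definition path_abs_continuous (u : R -> 'rV[R]_N) : Prop :=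
  forall (T : R) (i : 'I_N), 0 < T -> abs_continuous (fun t => u t 0 i) 0 T.

Definition drift (gamma : R -> Cplx R) (x : 'rV[R]_N) (i : 'I_N) : R :=
  \sum_(j < N | j != i)
    complex.Re (cderive gamma (x 0 i) / (gamma (x 0 i) - gamma (x 0 j))).

Definition rate (gamma : R -> Cplx R) (u : R -> 'rV[R]_N) : \bar R :=
  if `[< path_abs_continuous u >] then
    ((2^-1)%:E * \int[lebesgue_measure]_(t in [set t : R | (0 <= t)%R])
      (\sum_(i < N) `|derive1 (fun s => u s 0 i) t - drift gamma (u t) i| ^+ 2)%:E)%E
  else +oo%E.

End Rate.

Section Process.
Context {R : realType} {d : measure_display} {T : measurableType d}.
Context (P : probability T R) (N : nat).
Implicit Types (B : R -> T -> 'rV[R]_N).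

Definition mutually_independent (J : finType) (Y : J -> T -> R) : Prop :=
  forall A : J -> set R, (forall j, measurable (A j)) ->
    P (\bigcap_j (Y j @^-1` A j)) = (\prod_j P (Y j @^-1` A j))%E.

(* N-dimensional standard Brownian motion, indexed by [0, +oo[: the values of B
   at negative times are irrelevant.  Independence is joint over the increments
   of all coordinates. *)
Record brownian_motion B : Prop := {
  bm_measurable : forall (t : R) i, 0 <= t -> measurable_fun setT (fun w => B t w 0 i) ;
  bm_start : {ae P, forall w, B 0 w = 0} ;
  bm_continuous : {ae P, forall w, {within `[0, +oo[, continuous (fun t => B t w)}} ;
  bm_gaussian : forall (s t : R) i (A : set R), 0 <= s -> s < t -> measurable A ->
    P ((fun w => B t w 0 i - B s w 0 i) @^-1` A) = normal_prob 0 (Num.sqrt (t - s)) A ;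
  bm_increments : forall (m : nat) (t : nat -> R), 0 <= t 0%N ->
    (forall k, (k < m)%N -> t k < t k.+1) ->
    mutually_independent (fun (ki : 'I_m * 'I_N) w =>
      B (t ki.1.+1) w 0 ki.2 - B (t ki.1) w 0 ki.2) }.

(* The P-augmentation of the filtration generated by B. *)
Definition brownian_filtration B (t : R) : set (set T) :=
  <<s [set C | exists (s : R) (i : 'I_N) (A : set R),
          [/\ 0 <= s, s <= t, measurable A & C = (fun w => B s w 0 i) @^-1` A]]
      `|` [set C | measurable C /\ P C = 0%E] >>.

(* The noise is additive, so the stochastic differential equation
   dX = sqrt kappa dB - grad V(X) dt is an equation between paths. *)
Record strong_solution (gamma : R -> Cplx R) (l : R) (x : 'rV[R]_N) B (kappa : R)
    (X : T -> path_space l x) : Prop := {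
  ss_adapted : forall (t : R) i (A : set R), 0 <= t -> measurable A ->
    brownian_filtration B t ((fun w => pval (X w) t 0 i) @^-1` A) ;
  ss_equation : {ae P, forall w, forall t : R, 0 <= t ->
    pval (X w) t = x + Num.sqrt kappa *: B t w
      - \row_i \int[lebesgue_measure]_(s in `[0, t])
                 grad (Venergy gamma) (pval (X w) s) 0 i} }.

Definition good_rate_function (E : topologicalType) (I : E -> \bar R) : Prop :=
  [/\ forall u, (0 <= I u)%E, lower_semicontinuous I &
      forall a : R, compact [set u | (I u <= a%:E)%E]].

(* Large deviation principle with rate 1 / kappa, as kappa -> 0+, for the random
   elements Z kappa of E. *)
Definition LDP (E : topologicalType) (Z : R -> T -> E) (I : E -> \bar R) : Prop :=
  (forall F : set E, closed F ->
    limf_esup (fun kappa : R => kappa%:E * lne (P (Z kappa @^-1` F))) 0^'+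
      <= - ereal_inf (I @` F))%E /\
  (forall G : set E, open G ->
    - ereal_inf (I @` G) <=
      limf_einf (fun kappa : R => kappa%:E * lne (P (Z kappa @^-1` G))) 0^'+)%E.

End Process.

(* Main.v *)
(* The driving function of a path u is W(t) = u(t) - x - int_0^t b(u(s)) ds, where
   b = - grad V is the drift.  For the solution it is sqrt kappa B, and I(u) is its
   Cameron-Martin energy, i.e. the supremum of sum |Delta W|^2 / (2 Delta t) over
   finite families of disjoint intervals.

   Goodness of I and upper bound: along u, the potential V increases by at most
   the energy of W, because the drift only decreases it.  So a bound on the energy
   of W, even if only on a grid and with small oscillations of W on its cells,
   keeps the particles apart, makes u equicontinuous, and lets ultrafilters of such
   paths converge to paths of bounded energy when the grid is refined.  Hence, if F
   is closed and I > a on F, one fixed grid is such that the solution can be in F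
   only if the grid energy of sqrt kappa B exceeds a (estimated by covering with
   finitely many boxes of independent increments) or if sqrt kappa B oscillates too
   much on a cell (estimated by chaining).

   Lower bound: by Gronwall's lemma, the solution is close to u as soon as
   sqrt kappa B is close to the driving function of u; this follows from the
   closeness of finitely many independent increments and from small oscillations. *)
Require Import Defs.
From HB Require Import structures.
From mathcomp Require Import all_boot all_order all_algebra complex.
From mathcomp Require Import all_classical all_reals all_analysis measurable_realfun.
From mathcomp Require Import ring lra zify.

Set Implicit Arguments.
Unset Strict Implicit.
Unset Printing Implicit Defensive.

Import Order.TTheory GRing.Theory Num.Theory.
Import numFieldNormedType.Exports.
Import ComplexField.Normc.

Local Open Scope classical_set_scope.
Local Open Scope ring_scope.

(** * Absolute continuity and energy *)

(** The drift is singular at collisions, so the equation need not be solvable for an arbitrary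
    continuous driving function, and the large deviations of Brownian motion cannot simply be pushed
    forward. What replaces this is the supremum form of the energy: its finite sums are continuous
    in the path, so bounds on it pass to limits without derivatives, and on a grid it is a function
    of finitely many Gaussian increments. Confinement is a completed square: with drift [b] and
    driving function [W], [V' = - b . (b + W') <= |W'| ^+ 2 / 4], so energy [a] raises [V] by at
    most [a / 2]. Two scales make the discretisation harmless: moving by [2 ^- p] within a cell of
    length [8 ^- p] costs an energy of order [2 ^ p], beyond any fixed level for large [p], while
    the tolerance [2 ^- p] still tends to [0]. The price is to match the supremum with the integral
    in [rate], which is written with pointwise derivatives. This rests on the fact that an
    absolutely continuous function is the integral of its derivative, obtained here from the
    Radon-Nikodym theorem and Lebesgue differentiation. *)

Section AbsCont.
Context {R : realType}.
Local Notation mu := (@lebesgue_measure R).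

Lemma itv_overlap (a b c d : R) : a < b -> c < d -> c < b -> a < d ->
  exists x, a < x < b /\ c < x < d.
Proof.
move=> ab cd cb ad; have : Num.max a c < Num.min b d by rewrite gt_max !lt_min ab ad cb cd.
move=> /midf_lt [h1 h2]; exists ((Num.max a c + Num.min b d) / 2).
by move: h1 h2; rewrite gt_max lt_min => /andP[-> ->] /andP[-> ->].
Qed.

Lemma derivable_addcst (F : R -> R) (c x : R) : derivable F x 1 ->
  derivable (fun y => F y + c) x 1 /\ derive1 (fun y => F y + c) x = derive1 F x.
Proof.
move=> dF; have H : is_derive x (1 : R) (F + cst c) ('D_1 F x + 0).
  exact: (@is_deriveD R R R F (cst c) x 1 _ _ (DeriveDef dF erefl) (is_derive_cst _ _ _)).
split; first exact: (@ex_derive _ _ _ _ _ _ _ H).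
by rewrite !derive1E (@derive_val _ _ _ _ _ _ _ H) addr0.
Qed.

(** Touching intervals are allowed, so the cells of a partition qualify. The predicate [P] drops
    members of a family without reindexing it. *)
Definition apart (J : finType) (P : pred J) (s t : J -> R) :=
  forall i j, P i -> P j -> i != j -> t i <= s j \/ t j <= s i.

(** Degenerate intervals contribute nothing to either sum. They are filtered out before the
    definition, which asks for [s k < t k] and an ordinal index, is applied. *)
Lemma abs_continuous_fin (f : R -> R) a b (e : R) : abs_continuous f a b -> 0 < e ->
  exists2 d : R, 0 < d & forall (J : finType) (P : pred J) (s t : J -> R),
    (forall j, P j -> [/\ a <= s j, s j <= t j & t j <= b]) ->
    apart P s t -> \sum_(j | P j) (t j - s j) < d ->
    \sum_(j | P j) `|f (t j) - f (s j)| < e.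
Proof.
move=> fac e0; have [d d0 H] := fac e e0; exists d => // J P s t st ap sd.
pose r := [seq j <- enum J | P j && (s j < t j)].
have restr (F : J -> R) : (forall j, P j -> s j = t j -> F j = 0) ->
    \sum_(j | P j) F j = \sum_(k < size r) F (tnth (in_tuple r) k).
  move=> F0; rewrite -(big_tnth _ _ r xpredT F) big_filter big_enum_cond /=.
  rewrite (bigID (fun j => s j < t j)) /= [X in _ + X]big1 ?addr0; last first.
    move=> j /andP[Pj]; rewrite -leNgt => tsj; apply: F0 => //.
    by apply/le_anti; rewrite tsj andbT; have [] := st j Pj.
  by [].
rewrite restr; last by move=> j _ ->; rewrite subrr normr0.
have mem k : P (tnth (in_tuple r) k) /\ s (tnth (in_tuple r) k) < t (tnth (in_tuple r) k).
  have : tnth (in_tuple r) k \in r by exact: mem_tnth.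
  by rewrite mem_filter => /andP[/andP[-> ->]].
apply: (H _ (fun k => s (tnth (in_tuple r) k)) (fun k => t (tnth (in_tuple r) k))).
- by move=> k; have [Pk sk] := mem k; have [? _ ?] := st _ Pk.
- apply/trivIsetP => k k' _ _ kk'.
  have [Pk _] := mem k; have [Pk' _] := mem k'.
  have neq : tnth (in_tuple r) k != tnth (in_tuple r) k'.
    apply: contra kk' => /eqP kk'; apply/eqP/val_inj => /=.
    have ur : uniq r by rewrite filter_uniq// enum_uniq.
    have x0 := tnth (in_tuple r) k.
    by apply/eqP; rewrite -(nth_uniq x0 _ _ ur) //; rewrite -!(tnth_nth x0 (in_tuple r)) kk'.
  apply/seteqP; split => // x [/=]; rewrite !in_itv /= => /andP[x1 x2] /andP[x3 x4].
  have [h|h] := ap _ _ Pk Pk' neq; lra.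
- rewrite -(restr (fun j => t j - s j)) //.
  by move=> j _ ->; rewrite subrr.
Qed.

(** The partitions of disjoint intervals form together one disjoint family of the same total length,
    indexed by the pairs of an interval and a cell of its partition. Hence the bound is uniform in
    the partitions. *)
Lemma abs_continuous_TV (f : R -> R) a b (e : R) : abs_continuous f a b -> 0 < e ->
  exists2 d : R, 0 < d & forall (J : finType) (P : pred J) (s t : J -> R),
    (forall j, P j -> [/\ a <= s j, s j <= t j & t j <= b]) ->
    apart P s t -> \sum_(j | P j) (t j - s j) < d ->
    forall l : J -> seq R, (forall j, P j -> itv_partition (s j) (t j) (l j)) ->
    \sum_(j | P j) variation (s j) (t j) f (l j) <= e.
Proof.
move=> fac e0; have [d d0 H] := abs_continuous_fin fac e0; exists d => //.
move=> J P s t st ap sd l lP.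
pose nt (j : J) k := nth (t j) (s j :: l j) k.
have mono j k k' : P j -> (k <= k')%N -> (k' <= size (l j))%N -> nt j k <= nt j k'.
  move=> Pj kk' k's; have := lP j Pj; rewrite /itv_partition => -[pl _].
  have : sorted <=%R (s j :: l j).
    by apply: (@sub_sorted _ <%R) => // x y /ltW.
  move/(sorted_leq_nth le_trans le_refl (t j)); apply => //; rewrite inE /= ltnS //.
  exact: leq_trans k's.
have nt0 j : nt j 0%N = s j by [].
have ntS j : P j -> nt j (size (l j)) = t j.
  move=> Pj; have := lP j Pj; rewrite /itv_partition => -[_ /eqP ll].
  by rewrite /nt -[X in nth _ _ X]/(size (s j :: l j)).-1 nth_last /=.
under eq_bigr do rewrite /variation.
have -> : \sum_(j | P j) \sum_(0 <= k < size (l j))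
     `|(f \o nth (t j) (s j :: l j)) k.+1 - (f \o nth (t j) (s j :: l j)) k| =
   \sum_(p : {j : J & 'I_(size (l j))} | P (tag p))
     `|f (nt (tag p) (tagged p).+1) - f (nt (tag p) (tagged p))|.
  under eq_bigr do rewrite big_mkord.
  rewrite (sig_big_dep (fun j => P j) (fun _ _ => true)
    (fun j (k : 'I_(size (l j))) => `|f (nt j k.+1) - f (nt j k)|)) /=.
  by apply: eq_bigl => p; rewrite andbT.
apply/ltW/H.
- move=> [j k] /= Pj; have [h1 _ h2] := st j Pj; have := ltn_ord k => ks; split.
  + by apply: (le_trans h1); rewrite -nt0; apply: mono => //; exact: ltnW.
  + exact: mono.
  + by apply: le_trans h2; rewrite -(ntS j Pj); exact: mono.
- move=> [j k] [j' k'] /= Pj Pj' neq.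
  have := ltn_ord k => ks; have := ltn_ord k' => ks'.
  have [jj'|jj'] := eqVneq j j'.
    subst j'. have kk' : k != k' by apply: contra neq => /eqP ->.
    have [lt|lt] := ltnP k k'; [left|right]; apply: mono => //.
      exact: ltnW.
    by rewrite ltn_neqAle lt andbT eq_sym.
    exact: ltnW.
  have [h|h] := ap _ _ Pj Pj' jj'; [left|right].
    apply: (@le_trans _ _ (t j)); first by rewrite -(ntS j Pj); exact: mono.
    by apply: (le_trans h); rewrite -nt0; apply: mono => //; exact: ltnW.
  apply: (@le_trans _ _ (t j')); first by rewrite -(ntS j' Pj'); exact: mono.
  by apply: (le_trans h); rewrite -nt0; apply: mono => //; exact: ltnW.
- apply: le_lt_trans sd.
  have -> : \sum_(p : {j : J & 'I_(size (l j))} | P (tag p))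
        (nt (tag p) (tagged p).+1 - nt (tag p) (tagged p)) =
      \sum_(j | P j) \sum_(k < size (l j)) (nt j k.+1 - nt j k).
    rewrite (sig_big_dep (fun j => P j) (fun _ _ => true)
      (fun j (k : 'I_(size (l j))) => nt j k.+1 - nt j k)) /=.
    by apply: eq_bigl => p; rewrite andbT.
  under [X in _ <= X]eq_bigr => j Pj do rewrite -(ntS j Pj) -nt0.
  apply: ler_sum => j Pj; rewrite -(big_mkord xpredT (fun k => nt j k.+1 - nt j k)).
  by rewrite telescope_sumr.
Qed.

(** The variation is at most [1] on every interval shorter than the [d] attached to [1], and
    finitely many steps of length [d / 2] exhaust [[a, b]]. *)
Lemma abs_continuous_BV (f : R -> R) a b : a <= b -> abs_continuous f a b ->
  bounded_variation a b f.
Proof.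
move=> ab fac; have [d d0 H] := abs_continuous_TV fac ltr01.
have step s t : a <= s -> s <= t -> t <= b -> t - s < d -> (total_variation s t f <= 1)%E.
  move=> as_ st tb std; apply: ge_ereal_sup => _ [_ [l lp <-] <-].
  rewrite lee_fin; have := H unit xpredT (fun=> s) (fun=> t).
  move=> /(_ (fun _ _ => And3 as_ st tb)).
  have ap : apart xpredT (fun _ : unit => s) (fun=> t) by move=> [] [].
  move=> /(_ ap); rewrite !big_const /= !card_unit /= !addr0 => /(_ std (fun=> l)).
  by rewrite !big_const /= !card_unit /= !addr0; apply.
have iter n : forall t, a <= t -> t <= b -> t - a <= n%:R * (d / 2) ->
    (total_variation a t f < +oo)%E.
  elim: n => [|n IH] t at_ tb tn.
    have -> : t = a by lra.
    by rewrite total_variationxx ltry.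
  have [le|gt] := leP (t - a) (d / 2).
    by apply: le_lt_trans (step a t _ _ _ _) _; rewrite ?ltry //; lra.
  rewrite (@total_variationD _ a t (t - d / 2)); [|lra|lra].
  apply: lte_add_pinfty.
    by apply: IH; [lra|lra|rewrite -natr1 in tn; lra].
  by apply: le_lt_trans (step _ t _ _ _ _) _; rewrite ?ltry //; lra.
apply/bounded_variationP => //.
rewrite ge0_fin_numE; last exact: total_variation_ge0.
apply: (iter (Num.truncn ((b - a) / (d / 2))).+1) => //.
rewrite -ler_pdivrMr; last lra.
exact/ltW/truncnS_gt.
Qed.

(** The witness is the total variation function. It inherits absolute continuity because the
    variation over each interval is nearly attained by a partition. *)
Lemma abs_continuous_varfun (f : R -> R) a b : a <= b -> abs_continuous f a b ->
  exists v : R -> R,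
  [/\ forall s t, a <= s -> s <= t -> t <= b -> `|f t - f s| <= v t - v s &
   forall e, 0 < e ->
     exists2 d : R, 0 < d & forall (J : finType) (P : pred J) (s t : J -> R),
    (forall j, P j -> [/\ a <= s j, s j <= t j & t j <= b]) ->
    apart P s t -> \sum_(j | P j) (t j - s j) < d ->
    \sum_(j | P j) (v (t j) - v (s j)) < e].
Proof.
move=> ab fac; have BVf := abs_continuous_BV ab fac.
have fin s t : a <= s -> s <= t -> t <= b -> total_variation s t f \is a fin_num.
  move=> as_ st tb; apply/bounded_variationP => //.
  apply: (bounded_variationl st tb); apply: (bounded_variationr as_ _ BVf).
  exact: le_trans tb.
pose v t := fine (total_variation a t f).
have vB s t : a <= s -> s <= t -> t <= b -> v t - v s = fine (total_variation s t f).
  move=> as_ st tb; rewrite /v (total_variationD f as_ st) fineD.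
  - by rewrite addrAC subrr add0r.
  - by apply: fin => //; exact: le_trans tb.
  - exact: fin.
exists v; split.
  move=> s t as_ st tb; rewrite vB // -lee_fin fineK; last exact: fin.
  exact: total_variation_ge.
move=> e e0; have e40 : 0 < e / 4 by lra.
have [d d0 H] := abs_continuous_TV fac e40; exists d => // J P s t st ap sd.
(* The slack [c] per interval adds up to at most [e / 4] over the family. *)
pose c := e / 4 / #|J|.+1%:R.
have c0 : 0 < c by rewrite divr_gt0.
have /choice[l lP] : forall j, exists l, P j -> itv_partition (s j) (t j) l /\
   v (t j) - v (s j) - c < variation (s j) (t j) f l.
  move=> j; have [Pj|] := boolP (P j); last by exists nil.
  have [h1 h2 h3] := st j Pj.
  have := @ub_ereal_sup_adherent R [set x%:E | x in variations (s j) (t j) f] c c0 (fin _ _ h1 h2 h3).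
  move=> [_ [_ [l lp <-] <-] hl]; exists l => _; split => //.
  rewrite vB // -lte_fin EFinB fineK //; exact: fin.
have := H J P s t st ap sd l (fun j Pj => (lP j Pj).1).
move=> hs.
have : \sum_(j | P j) (v (t j) - v (s j)) <= \sum_(j | P j) (variation (s j) (t j) f (l j) + c).
  by apply: ler_sum => j Pj; have [_] := lP j Pj; lra.
rewrite [X in _ <= X -> _]big_split /= => h.
have : \sum_(j | P j) c <= e / 4.
  apply: (@le_trans _ _ (\sum_(j : J) c)).
    rewrite [leRHS](bigID P) /= lerDl; apply: sumr_ge0 => *; exact: ltW.
  rewrite sumr_const -[c *+ _]mulr_natr; apply: (@le_trans _ _ (c * #|J|.+1%:R)).
    by rewrite ler_pM2l // ler_nat.
  by rewrite /c divfK.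
lra.
Qed.


(** Absolute continuity of [v] says that its Stieltjes measure is dominated by Lebesgue measure; the
    density is the Radon-Nikodym derivative. *)
Lemma monotone_ac_density (v : R -> R) a b : a < b ->
  (forall s t, a <= s -> s <= t -> t <= b -> v s <= v t) ->
  (forall e, 0 < e ->
     exists2 d : R, 0 < d & forall (J : finType) (P : pred J) (s t : J -> R),
    (forall j, P j -> [/\ a <= s j, s j <= t j & t j <= b]) ->
    apart P s t -> \sum_(j | P j) (t j - s j) < d ->
    \sum_(j | P j) (v (t j) - v (s j)) < e) ->
  exists g : R -> R, mu.-integrable setT (EFin \o g) /\
    forall s t, a <= s -> s <= t -> t <= b ->
      v t - v s = \int[mu]_(x in `[s, t]) g x.
Proof.
move=> ab vmono vac.
(* Freezing [v] outside [[a, b]] extends it to a monotone function on the line. The clamp is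
   monotone and 1-Lipschitz, so it maps short disjoint families to short disjoint families. *)
pose cl x : R := Num.max a (Num.min b x).
have cl_in x : a <= cl x /\ cl x <= b.
  by rewrite /cl; split; [rewrite le_max lexx|rewrite ge_max ge_min lexx (ltW ab)].
have cl_id x : a <= x -> x <= b -> cl x = x.
  by move=> ax xb; rewrite /cl (min_idPr xb) (max_idPr ax).
have cl_le x y : x <= y -> cl x <= cl y.
  move=> xy; rewrite /cl ge_max le_max lexx /= le_max.
  by apply/orP; right; rewrite le_min !ge_min lexx xy orbT.
have cl_lip x y : x <= y -> cl y - cl x <= y - x.
  by move=> xy; rewrite /cl /Num.max /Num.min; repeat case: ifPn; rewrite -?leNgt; lra.
pose F x := v (cl x).
have Fnd : {homo F : x y / x <= y}.
  move=> x y xy; apply: vmono; [exact: (cl_in x).1|exact: cl_le|exact: (cl_in y).2].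
have Fcont : continuous F.
  move=> x; apply/cvgrPdist_lt => e e0; have [d d0 H] := vac e e0.
  have one s t : s <= t -> t - s < d -> F t - F s < e.
    move=> st std; have := H unit xpredT (fun=> cl s) (fun=> cl t).
    move=> /(_ (fun _ _ => And3 (cl_in s).1 (cl_le _ _ st) (cl_in t).2)).
    have ap : apart xpredT (fun _ : unit => cl s) (fun=> cl t) by move=> [] [].
    move=> /(_ ap); rewrite !big_const /= !card_unit /= !addr0; apply.
    by apply: le_lt_trans std; exact: cl_lip.
  near=> y; have [xy|/ltW yx] := leP x y.
    rewrite distrC ger0_norm ?subr_ge0 ?Fnd //; apply: one => //.
    suff : `|x - y| < d by rewrite distrC ger0_norm ?subr_ge0.
    by near: y; exact: cvgr_dist_lt.
  rewrite ger0_norm ?subr_ge0 ?Fnd //; apply: one => //.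
  suff : `|x - y| < d by rewrite ger0_norm ?subr_ge0.
  by near: y; exact: cvgr_dist_lt.
pose isC := isCumulative.Build R _ R F Fnd (right_continuousW Fcont).
pose Fc : cumulative R R := HB.pack F isC.
pose nu := lebesgue_stieltjes_measure Fc.
have nuoc s t : s <= t -> nu `]s, t]%classic = (F t - F s)%:E.
  move=> st; rewrite /nu /lebesgue_stieltjes_measure /measure_extension.
  rewrite measurable_mu_extE /=; last exact: is_ocitv.
  by rewrite wlength_itv_bnd.
(* Restriction to a bounded neighbourhood of [[a, b]] makes the Stieltjes measure finite; as [D] is
   open, intersecting with it keeps the covering set [U] open. *)
pose D : set R := `]a - 1, b + 1[%classic.
have mD : measurable (D : set (measurableTypeR R)) by exact: measurable_itv.
have nuD : (nu D < +oo)%E.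
  apply: (@le_lt_trans _ _ (nu (`]a - 1, b + 1]%classic : set R))).
    apply: le_measure; rewrite ?inE //; try exact: measurable_itv.
    by apply: subset_itvl; rewrite bnd_simp.
  by rewrite nuoc ?ltry //; lra.
pose nu' := mfrestr mD nuD.
have dom : nu' `<< mu.
  apply/null_content_dominatesP => A mA A0.
  apply/eqP; rewrite eq_le measure_ge0 andbT; apply/lee_addgt0Pr => e e0.
  rewrite add0e; have [d d0 H] := vac e e0.
  pose A' := A `&` D.
  have mA' : measurable A' by exact: measurableI.
  have A'0 : mu A' = 0%E.
    by apply/eqP; rewrite -measure_le0 -A0 le_measure ?inE //; exact: subIsetl.
  have A'oo : (mu A' < +oo)%E by rewrite A'0 ltry.
  have [U0 [oU0 A'U0 muU0]] := lebesgue_regularity_outer mA' A'oo d0.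
  pose U := U0 `&` D.
  have oU : open U by apply: openI => //; exact: itv_open.
  have A'U : A' `<=` U by move=> x Ax; split; [exact: A'U0|exact: Ax.2].
  have mU : measurable U by exact: open_measurable.
  have muU : (mu U < d%:E)%E.
    apply: (@le_lt_trans _ _ (mu U0)).
      by apply: le_measure; rewrite ?inE //; [exact: open_measurable|exact: subIsetl].
    have -> : U0 = (U0 `\` A') `|` A' by rewrite setUC setDUK.
    apply: (le_lt_trans (measureU2 _ _ _)) => //.
      by apply: measurableD => //; exact: open_measurable.
    by rewrite [X in (_ + X < _)%E]A'0 adde0.
  (* The open cover of the null set splits into countably many disjoint open intervals, and absolute
     continuity bounds every finite partial sum of their Stieltjes measures by [e]. *)
  pose I := open_disjoint_itv oU.
  have UI : U = \bigcup_q I q by exact: open_disjoint_itv_bigcup.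
  have tI : trivIset setT I by exact: open_disjoint_itv_trivIset.
  have mI q : measurable (I q) by apply: open_measurable; exact: open_disjoint_itv_open.
  have IU q : I q `<=` D.
    by move=> x Ix; have [] : U x by rewrite UI; exists q.
  have IE q : I q = [set r | inf (I q) < r < sup (I q)].
    rewrite -interval_bounded_interior; last 3 first.
    - exact: open_disjoint_itv_is_interval.
    - by exists (a - 1) => x /IU; rewrite /D /= in_itv /= => /andP[/ltW].
    - by exists (b + 1) => x /IU; rewrite /D /= in_itv /= => /andP[_ /ltW].
    apply/esym/seteqP; split; first exact: interior_subset.
    by rewrite -open_subsetE //; exact: open_disjoint_itv_open.
  change (nu A' <= e%:E)%E.
  apply: (@le_trans _ _ (nu U)); first by apply: le_measure; rewrite ?inE.
  have mUI : measurable (\bigcup_q I q) by rewrite -UI.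
  have := @measure_semi_sigma_additive _ _ _ nu I mI tI mUI; rewrite -UI => cv.
  rewrite -[X in (X <= _)%E](cvg_lim _ cv) //; apply: lime_le; first by apply/cvg_ex; eexists; exact: cv.
  apply: nearW => n; rewrite big_mkord.
  pose P (q : 'I_n) := I q != set0.
  pose s (q : 'I_n) := inf (I q). pose t (q : 'I_n) := sup (I q).
  have st q : P q -> s q < t q.
    by move=> /set0P[x]; rewrite IE => /andP[]; exact: lt_trans.
  have IE' (q : 'I_n) : I q = `]s q, t q[%classic.
    by rewrite IE; apply/seteqP; split => x /=; rewrite in_itv.
  have st' q : P q -> [/\ a <= cl (s q), cl (s q) <= cl (t q) & cl (t q) <= b].
    by move=> /st/ltW/cl_le h; split => //; [exact: (cl_in _).1|exact: (cl_in _).2].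
  have ap : apart P (cl \o s) (cl \o t).
    move=> q q' Pq Pq' qq' /=.
    have [h|h] := leP (t q) (s q'); first by left; exact: cl_le.
    have [h'|h'] := leP (t q') (s q); first by right; exact: cl_le.
    have := tI q q' Logic.I Logic.I.
    have [x [x1 x2]] : (I q `&` I q') !=set0.
      have [x [h1 h2]] := itv_overlap (st q Pq) (st q' Pq') h h'.
      by exists x; rewrite !IE'; split; rewrite /= in_itv.
    by move=> /(_ (ex_intro _ x (conj x1 x2)))/val_inj/eqP; rewrite (negbTE qq').
  have sm : \sum_(q < n | P q) (t q - s q) < d.
    rewrite -lte_fin; apply: le_lt_trans muU.
    apply: (@le_trans _ _ (\sum_(q < n) mu (I q))).
      rewrite -sumEFin [leRHS](bigID P) /=.
      apply: (@le_trans _ _ (\sum_(q < n | P q) mu (I q))).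
        apply: lee_sum => q Pq; rewrite IE' lebesgue_measure_itv /= lte_fin st //.
      by rewrite leeDl // sume_ge0.
    rewrite -measure_bigsetU //.
    apply: le_measure; rewrite ?inE //.
      by apply: bigsetU_measurable => i _; exact: mI.
    by rewrite UI -bigcup_mkord => x [q _ Iqx]; exists q.
  apply: (@le_trans _ _ (\sum_(q < n | P q) (F (t q) - F (s q)))%:E); last first.
    by rewrite lee_fin; apply/ltW/H => //; apply: le_lt_trans sm; apply: ler_sum => q /st/ltW/cl_lip.
  rewrite -sumEFin (bigID P) /= [X in (_ + X <= _)%E]big1 ?adde0; last first.
    by move=> q; rewrite negbK => /eqP ->; rewrite measure0.
  apply: lee_sum => q Pq; rewrite -nuoc; last exact/ltW/st.
  apply: (@le_measure _ _ _ (lebesgue_stieltjes_measure Fc)); rewrite ?inE //.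
    exact: mI.
  by rewrite IE'; apply: subset_itvl; rewrite bnd_simp.
have [g [g0 gfin gint gE]] := radon_nikodym_sigma_finite dom.
exists (fine \o g); have gg : EFin \o (fine \o g) = g.
  by apply/funext => x /=; rewrite fineK.
rewrite gg; split => // s t as_ st tb.
have h : nu (`]s, t]%classic `&` D) = (\int[mu]_(x in `]s, t]) g x)%E.
  exact: (gE _ (measurable_itv _)).
rewrite setIidl in h; last first.
  by move=> x /=; rewrite /D /= !in_itv /= => /andP[h1 h2]; apply/andP; split; lra.
move: h; rewrite nuoc // /F !cl_id //; try lra.
move=> h; have -> : v t - v s = fine (v t - v s)%:E by [].
rewrite h /Rintegral integral_itv_obnd_cbnd; last first.
  by apply: measurable_funS (measurable_int mu gint).
congr fine; apply: eq_integral => x _; by rewrite /= fineK.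
Unshelve. all: by end_near. Qed.

(** [f] is the difference of its variation function [v] and of [v - f], both nondecreasing and
    absolutely continuous. *)
Theorem abs_continuous_density (f : R -> R) a b : a < b -> abs_continuous f a b ->
  exists g : R -> R, mu.-integrable setT (EFin \o g) /\
    forall s t, a <= s -> s <= t -> t <= b ->
      f t - f s = \int[mu]_(x in `[s, t]) g x.
Proof.
move=> ab fac; have [v [fv vac]] := abs_continuous_varfun (ltW ab) fac.
have [|g1 [ig1 g1E]] := @monotone_ac_density v a b ab _ vac.
  move=> s t h1 h2 h3; have := fv s t h1 h2 h3; have := normr_ge0 (f t - f s); lra.
pose w t := v t - f t.
have wmono s t : a <= s -> s <= t -> t <= b -> w s <= w t.
  move=> h1 h2 h3; have := fv s t h1 h2 h3; have := ler_norm (f t - f s); rewrite /w; lra.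
have wac : forall e, 0 < e ->
     exists2 d : R, 0 < d & forall (J : finType) (P : pred J) (s t : J -> R),
    (forall j, P j -> [/\ a <= s j, s j <= t j & t j <= b]) ->
    apart P s t -> \sum_(j | P j) (t j - s j) < d ->
    \sum_(j | P j) (w (t j) - w (s j)) < e.
  move=> e e0; have e20 : 0 < e / 2 by lra.
  have [d d0 H] := vac _ e20; exists d => // J P s t st ap sd.
  apply: (@le_lt_trans _ _ (2 * \sum_(j | P j) (v (t j) - v (s j)))).
    rewrite mulr_sumr; apply: ler_sum => j Pj; have [h1 h2 h3] := st j Pj.
    have := fv _ _ h1 h2 h3; have := ler_norm (- (f (t j) - f (s j))).
    rewrite normrN /w; lra.
  have := H J P s t st ap sd; lra.
have [g2 [ig2 g2E]] := @monotone_ac_density w a b ab wmono wac.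
exists (fun x => g1 x - g2 x); split.
  rewrite (_ : EFin \o _ = ((EFin \o g1) \- (EFin \o g2))%E) //.
  exact: integrableB.
move=> s t h1 h2 h3; rewrite RintegralB //.
- rewrite -g1E // -g2E // /w; lra.
- exact: integrableS ig1.
- exact: integrableS ig2.
Qed.

(** Inside [[a, b]] the function [f] is an indefinite integral up to the constant [f a], so Lebesgue
    differentiation applies. *)
Lemma abs_continuous_derive (f g : R -> R) a b : a < b -> mu.-integrable setT (EFin \o g) ->
    (forall s t, a <= s -> s <= t -> t <= b ->
      f t - f s = \int[mu]_(x in `[s, t]) g x) ->
  {ae mu, forall x, a < x < b -> derivable f x 1 /\ derive1 f x = g x}.
Proof.
move=> ab ig fE.
have lg : locally_integrable setT g by apply: open_integrable_locally => //; exact: openT.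
have ig' y : mu.-integrable `[a, y] (EFin \o g) by apply: integrableS ig.
have := @FTC1 R g (BLeft a) ig' lg.
move=> /=; apply: filterS; first exact: (ae_filter_ringOfSetsType mu).
move=> x /[swap] /andP[ax xb] /(_ _)[|dF dFE]; first by rewrite lte_fin.
have nr : {near x, (fun y => \int[mu]_(t in `[a, y]) g t + f a) =1 f}.
  near=> y.
  have ay : a <= y by apply/ltW; near: y; exact: lt_nbhsr.
  have yb : y <= b by apply/ltW; near: y; exact: lt_nbhsl.
  by rewrite -fE // subrK.
have nr' : {near x, f =1 (fun y => \int[mu]_(t in `[a, y]) g t + f a)}.
  by apply: filterS nr => y ->.
have [h1 h2] := derivable_addcst (f a) dF.
split; first exact: (near_eq_derivable nr h1).
by rewrite derive1E (near_eq_derive _ nr') // -derive1E h2.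
Unshelve. all: by end_near. Qed.

End AbsCont.

(** * The energy as a supremum and as an integral of squared derivatives *)

Section Energy.
Context {R : realType}.
Local Notation mu := (@lebesgue_measure R).

(* Riesz: this holds if and only if w is absolutely continuous and the integral of
   sum_k (w k)' ^+ 2 over [0, +oo[ is at most 2 * a. *)
Definition energy_le (K : finType) (w : K -> R -> R) (a : R) :=
  forall (J : finType) (s t : J -> R),
    (forall j, 0 <= s j < t j) -> apart xpredT s t ->
    \sum_j \sum_k (w k (t j) - w k (s j)) ^+ 2 / (t j - s j) <= 2 * a.

Lemma energy_le_ge0 (K : finType) (w : K -> R -> R) a : energy_le w a -> 0 <= a.
Proof.
move=> E; have := E void (fun _ => 0) (fun _ => 0); rewrite big1; last by move=> [].
by move=> h; rewrite -(pmulr_rge0 _ (@ltr0Sn R 1)); apply: h => -[].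
Qed.

(** Young's inequality [|D| <= la / 2 * (D ^+ 2 / h) + h / (2 * la)], for an increment [D] over a
    length [h], turns the quadratic bound into a linear one. *)
Lemma energy_abs_continuous (K : finType) (w : K -> R -> R) a k T :
  energy_le w a -> abs_continuous (w k) 0 T.
Proof.
move=> wa e e0.
have a0 := energy_le_ge0 wa.
(* With this weight the energy part is at most [la * a < e / 2], and a total length below [la * e]
   makes the other part smaller than [e / 2]. *)
pose la := e / (2 * (a + 1)).
have la0 : 0 < la by rewrite divr_gt0 //; lra.
exists (la * e) => [|m s t st tr sd]; first by rewrite mulr_gt0.
have st' j : 0 <= s j < t j by have [-> ->] := st j.
have ap : apart xpredT s t.
  move=> i j _ _ ij; have [h|h] := leP (t i) (s j); first by left.
  have [h'|h'] := leP (t j) (s i); first by right.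
  have [x [x1 x2]] : (`]s i, t i[%classic `&` `]s j, t j[%classic) !=set0.
    have [x [h1 h2]] := itv_overlap (proj2 (andP (st' i))) (proj2 (andP (st' j))) h h'.
    by exists x; split; rewrite /= in_itv.
  have := tr i j Logic.I Logic.I (ex_intro _ x (conj x1 x2)).
  by move/eqP; rewrite (negbTE ij).
have := wa _ _ _ st' ap => en.
have le1 : \sum_j (w k (t j) - w k (s j)) ^+ 2 / (t j - s j) <= 2 * a.
  apply: le_trans en; apply: ler_sum => j _; rewrite (bigD1 k) //= lerDl.
  apply: sumr_ge0 => i _; rewrite divr_ge0 ?sqr_ge0 //; have := st' j; lra.
apply: (@le_lt_trans _ _ (\sum_j (la / 2 * ((w k (t j) - w k (s j)) ^+ 2 / (t j - s j))
    + (t j - s j) / (2 * la)))).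
  apply: ler_sum => j _; have /andP[_ lt] := st' j.
  have d0 : 0 < t j - s j by lra.
  set D := w k (t j) - w k (s j).
  have -> : la / 2 * (D ^+ 2 / (t j - s j)) + (t j - s j) / (2 * la) =
     ((la * `|D|) ^+ 2 + (t j - s j) ^+ 2) / (2 * la * (t j - s j)).
    by rewrite exprMn -normrX ger0_norm ?sqr_ge0 //; field; rewrite !gt_eqF.
  rewrite ler_pdivlMr; last by rewrite mulr_gt0 // mulr_gt0.
  have := sqr_ge0 (la * `|D| - (t j - s j)); lra.
rewrite big_split /= -mulr_sumr -mulr_suml.
have : la / 2 * \sum_i (w k (t i) - w k (s i)) ^+ 2 / (t i - s i) <= la * a.
  by rewrite -mulrA ler_pM2l // mulrC ler_pdivrMr // mulrC.
have : (\sum_i (t i - s i)) / (2 * la) < e / 2.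
  rewrite ltr_pdivrMr; last lra.
  by have -> : e / 2 * (2 * la) = la * e by field.
have : la * a < e / 2.
  have <- : la * (a + 1) = e / 2 by rewrite /la; field; rewrite gt_eqF //; lra.
  by rewrite mulrDr mulr1 ltrDl.
lra.
Qed.

(** Both endpoints may move: the grid cells to which this is applied contain the point of
    differentiability anywhere. *)
Lemma derivable_slope (f : R -> R) t e : derivable f t 1 -> 0 < e ->
  exists2 d, 0 < d & forall a b, a <= t -> t <= b -> b - a < d ->
    `|f b - f a - derive1 f t * (b - a)| <= e * (b - a).
Proof.
move=> df e0.
have : (h^-1 *: (f (h + t) - f t)) @[h --> 0^'] --> derive1 f t.
  move: df; rewrite /derivable /derive1 /=.
  rewrite (_ : (fun h => h^-1 *: ((f \o shift t) (h *: 1) - f t)) =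
    (fun h => h^-1 *: (f (h + t) - f t))) //.
  by apply/funext => h /=; rewrite -[h%:A]/(h * 1) mulr1.
move/cvgrPdist_le => /(_ e e0) [d /= d0 H].
have H' h : `|h| < d -> `|f (h + t) - f t - derive1 f t * h| <= e * `|h|.
  move=> hd; have [->|h0] := eqVneq h 0; first by rewrite add0r !subrr mulr0 normr0 mulr0 subrr normr0.
  have := H h; rewrite /ball_ /= sub0r normrN => /(_ hd h0).
  rewrite distrC => h1.
  have -> : f (h + t) - f t - derive1 f t * h =
    (h^-1 *: (f (h + t) - f t) - derive1 f t) * h.
    by rewrite mulrBl [_ *: _]mulrC -mulrA mulVf // mulr1.
  by rewrite normrM ler_pM2r // normr_gt0.
exists d => // a b at_ tb ba.
have := H' (b - t); rewrite subrK ger0_norm ?subr_ge0 // => /(_ _).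
have := H' (a - t); rewrite subrK (@ler0_norm _ (a - t)) ?subr_le0 // => /(_ _).
rewrite opprB.
have h1 : t - a < d by lra. have h2 : b - t < d by lra.
move=> /(_ h1) + /(_ h2).
rewrite !ler_norml => /andP[? ?] /andP[? ?]; apply/andP; split; lra.
Qed.

(** The integral of a nonnegative function is a supremum over the simple functions below it, so
    monotonicity also covers functions of unknown measurability, such as the integrand of [rate]. *)
Lemma le_integral_nonneg (D : set R) (f g : R -> \bar R) :
  (forall x, D x -> (0 <= f x)%E) -> (forall x, D x -> (f x <= g x)%E) ->
  (\int[mu]_(x in D) f x <= \int[mu]_(x in D) g x)%E.
Proof.
move=> f0 fg.
rewrite !ge0_integralE // => [|x Dx]; last by apply: le_trans (fg x Dx); exact: f0.
apply: ereal_sup_le => _ [h /= hf <-]; exists h => // x.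
apply: le_trans (hf x) _; rewrite /patch; case: ifPn => // xD.
by apply: fg; rewrite inE in xD.
Qed.

(** On the null set [Z] the function [f] is arbitrary. It is sandwiched between two measurable
    modifications of [g], one equal to [0] and one to [+oo] on [Z], which have the same integral. *)
Lemma integral_ae_eq_nonneg (D : set R) (f g : R -> \bar R) : measurable D ->
  measurable_fun D g -> (forall x, D x -> (0 <= f x)%E) ->
  (forall x, D x -> (0 <= g x)%E) ->
  {ae mu, forall x, D x -> f x = g x} ->
  (\int[mu]_(x in D) f x = \int[mu]_(x in D) g x)%E.
Proof.
move=> mD mg f0 g0 [Z [mZ Z0 fg]].
have fgZ x : D x -> ~ Z x -> f x = g x.
  by move=> Dx nZ; apply: contrapT => ne; apply: nZ; apply: fg => /(_ Dx).
pose g1 x := (g x * (\1_(~` Z) x)%:E)%E.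
pose g2 x := (g x + +oo * (\1_Z x)%:E)%E.
have m1 (A : set R) : measurable A -> measurable_fun D (fun x => (\1_A x)%:E : \bar R).
  by move=> mA; apply/measurable_EFinP; exact: measurable_indic.
have mg1 : measurable_fun D g1.
  by apply: emeasurable_funM => //; apply: m1; exact: measurableC.
have mg2 : measurable_fun D g2.
  by apply: emeasurable_funD => //; apply: emeasurable_funM => //; exact: m1.
have aeZ (h1 h2 : R -> \bar R) : (forall x, ~ Z x -> h1 x = h2 x) -> ae_eq mu D h1 h2.
  move=> h12; exists Z; split => // x /= /not_implyP[Dx hx].
  by apply: contrapT => /h12.
have i1 x : ~ Z x -> (\1_Z x : R) = 0 by move=> h; rewrite indicE memNset.
have i2 x : ~ Z x -> (\1_(~` Z) x : R) = 1 by move=> h; rewrite indicE mem_set.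
have j1 x : Z x -> (\1_Z x : R) = 1 by move=> h; rewrite indicE mem_set.
have j2 x : Z x -> (\1_(~` Z) x : R) = 0 by move=> h; rewrite indicE memNset //; apply.
have g10 x : D x -> (0 <= g1 x)%E.
  by move=> Dx; apply: mule_ge0; [exact: g0|rewrite lee_fin].
have g20 x : D x -> (0 <= g2 x)%E.
  by move=> Dx; apply: adde_ge0; [exact: g0|apply: mule_ge0 => //; rewrite lee_fin].
apply/le_anti/andP; split.
  rewrite [leRHS](@ge0_ae_eq_integral _ _ _ mu D g g2) //; last first.
    by apply: aeZ => x nZ; rewrite /g2 i1 // mule0 adde0.
  apply: le_integral_nonneg => // x Dx; rewrite /g2.
  have [Zx|nZx] := pselect (Z x).
    rewrite j1 // mule1 addey ?leey //.
    by have := g0 x Dx; case: (g x).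
  by rewrite i1 // mule0 adde0 fgZ.
rewrite [leLHS](@ge0_ae_eq_integral _ _ _ mu D g g1) //; last first.
  by apply: aeZ => x nZ; rewrite /g1 i2 // mule1.
apply: le_integral_nonneg => // x Dx; rewrite /g1.
have [Zx|nZx] := pselect (Z x); first by rewrite j2 // mule0 f0.
by rewrite i2 // mule1 fgZ.
Qed.

Lemma ae_imply (P Q : R -> Prop) : {ae mu, forall x, P x} ->
  (forall x, x != 0 -> P x -> Q x) -> {ae mu, forall x, Q x}.
Proof.
move=> [Z [mZ Z0 hZ]] PQ; exists (Z `|` [set 0]); split.
- by apply: measurableU => //; exact: measurable_set1.
- apply/eqP; rewrite -measure_le0; apply: (le_trans (measureU2 _ _ _)) => //.
  by rewrite [X in (X + _)%E]Z0 add0e [X in (X <= _)%E]lebesgue_measure_set1.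
- move=> x nQ; have [->|x0] := eqVneq x 0; [by right|left].
  by apply: hZ => Px; exact/nQ/PQ.
Qed.

(** The density must be one measurable function for all times. The upper limit of difference
    quotients is measurable and equals the derivative wherever this exists, so it agrees almost
    everywhere with the densities found on [[0, n + 1]]. *)
Lemma abs_continuous_density_ray (u : R -> R) : continuous u ->
  (forall T, 0 < T -> abs_continuous u 0 T) ->
  exists H : R -> R, [/\ measurable_fun setT H,
   forall T, mu.-integrable `[0, T] (EFin \o H),
   forall s t, 0 <= s -> s <= t -> u t - u s = \int[mu]_(x in `[s, t]) H x &
   {ae mu, forall x, 0 < x -> derivable u x 1 /\ derive1 u x = H x}].
Proof.
move=> cu acu.
pose q (n : nat) t := n.+1%:R * (u (t + n.+1%:R^-1) - u t).
pose H t := fine (limn_esup (fun n => (q n t)%:E)).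
have mq n : measurable_fun setT (q n).
  apply: continuous_measurable_fun => x.
  apply: cvgM; first exact: cvg_cst.
  apply: cvgB; last exact: cu.
  suff : {for x, continuous (u \o (fun t => t + n.+1%:R^-1))} by [].
  apply: continuous_comp; last exact: cu.
  by apply: cvgD; [exact: cvg_id|exact: cvg_cst].
have mH : measurable_fun setT H.
  apply: measurableT_comp => //; apply: measurable_fun_limn_esup => n.
  exact/measurable_EFinP.
have HE t : derivable u t 1 -> H t = derive1 u t.
  move=> du; rewrite /H.
  have cq : (q n t)%:E @[n --> \oo] --> (derive1 u t)%:E.
    apply/cvg_EFin; first by near=> n.
    apply/cvgrPdist_le => e e0; have [d d0 Hd] := derivable_slope du e0.
    near=> n; have n0 : 0 < n.+1%:R^-1 :> R by rewrite invr_gt0.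
    have nd : n.+1%:R^-1 < d by near: n; exact: near_infty_natSinv_lt (PosNum d0).
    have := Hd t (t + n.+1%:R^-1) (lexx _).
    rewrite addrAC subrr add0r lerDl => /(_ (ltW n0) nd) h.
    rewrite distrC /q /=.
    have -> : n.+1%:R * (u (t + n.+1%:R^-1) - u t) - derive1 u t =
      n.+1%:R * (u (t + n.+1%:R^-1) - u t - derive1 u t / n.+1%:R).
      by field; rewrite gt_eqF.
    by rewrite normrM ger0_norm // -ler_pdivlMl // [_^-1 * _]mulrC.
  by rewrite (cvg_limn_einf_sup cq).2.
have dens (n : nat) : exists g : R -> R, mu.-integrable setT (EFin \o g) /\
    forall s t, 0 <= s -> s <= t -> t <= n.+1%:R ->
      u t - u s = \int[mu]_(x in `[s, t]) g x.
  by apply: abs_continuous_density => //; exact: acu.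
have {}[g /all_and2[ig gE]] := choice dens.
have aeg n : {ae mu, forall x, 0 < x < n.+1%:R -> derivable u x 1 /\ derive1 u x = g n x}.
  by apply: abs_continuous_derive => //; exact: gE.
have aeHg n : ae_eq mu [set` `[0, n.+1%:R]] (EFin \o H) (EFin \o g n).
  have [Z [mZ Z0 ZP]] := aeg n.
  exists (Z `|` ([set 0] `|` [set n.+1%:R])); split.
  - apply: measurableU => //; apply: measurableU; exact: measurable_set1.
  - apply/eqP; rewrite -measure_le0.
    apply: (le_trans (measureU2 _ _ _)) => //.
      apply: measurableU; exact: measurable_set1.
    rewrite [X in (X + _)%E]Z0 add0e.
    apply: (le_trans (measureU2 _ _ _)); try exact: measurable_set1.
    by rewrite [X in (X + _)%E](lebesgue_measure_set1 (0 : R)) add0e [X in (X <= _)%E]lebesgue_measure_set1.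
  - move=> x /= /not_implyP[]; rewrite in_itv /= => /andP[x0 xn] ne.
    have [->|x0'] := eqVneq x 0; first by right; left.
    have [->|xn'] := eqVneq x n.+1%:R; first by right; right.
    left; apply: ZP => /= h.
    have [|dx dxE] := h; first by rewrite !lt_neqAle x0 xn xn' eq_sym x0'.
    by apply: ne; rewrite HE // dxE.
have igHn n : mu.-integrable `[0, n.+1%:R] (EFin \o H).
  apply/integrableP; split.
    by apply: measurable_funTS; exact/measurable_EFinP.
  rewrite (@ae_eq_integral _ _ _ mu _ (abse \o (EFin \o g n))) //.
  - have /integrableP[_] : mu.-integrable `[0, n.+1%:R] (EFin \o g n) by apply: integrableS (ig n).
    by [].
  - apply: measurableT_comp => //; apply: measurable_funTS; exact/measurable_EFinP.
  - apply: measurableT_comp => //; apply: measurable_funTS; exact: measurable_int (ig n).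
  - exact: ae_eq_comp (aeHg n).
have arch (T : R) : exists n : nat, T <= n.+1%:R.
  by exists (Num.truncn T); exact/ltW/truncnS_gt.
exists H; split => //.
- move=> T; have [n Tn] := arch T; apply: integrableS (igHn n) => //.
  by apply: subset_itvl; rewrite bnd_simp.
- move=> s t s0 st; have [n tn] := arch t.
  rewrite (gE n) //; congr fine.
  apply: ae_eq_integral => //.
  + by apply: measurable_funTS; exact: measurable_int (ig n).
  + by apply: measurable_funTS; exact/measurable_EFinP.
  + apply: ae_eq_sym; apply: ae_eq_subset (aeHg n).
    by move=> x /=; rewrite !in_itv /= => /andP[sx xt]; apply/andP; split; lra.
- apply: (ae_imply (ae_foralln aeg)) => x _ hx x0; have [n xn] := arch (x + 1).
  have [|dx dxE] := hx n; first by rewrite x0 /=; lra.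
  by rewrite HE.
Unshelve. all: by end_near. Qed.

Section Rate.
Variables (K : finType) (u c : K -> R -> R).
Hypothesis cu : forall k, continuous (u k).
Hypothesis cc : forall k, continuous (c k).

Let w k t := u k t - \int[mu]_(x in `[0, t]) c k x.

Lemma continuous_integrable (f : R -> R) s t : continuous f -> mu.-integrable `[s, t] (EFin \o f).
Proof.
move=> cf; apply: continuous_compact_integrable; first exact: segment_compact.
exact: continuous_subspaceT.
Qed.

Lemma integral_increment (f : R -> R) s t : (forall T, mu.-integrable `[0, T] (EFin \o f)) ->
  0 <= s -> s <= t ->
  \int[mu]_(x in `[0, t]) f x - \int[mu]_(x in `[0, s]) f x = \int[mu]_(x in `[s, t]) f x.
Proof.
move=> cf s0 st; rewrite (@Rintegral_itvB _ _ (BLeft 0) (BRight t)) ?bnd_simp //.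
rewrite Rintegral_itv_obnd_cbnd //; apply: integrableS (cf t) => //.
by apply: subset_itvr; rewrite bnd_simp.
Qed.

Lemma integral_bound (f : R -> R) s t m e : continuous f -> s <= t ->
  (forall x, s <= x -> x <= t -> `|f x - m| <= e) ->
  `|\int[mu]_(x in `[s, t]) f x - m * (t - s)| <= e * (t - s).
Proof.
move=> cf st H.
have mE r : \int[mu]_(x in `[s, t]) r = r * (t - s).
  rewrite Rintegral_cst //; congr (_ * _).
  rewrite -[LHS]/(fine (lebesgue_measure (`[s, t]%classic : set R))) lebesgue_measure_itv /= lte_fin.
  by case: ltP => // ts /=; lra.
have ic r : mu.-integrable `[s, t] (EFin \o (fun=> r)).
  by apply: continuous_integrable; exact: cst_continuous.
rewrite -!mE ler_norml -RintegralB //; last exact: continuous_integrable.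
have ib : mu.-integrable `[s, t] (EFin \o (fun x => f x - m)).
  by apply: continuous_integrable => x; apply: cvgB; [exact: cf|exact: cvg_cst].
apply/andP; split; last first.
  apply: le_Rintegral => // x /=; rewrite in_itv /= => /andP[sx xt].
  exact: le_trans (ler_norm _) (H x sx xt).
rewrite mE -mulNr -mE; apply: le_Rintegral => // x /=; rewrite in_itv /= => /andP[sx xt].
by rewrite lerNl; apply: le_trans (H x sx xt); rewrite -normrN ler_norm.
Qed.

(** Cauchy-Schwarz, obtained by integrating the tangent inequality [f ^+ 2 >= 2 * la * f - la ^+ 2]
    at the mean [la] of [f]. Half-open intervals keep touching members of a family disjoint. *)
Lemma square_integral_le (f : R -> R) s t : s < t -> mu.-integrable `[s, t] (EFin \o f) ->
  (((\int[mu]_(x in `[s, t]) f x) ^+ 2 / (t - s))%:E <=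
   \int[mu]_(x in `[s, t[) (f x ^+ 2)%:E)%E.
Proof.
move=> st fi; set I := Rintegral _ _ _.
pose la := I / (t - s).
have d0 : 0 < t - s by lra.
have sub : `[s, t[ `<=` (`[s, t] : set R) by apply: subset_itvl; rewrite bnd_simp.
have fi' : mu.-integrable `[s, t[ (EFin \o f) by exact: integrableS fi.
have mf : measurable_fun `[s, t[ f by apply/measurable_EFinP; exact: measurable_int fi'.
have m2 : measurable_fun `[s, t[ (fun x => (f x ^+ 2)%:E).
  by apply/measurable_EFinP; exact: measurable_funX.
have [->|fin] := eqVneq (\int[mu]_(x in `[s, t[) (f x ^+ 2)%:E)%E +oo%E; first by rewrite leey.
have i2 : mu.-integrable `[s, t[ (fun x => (f x ^+ 2)%:E).
  apply/integrableP; split => //.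
  under eq_integral do rewrite gee0_abs ?lee_fin ?sqr_ge0 //.
  by rewrite ltey.
have ic r : mu.-integrable `[s, t[ (EFin \o (fun=> r)).
  have h : mu.-integrable `[s, t] (EFin \o (fun=> r)).
    by apply: continuous_integrable; exact: cst_continuous.
  exact: integrableS h.
have i1 : mu.-integrable `[s, t[ (EFin \o (fun x => 2 * la * f x)).
  by rewrite (_ : EFin \o _ = (fun x => (2 * la)%:E * (EFin \o f) x)%E) //; exact: integrableZl.
have isub : mu.-integrable `[s, t[ (EFin \o (fun x => 2 * la * f x - la ^+ 2)).
  rewrite (_ : EFin \o _ = ((EFin \o (fun x => 2 * la * f x)%R) \- (EFin \o (fun=> la ^+ 2)%R))%E) //.
  exact: integrableB.
have -> : I ^+ 2 / (t - s) = \int[mu]_(x in `[s, t[) (2 * la * f x - la ^+ 2).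
  rewrite RintegralB // RintegralZl // Rintegral_cst //.
  rewrite [X in _ - _ * X](_ : _ = t - s); last first.
    rewrite -[LHS]/(fine (lebesgue_measure (`[s, t[%classic : set R))).
    by rewrite lebesgue_measure_itv /= lte_fin st.
  rewrite Rintegral_itv_bndo_bndc // -/I /= /la; field; by rewrite gt_eqF.
rewrite /Rintegral fineK; last exact: integrable_fin_num isub.
apply: le_integral => //.
move=> x _; rewrite lee_fin; have := sqr_ge0 (f x - la); lra.
Qed.

(** Cauchy-Schwarz bounds each term of an energy sum by the integral over its interval, and these
    intervals are disjoint. *)
Lemma energy_le_of_rate a : (forall k T, 0 < T -> abs_continuous (u k) 0 T) ->
  (\int[mu]_(t in [set t : R | (0 <= t)%R])
     (\sum_k (derive1 (u k) t - c k t) ^+ 2)%:E <= (2 * a)%:E)%E ->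
  energy_le w a.
Proof.
move=> acu; have {}[H /all_and4[mH iH HE aeH]] :=
  choice (fun k => abs_continuous_density_ray (@cu k) (acu k)).
pose phi t := \sum_k (H k t - c k t) ^+ 2.
have phi0 t : 0 <= phi t by apply: sumr_ge0 => k _; exact: sqr_ge0.
have mHc k : measurable_fun setT (fun t => H k t - c k t).
  apply: measurable_funB => //; exact: continuous_measurable_fun.
have mphi : measurable_fun setT phi.
  by apply: measurable_sum => k; apply: measurable_funX.
have mD : measurable ([set t | (0 <= t)%R] : set R) by rewrite -set_itvcy; exact: measurable_itv.
(* The derivatives are replaced by their measurable versions [H k] before the integral is split. *)
rewrite (@integral_ae_eq_nonneg _ _ (EFin \o phi)) //; last 4 first.
- by apply: measurable_funTS; exact/measurable_EFinP.
- by move=> x _; rewrite lee_fin; apply: sumr_ge0 => k _; exact: sqr_ge0.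
- by move=> x _; rewrite /= lee_fin.
- apply: (ae_imply (filter_forall (ae_filter_ringOfSetsType mu) aeH)) => x x0 hx /= xge.
  congr (_%:E); apply: eq_bigr => k _.
  by rewrite (hx k _).2 // lt_neqAle eq_sym x0.
move=> le J s t st ap.
have wE k j : w k (t j) - w k (s j) = \int[mu]_(x in `[s j, t j]) (H k x - c k x).
  have /andP[s0 lt] := st j.
  rewrite RintegralB //; last 2 first.
    by apply: integrableS (iH k (t j)) => //; apply: subset_itvr; rewrite bnd_simp.
    exact: continuous_integrable.
  rewrite -HE ?(ltW lt) // -integral_increment ?(ltW lt) //; last first.
    by move=> T; exact: continuous_integrable.
  by rewrite /w; ring.
have one j : ((\sum_k (w k (t j) - w k (s j)) ^+ 2 / (t j - s j))%:E <=
    \int[mu]_(x in `[s j, t j[) (phi x)%:E)%E.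
  have /andP[s0 lt] := st j.
  under eq_integral do rewrite /phi -sumEFin.
  rewrite ge0_integral_sum //; last 2 first.
    have mH2 k : measurable_fun setT (fun x => (H k x - c k x) ^+ 2) by exact: measurable_funX.
    by move=> k; apply: measurable_funTS; apply/measurable_EFinP; exact: mH2.
    by move=> k x _; rewrite lee_fin sqr_ge0.
  rewrite -sumEFin; apply: lee_sum => k _; rewrite wE.
  apply: (@square_integral_le (fun x => H k x - c k x)) => //.
  rewrite (_ : EFin \o _ = ((EFin \o H k) \- (EFin \o c k))%E) //.
  apply: integrableB => //; last exact: continuous_integrable.
  by apply: integrableS (iH k (t j)) => //; apply: subset_itvr; rewrite bnd_simp.
rewrite -lee_fin; apply: le_trans le.
rewrite -sumEFin; apply: (@le_trans _ _ (\sum_j (\int[mu]_(x in `[s j, t j[) (phi x)%:E)%E)).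
  by apply: lee_sum.
have tr : trivIset [set` index_enum J] (fun j => `[s j, t j[%classic : set R).
  apply/trivIsetP => i j _ _ ij; apply/seteqP; split => // x [/=];
    rewrite !in_itv /= => /andP[? ?] /andP[? ?].
  by have [] := ap i j isT isT ij; lra.
have mphiA (A : set R) : measurable_fun A (fun x => (phi x)%:E).
  by apply: measurable_funTS; exact/measurable_EFinP.
rewrite -(@ge0_integral_bigsetU _ _ _ mu _ (fun j => `[s j, t j[%classic : set R)) //; last 3 first.
- exact: index_enum_uniq.
- exact: mphiA.
- by move=> x _; rewrite /= lee_fin.
apply: ge0_subset_integral => //.
- by apply: bigsetU_measurable.
- exact: mphiA.
- by move=> x _; rewrite /= lee_fin.
- rewrite -bigcup_seq => x [j _] /=; rewrite in_itv /= => /andP[sx _].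
  by apply: le_trans sx; have /andP[] := st j.
Qed.

(** Fatou's lemma for step functions: the squared difference quotients of [w] on a grid of mesh
    [h n] have integral at most [2 * a] by the energy bound, and they converge at every positive
    time where all [u k] are differentiable. *)
Lemma rate_le_of_energy a : energy_le w a ->
  (forall k T, abs_continuous (u k) 0 T) /\
  (\int[mu]_(t in [set t : R | (0 <= t)%R])
     (\sum_k (derive1 (u k) t - c k t) ^+ 2)%:E <= (2 * a)%:E)%E.
Proof.
move=> wa.
(* [u k] is [w k] plus an integral of [c k], which is bounded on [[0, T]]. *)
have acu k T : abs_continuous (u k) 0 T.
  have [T0|T0] := ltP T 0.
    move=> e e0; exists 1 => // m s t st _ _; rewrite big1 // => i _.
    have [? ? ?] := st i; lra.
  have [M M0 cM] : exists2 M, 0 <= M & forall x, 0 <= x -> x <= T -> `|c k x| <= M.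
    have [z _ zP] := @EVT_max R (fun x => `|c k x|) 0 T T0
      (continuous_subspaceT (fun x => continuous_comp (@cc k x) (@norm_continuous _ _ _))).
    by exists `|c k z| => // x x0 xT; apply: zP; rewrite in_itv /= x0.
  move=> e e0; have e20 : 0 < e / 2 by lra.
  have [d d0 H] := @energy_abs_continuous K w a k T wa _ e20.
  have M10 : 0 < M + 1 by lra.
  exists (Num.min d (e / 2 / (M + 1))); first by rewrite lt_min d0 divr_gt0.
  move=> m s t st tr; rewrite lt_min => /andP[sd sM].
  have := H m s t st tr sd => h1.
  have h2 : \sum_(j < m) (M * (t j - s j)) <= e / 2.
    rewrite -mulr_sumr; move: sM; rewrite ltr_pdivlMr // => sM.
    apply: (le_trans _ (ltW sM)); rewrite mulrC ler_wpM2l //; last lra.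
    by apply: sumr_ge0 => i _; have [] := st i; lra.
  apply: (@le_lt_trans _ _ (\sum_(j < m) (`|w k (t j) - w k (s j)| + M * (t j - s j)))).
    apply: ler_sum => j _; have [h3 h4 h5] := st j.
    have hb x : s j <= x -> x <= t j -> `|c k x - 0| <= M.
      by move=> ? ?; rewrite subr0; apply: cM; lra.
    have := @integral_bound (c k) (s j) (t j) 0 M (@cc k) (ltW h4) hb.
    rewrite mul0r subr0 -integral_increment ?(ltW h4) //; last by move=> ?; exact: continuous_integrable.
    rewrite /w; set I1 := Rintegral _ _ _; set I2 := Rintegral _ _ _ => hh.
    have -> : u k (t j) - u k (s j) = (u k (t j) - I1 - (u k (s j) - I2)) + (I1 - I2) by ring.
    by apply: (le_trans (ler_normD _ _)); rewrite lerD2l.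
  rewrite big_split /=; lra.
split => //.
have {}[H /all_and4[mH iH HE aeH]] :=
  choice (fun k => abs_continuous_density_ray (@cu k) (fun T _ => acu k T)).
pose h (n : nat) : R := n.+1%:R^-1.
have h0 n : 0 < h n by rewrite invr_gt0.
pose sl n (q : nat) k := (w k (q.+1%:R * h n) - w k (q%:R * h n)) / h n.
pose S n q := \sum_k (sl n q k) ^+ 2.
have S0 n q : 0 <= S n q by apply: sumr_ge0 => k _; exact: sqr_ge0.
pose A n (q : nat) : set R := `[q%:R * h n, q.+1%:R * h n[%classic.
(* [(n + 1) ^ 2] cells of length [1 / (n + 1)] cover [[0, n + 1[], so every time is eventually
   covered while the mesh vanishes. *)
pose f n t := (\sum_(q < n.+1 ^ 2) (S n q * \1_(A n q) t)%:E)%E.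
have mA n q : measurable (A n q) by exact: measurable_itv.
pose D : set R := [set t | 0 <= t].
have mD : measurable D by rewrite /D -set_itvcy; exact: measurable_itv.
have msum n q : measurable_fun D (fun t => (S n q * \1_(A n q) t)%:E).
  by apply/measurable_EFinP; apply: measurable_funM => //; exact: measurable_indic.
have sum0 n q t : (0 <= (S n q * \1_(A n q) t)%:E)%E by rewrite lee_fin mulr_ge0.
have mind m q : measurable_fun D (fun t => (\1_(A m q) t)%:E : \bar R).
  by apply/measurable_EFinP; exact: measurable_indic.
have intf m : (\int[mu]_(t in D) f m t <= (2 * a)%:E)%E.
  move: m => n; rewrite /f (ge0_integral_sum mu mD (fun q : 'I_(n.+1 ^ 2) => msum n q) (fun q t _ => sum0 n q t)).
  have -> : (\sum_(q < n.+1 ^ 2) \int[mu]_(t in D) (S n q * \1_(A n q) t)%:E)%E =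
     (\sum_(q < n.+1 ^ 2) (S n q * h n)%:E)%E.
    apply: eq_bigr => q _; under eq_integral do rewrite EFinM.
    rewrite ge0_integralZl //; last 2 first.
      exact: mind.
      by rewrite lee_fin.
    rewrite (integral_indic mu mD (mA n q)) setIidl; last first.
      by move=> x; rewrite /A /D /= in_itv /= => /andP[hx _]; apply: le_trans hx;
        rewrite mulr_ge0 // ltW.
    rewrite [X in (_ * X)%E](_ : _ = (h n)%:E) //.
    rewrite -[LHS]/(lebesgue_measure (A n q)) lebesgue_measure_itv /= lte_fin.
    by rewrite ltr_pM2r // ltr_nat ltnSn -EFinB -mulrBl -natrB // subSnn mul1r.
  rewrite sumEFin lee_fin.
  have := wa 'I_(n.+1 ^ 2)%N (fun q => q%:R * h n) (fun q => q.+1%:R * h n).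
  have st (j : 'I_(n.+1 ^ 2)) : 0 <= j%:R * h n < j.+1%:R * h n.
    by rewrite ltr_pM2r // ltr_nat ltnSn andbT mulr_ge0 // ltW.
  have ap : apart xpredT (fun q : 'I_(n.+1 ^ 2) => q%:R * h n) (fun q => q.+1%:R * h n).
    move=> i j _ _ ij; rewrite !ler_pM2r // !ler_nat.
    by apply/orP; rewrite -neq_ltn.
  move=> /(_ st ap); apply: le_trans; apply: ler_sum => q _.
  rewrite mulr_suml; apply: ler_sum => k _.
  rewrite -mulrBl -natrB // subSnn mul1r /sl.
  by rewrite le_eqVlt; apply/orP; left; apply/eqP; field; rewrite gt_eqF.
pose phi t := \sum_k (derive1 (u k) t - c k t) ^+ 2.
have cvf t : 0 < t -> (forall k, derivable (u k) t 1) -> f n t @[n --> \oo] --> (phi t)%:E.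
  move=> t0 du; pose Q (n : nat) := Num.truncn (t / h n).
  have QP m : (Q m)%:R * h m <= t < (Q m).+1%:R * h m.
    by rewrite -ler_pdivlMr // -ltr_pdivrMr // truncnS_gt andbT truncn_le // divr_ge0 // ltW.
  have cS : (S n (Q n))%:E @[n --> \oo] --> (phi t)%:E.
    apply/cvg_EFin; first by near=> n.
    apply: (@cvg_big R K +%R 0 xpredT add_continuous) => k _.
    suff : sl n (Q n) k @[n --> \oo] --> derive1 (u k) t - c k t.
      by move=> cs; apply: cvgM.
    apply/cvgrPdist_le => e e0; have e20 : 0 < e / 2 by lra.
    have [d1 d10 H1] := derivable_slope (du k) e20.
    have [d2 d20 H2] : exists2 d, 0 < d & forall x, `|x - t| < d -> `|c k x - c k t| <= e / 2.
      have /cvgrPdist_le/(_ _ e20)[d2 /= d20 H2] := @cc k t.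
      by exists d2 => // x xt; rewrite distrC; apply: H2; rewrite /= distrC.
    near=> n; have n1 : h n < d1 by near: n; exact: near_infty_natSinv_lt (PosNum d10).
    have n2 : h n < d2 by near: n; exact: near_infty_natSinv_lt (PosNum d20).
    have /andP[q1 q2] := QP n.
    set a1 := (Q n)%:R * h n in q1 *; set b1 := (Q n).+1%:R * h n in q2 *.
    have ba : b1 - a1 = h n by rewrite /b1 /a1 -mulrBl -natrB // subSnn mul1r.
    have a10 : 0 <= a1 by rewrite /a1 mulr_ge0 // ltW.
    have := H1 a1 b1 q1 (ltW q2); rewrite ba => /(_ n1) h1.
    have ab : a1 <= b1 by lra.
    have hb x : a1 <= x -> x <= b1 -> `|c k x - c k t| <= e / 2.
      by move=> ? ?; apply: H2; rewrite ltr_norml; apply/andP; split; lra.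
    have := @integral_bound (c k) a1 b1 (c k t) (e / 2) (@cc k) ab hb.
    rewrite ba -integral_increment //; last by move=> ?; exact: continuous_integrable.
    move=> h2.
    rewrite distrC /sl -/a1 -/b1.
    have -> : (w k b1 - w k a1) / h n - (derive1 (u k) t - c k t) =
       (u k b1 - u k a1 - derive1 (u k) t * h n -
       (\int[mu]_(x in `[0, b1]) c k x - \int[mu]_(x in `[0, a1]) c k x - c k t * h n)) / h n.
      by rewrite /w; field; rewrite gt_eqF.
    rewrite normrM (gtr0_norm (x := (h n)^-1)) ?invr_gt0 // ler_pdivrMr //.
    apply: (le_trans (ler_normB _ _)); lra.
  apply: cvg_trans cS; apply: near_eq_cvg; near=> n.
  have nt : t < n.+1%:R.
    by apply: (lt_trans (truncnS_gt t)); rewrite ltr_nat ltnS; near: n; exact: nbhs_infty_gt.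
  have /andP[q1 q2] := QP n.
  have Qn : (Q n < n.+1 ^ 2)%N.
    have : (Q n)%:R < n.+1%:R * n.+1%:R :> R.
      by rewrite -(@ltr_pM2r _ (h n)) // /h mulfK ?gt_eqF //; exact: le_lt_trans nt.
    by rewrite -natrM ltr_nat mulnn.
  rewrite /f (bigD1 (Ordinal Qn)) //= big1 ?adde0; last first.
    move=> q qQ; rewrite indicE memNset ?mulr0 //=.
    rewrite /A /= in_itv /= => /andP[z1 z2].
    move: qQ; rewrite -val_eqE /= => /eqP; apply; apply/eqP; rewrite eqn_leq.
    have h1 : q%:R < (Q n).+1%:R :> R by rewrite -(ltr_pM2r (h0 n)); exact: le_lt_trans z1 q2.
    have h2 : (Q n)%:R < q.+1%:R :> R by rewrite -(ltr_pM2r (h0 n)); exact: le_lt_trans q1 z2.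
    by rewrite ltr_nat ltnS in h1; rewrite ltr_nat ltnS in h2; rewrite h1 h2.
  by rewrite indicE mem_set ?mulr1 // /A /= in_itv /= q1 q2.
have mfn n : measurable_fun D (f n) by apply: emeasurable_sum.
have fn0 n t : (0 <= f n t)%E by apply: sume_ge0.
have mlim : measurable_fun D (fun t => limn_einf (f ^~ t)).
  rewrite (_ : (fun t => _) = (fun t => - limn_esup (fun n => - f n t))%E); last first.
    by apply/funext => t; rewrite -limn_einfN; congr limn_einf; apply/funext => n /=; rewrite oppeK.
  apply: measurableT_comp => //; apply: measurable_fun_limn_esup => n.
  exact: measurableT_comp.
rewrite (@integral_ae_eq_nonneg D _ (fun t => limn_einf (f ^~ t))) //.
- apply: (le_trans (fatou mu mD mfn (fun n t _ => fn0 n t))).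
  rewrite limn_einf_lim; apply: lime_le; first exact: is_cvg_einfs.
  apply: nearW => n; apply: (le_trans _ (intf n)).
  by apply: ereal_inf_lbound; exists n => /=.
- by move=> x _; rewrite lee_fin; apply: sumr_ge0 => k _; exact: sqr_ge0.
- move=> x _; rewrite limn_einf_lim; apply: lime_ge; first exact: is_cvg_einfs.
  by apply: nearW => n; apply: le_ereal_inf_tmp => _ [m _ <-].
- apply: (ae_imply (filter_forall (ae_filter_ringOfSetsType mu) aeH)) => x x0 hx /= xge.
  have x0' : 0 < x by rewrite lt_neqAle eq_sym x0.
  by rewrite (cvg_limn_einf_sup (cvf x x0' (fun k => (hx k x0').1))).1.
Unshelve. all: by end_near. Qed.

End Rate.
End Energy.

(** * The curve, the drift and the potential *)

Section Curve.
Context {R : realType}.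

Lemma is_derive_bigsum (I : Type) (r : seq I) (P : pred I) (f : I -> R -> R)
    (df : I -> R) (x : R) : (forall i, P i -> is_derive x 1 (f i) (df i)) ->
  is_derive x 1 (fun t => \sum_(i <- r | P i) f i t) (\sum_(i <- r | P i) df i).
Proof.
move=> H; elim: r => [|i r IH].
  rewrite big_nil (_ : (fun _ => _) = cst 0); first exact: is_derive_cst.
  by apply/funext => t; rewrite big_nil.
rewrite big_cons; case: ifPn => Pi; last first.
  rewrite (_ : (fun _ => _) = (fun t => \sum_(i <- r | P i) f i t)) //.
  by apply/funext => t; rewrite big_cons (negbTE Pi).
rewrite (_ : (fun _ => _) = (f i + (fun t => \sum_(i <- r | P i) f i t))).
  by apply: is_deriveD; exact: H.
by apply/funext => t; rewrite big_cons Pi.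
Qed.

Lemma lipschitz_of_derive (f : R -> R) M s t : (forall s, derivable f s 1) ->
  (forall s, `|derive1 f s| <= M) -> `|f s - f t| <= M * `|s - t|.
Proof.
move=> df fM; wlog st : s t / s <= t.
  move=> H; have [|/ltW] := leP s t; first exact: H.
  by move=> /H; rewrite distrC (distrC t).
have [->|ne] := eqVneq s t; first by rewrite !subrr normr0 mulr0.
have lt : s < t by rewrite lt_neqAle ne.
have [||x _ fE] := @MVT R f (derive1 f) s t lt.
- by move=> x _; rewrite derive1E; apply: derivableP.
- apply: derivable_within_continuous => x _; exact: df.
by rewrite distrC fE normrM (distrC s) ler_wpM2r.
Qed.

Lemma periodic_derive1 (f : R -> R) l s : (forall s, f (s + l) = f s) ->
  derive1 f (s + l) = derive1 f s.
Proof.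
move=> fl; rewrite /derive1.
have -> : (fun h : R => h^-1 *: (f (h + (s + l)) - f (s + l))) =
  (fun h => h^-1 *: (f (h + s) - f s)) by apply/funext => h; rewrite addrA !fl.
by [].
Qed.

Lemma periodic_int (T : Type) (f : R -> T) l (k : int) s : (forall s, f (s + l) = f s) ->
  f (s + k%:~R * l) = f s.
Proof.
move=> fl; have natf (n : nat) t : f (t + n%:R * l) = f t.
  elim: n t => [|n IH] t; first by rewrite mul0r addr0.
  by rewrite -natr1 mulrDl mul1r addrA fl IH.
case: k => n; first exact: natf.
by rewrite NegzE -[LHS](natf n.+1) mulrNz -pmulrn mulNr subrK.
Qed.

Lemma fundamental_domain (l s : R) : 0 < l -> exists k : int, 0 <= s + k%:~R * l < l.
Proof.
move=> l0; exists (- Num.floor (s / l)); rewrite rmorphN /= mulNr.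
have /andP[] := floor_itv (s / l).
rewrite ler_pdivlMr // ltr_pdivrMr // intrD mulrDl mul1r => h1 h2.
by apply/andP; split; lra.
Qed.

Lemma periodic_bounded (f : R -> R) l : 0 < l -> (forall s, f (s + l) = f s) ->
  continuous f -> exists2 M, 0 <= M & forall s, `|f s| <= M.
Proof.
move=> l0 fl cf.
have [z _ zP] := @EVT_max R (fun x => `|f x|) 0 l (ltW l0)
  (continuous_subspaceT (fun x => continuous_comp (@cf x) (@norm_continuous _ _ _))).
exists `|f z| => // s; have [k /andP[k1 k2]] := fundamental_domain s l0.
by rewrite -(periodic_int k s fl); apply: zP; rewrite in_itv /= k1 ltW.
Qed.

Lemma Re_div (a b c d : R) :
  complex.Re ((a +i* b)%C / (c +i* d)%C) = (a * c + b * d) / (c ^+ 2 + d ^+ 2).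
Proof. by rewrite /= ; ring. Qed.

Lemma normc_sqrt (z : R[i]) : normc z = Num.sqrt (complex.Re z ^+ 2 + complex.Im z ^+ 2).
Proof. by case: z. Qed.

(** Passes from the pairs [i < j] of [Venergy] to the sums over [j != i] of the drift. *)
Lemma big_pairs_sym N (F : 'I_N -> 'I_N -> R) :
  \sum_(i < N) \sum_(j < N | (i < j)%N) (F i j + F j i) = \sum_i \sum_(j | j != i) F i j.
Proof.
under eq_bigr do rewrite big_split /=.
rewrite big_split /=.
rewrite [X in _ + X](exchange_big_dep xpredT) //= -big_split /=.
apply: eq_bigr => i _.
rewrite [RHS](bigID (fun j : 'I_N => (i < j)%N)) /=; congr (_ + _); apply: eq_bigl => j.
  rewrite -val_eqE /=; case: ltngtP => //.
by rewrite -val_eqE /=; case: ltngtP.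
Qed.

Variables (Gamma : set (Cplx R)) (l : R) (gamma : R -> Cplx R).
Hypothesis hgamma : arc_length_param Gamma l gamma.

Local Notation p := (fun s => complex.Re (gamma s)).
Local Notation q := (fun s => complex.Im (gamma s)).

Lemma C3_derivable (f : R -> R) : C3 f -> [/\ forall s, derivable f s 1,
  forall s, derivable (derive1 f) s 1 & continuous (derive1 (derive1 f))].
Proof.
move=> [H _]; have h0 := H 0%N; have h1 := H 1%N; have h2 := H 2%N.
rewrite /derive1n /= in h0 h1 h2.
split => s; [exact: h0|exact: h1|].
by apply: differentiable_continuous; apply/derivable1_diffP; exact: h2.
Qed.

Let pD : forall s, derivable p s 1.
Proof. have [h _ _] := C3_derivable (alp_re hgamma); exact: h. Qed.

Let qD : forall s, derivable q s 1.
Proof. have [h _ _] := C3_derivable (alp_im hgamma); exact: h. Qed.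

Let pl s : p (s + l) = p s. Proof. by rewrite /= (alp_periodic hgamma). Qed.
Let ql s : q (s + l) = q s. Proof. by rewrite /= (alp_periodic hgamma). Qed.

Let speed s : derive1 p s ^+ 2 + derive1 q s ^+ 2 = 1.
Proof.
have := alp_speed hgamma s; rewrite /cderive /= => h.
by rewrite -[LHS]sqr_sqrtr ?h ?expr1n // addr_ge0 // sqr_ge0.
Qed.

Let dp1 s : `|derive1 p s| <= 1.
Proof.
rewrite -(@ler_pXn2r _ 2) ?nnegrE // expr1n real_normK ?num_real //.
by rewrite -(speed s) lerDl sqr_ge0.
Qed.

Let dq1 s : `|derive1 q s| <= 1.
Proof.
rewrite -(@ler_pXn2r _ 2) ?nnegrE // expr1n real_normK ?num_real //.
by rewrite -(speed s) lerDr sqr_ge0.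
Qed.

Let plip s t : `|p s - p t| <= `|s - t|.
Proof. by rewrite -[leRHS]mul1r; exact: (@lipschitz_of_derive p 1 s t pD dp1). Qed.

Let qlip s t : `|q s - q t| <= `|s - t|.
Proof. by rewrite -[leRHS]mul1r; exact: (@lipschitz_of_derive q 1 s t qD dq1). Qed.

Let derivable_cont (f : R -> R) : (forall s, derivable f s 1) -> continuous f.
Proof. by move=> df s; apply: differentiable_continuous; apply/derivable1_diffP. Qed.

Lemma curve_bounds : exists2 M, 0 <= M & [/\ forall s, `|p s| <= M, forall s, `|q s| <= M,
  forall s t, `|derive1 p s - derive1 p t| <= M * `|s - t| &
  forall s t, `|derive1 q s - derive1 q t| <= M * `|s - t|].
Proof.
have l0 := alp_length hgamma.
have [_ d2p c2p] := C3_derivable (alp_re hgamma).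
have [_ d2q c2q] := C3_derivable (alp_im hgamma).
have [M1 M10 H1] := periodic_bounded l0 pl (derivable_cont pD).
have [M2 M20 H2] := periodic_bounded l0 ql (derivable_cont qD).
have [M3 M30 H3] := periodic_bounded l0 (fun s => periodic_derive1 s (fun s => periodic_derive1 s pl)) c2p.
have [M4 M40 H4] := periodic_bounded l0 (fun s => periodic_derive1 s (fun s => periodic_derive1 s ql)) c2q.
exists (M1 + M2 + M3 + M4); first by rewrite !addr_ge0.
have le3 (s t : R) : M3 * `|s - t| <= (M1 + M2 + M3 + M4) * `|s - t| by apply: ler_wpM2r => //; lra.
have le4 (s t : R) : M4 * `|s - t| <= (M1 + M2 + M3 + M4) * `|s - t| by apply: ler_wpM2r => //; lra.
split.
- move=> s; have := H1 s; lra.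
- move=> s; have := H2 s; lra.
- by move=> s t; exact: le_trans (@lipschitz_of_derive (derive1 p) M3 s t d2p H3) (le3 s t).
- by move=> s t; exact: le_trans (@lipschitz_of_derive (derive1 q) M4 s t d2q H4) (le4 s t).
Qed.

Definition rho s t : R := normc (gamma s - gamma t).
Definition rho2 s t : R := (p s - p t) ^+ 2 + (q s - q t) ^+ 2.
(** This is the partial derivative of [ln (rho s t)] in [s], where the chord [rho s t] is
    positive. *)
Definition kern s t : R := complex.Re (cderive gamma s / (gamma s - gamma t)).

Lemma rho2_ge0 s t : 0 <= rho2 s t. Proof. by rewrite addr_ge0 // sqr_ge0. Qed.

Lemma rhoE s t : rho s t = Num.sqrt (rho2 s t).
Proof. by rewrite /rho normc_sqrt /rho2; case: (gamma s) => a b; case: (gamma t). Qed.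

Lemma rho_sqr s t : rho s t ^+ 2 = rho2 s t.
Proof. by rewrite rhoE sqr_sqrtr // rho2_ge0. Qed.

Lemma rho_ge0 s t : 0 <= rho s t. Proof. by rewrite rhoE sqrtr_ge0. Qed.

Lemma rhoC s t : rho s t = rho t s.
Proof. by rewrite !rhoE /rho2; congr Num.sqrt; ring. Qed.

Lemma kernE s t : kern s t =
  (derive1 p s * (p s - p t) + derive1 q s * (q s - q t)) / rho2 s t.
Proof.
rewrite /kern /cderive /rho2.
have -> : gamma s - gamma t = ((p s - p t) +i* (q s - q t))%C.
  by case: (gamma s) => a b; case: (gamma t).
exact: Re_div.
Qed.

(** Cauchy-Schwarz with a unit tangent: the tangential component of a chord is at most the chord. *)
Lemma kern_num_le s t :
  `|derive1 p s * (p s - p t) + derive1 q s * (q s - q t)| <= rho s t.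
Proof.
rewrite -(@ler_pXn2r _ 2) ?nnegrE ?rho_ge0 // rho_sqr real_normK ?num_real //.
rewrite -[leRHS]mul1r -(speed s) /rho2.
set a := derive1 _ _; set b := derive1 _ _; set c := _ - _; set d := _ - _.
have := sqr_ge0 (a * d - b * c); nra.
Qed.

Lemma kern_bound e s t : 0 < e -> e <= rho s t -> `|kern s t| <= e^-1.
Proof.
move=> e0 er; have r0 : 0 < rho s t by exact: lt_le_trans er.
apply: (@le_trans _ _ (rho s t)^-1); last by rewrite lef_pV2 ?posrE.
rewrite kernE normrM -rho_sqr normfV [`|_ ^+ 2|]ger0_norm ?sqr_ge0 //.
rewrite expr2 invfM mulrA ler_pdivrMr // mulVf ?gt_eqF // ler_pdivrMr // mul1r.
exact: kern_num_le.
Qed.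

Lemma kern_lipschitz e : 0 < e -> exists2 L, 0 <= L & forall s t s' t',
  e <= rho s t -> e <= rho s' t' ->
  `|kern s t - kern s' t'| <= L * (`|s - s'| + `|t - t'|).
Proof.
move=> e0; have [M M0 [pM qM dpM dqM]] := curve_bounds.
(* Twice the bounds for one coordinate: numerators differ by at most [2 * (2 * M * M + 1) * d] and
   are at most [4 * M], squared chords differ by at most [8 * M * d], where [d] is the displacement;
   denominators are at least [e ^+ 2]. *)
exists ((2 * (2 * M * M + 1)) / e ^+ 2 + (4 * M) * (8 * M) / (e ^+ 2) ^+ 2).
  by rewrite addr_ge0 // divr_ge0 ?sqr_ge0 // !mulr_ge0 // addr_ge0 // !mulr_ge0.
move=> s t s' t' er er'.
set d := `|s - s'| + `|t - t'|; have d0 : 0 <= d by rewrite addr_ge0.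
have e20 : 0 < e ^+ 2 by rewrite exprn_gt0.
have D1 : e ^+ 2 <= rho2 s t by rewrite -rho_sqr ler_pXn2r ?nnegrE ?rho_ge0 // ltW.
have D2 : e ^+ 2 <= rho2 s' t' by rewrite -rho_sqr ler_pXn2r ?nnegrE ?rho_ge0 // ltW.
have half (f : R -> R) : (forall s, `|f s| <= M) ->
   (forall s t, `|f s - f t| <= `|s - t|) -> (forall s, `|derive1 f s| <= 1) ->
   (forall s t, `|derive1 f s - derive1 f t| <= M * `|s - t|) ->
   [/\ `|derive1 f s * (f s - f t) - derive1 f s' * (f s' - f t')| <= (2 * M * M + 1) * d,
     `|(f s - f t) ^+ 2 - (f s' - f t') ^+ 2| <= 4 * M * d &
     `|derive1 f s' * (f s' - f t')| <= 2 * M].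
  move=> fM fl f1 f2.
  have b1 : `|f s - f t| <= 2 * M by apply: (le_trans (ler_normB _ _)); rewrite mulr_natl mulr2n;
    exact: lerD.
  have b2 : `|f s' - f t'| <= 2 * M by apply: (le_trans (ler_normB _ _)); rewrite mulr_natl mulr2n;
    exact: lerD.
  have b3 : `|(f s - f s') - (f t - f t')| <= d.
    by apply: (le_trans (ler_normB _ _)); rewrite lerD.
  have b4 : `|derive1 f s - derive1 f s'| <= M * d.
    by apply: (le_trans (f2 _ _)); rewrite ler_wpM2l // lerDl.
  split.
  - have -> : derive1 f s * (f s - f t) - derive1 f s' * (f s' - f t') =
      (derive1 f s - derive1 f s') * (f s - f t) + derive1 f s' * ((f s - f s') - (f t - f t')) by ring.
    apply: (le_trans (ler_normD _ _)); rewrite !normrM mulrDl mul1r.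
    apply: lerD.
      by rewrite [leRHS](_ : _ = M * d * (2 * M)); [exact: ler_pM|ring].
    by rewrite -[leRHS]mul1r; apply: ler_pM.
  - have -> : (f s - f t) ^+ 2 - (f s' - f t') ^+ 2 =
      ((f s - f s') - (f t - f t')) * ((f s - f t) + (f s' - f t')) by ring.
    rewrite normrM mulrC; apply: ler_pM => //.
    by apply: (le_trans (ler_normD _ _)); lra.
  - by rewrite normrM -[leRHS]mul1r; apply: ler_pM.
have [n1 n2 n3] := half p pM plip dp1 dpM.
have [m1 m2 m3] := half q qM qlip dq1 dqM.
rewrite !kernE.
set n := (X in X / rho2 s t); set n' := (X in X / rho2 s' t').
have -> : n / rho2 s t - n' / rho2 s' t' =
   (n - n') / rho2 s t + n' * (rho2 s' t' - rho2 s t) / (rho2 s t * rho2 s' t').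
  by field; rewrite !gt_eqF //; exact: lt_le_trans e20 _.
apply: (le_trans (ler_normD _ _)); rewrite [leRHS]mulrDl; apply: lerD.
  have -> : 2 * (2 * M * M + 1) / e ^+ 2 * d = (2 * (2 * M * M + 1) * d) / e ^+ 2 by ring.
  rewrite normrM; apply: ler_pM => //.
    rewrite /n /n' opprD addrACA; apply: (le_trans (ler_normD _ _)).
    by rewrite -mulrA mulr_natl mulr2n lerD.
  rewrite normfV ger0_norm ?rho2_ge0 // lef_pV2 ?posrE //; exact: lt_le_trans D1.
rewrite !normrM normfV.
have -> : (4 * M) * (8 * M) / (e ^+ 2) ^+ 2 * d = (4 * M) * (8 * M * d) / (e ^+ 2) ^+ 2 by ring.
apply: ler_pM => //.
- apply: ler_pM => //.
    by rewrite /n'; apply: (le_trans (ler_normD _ _)); lra.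
  rewrite distrC /rho2 opprD addrACA; apply: (le_trans (ler_normD _ _)); lra.
- rewrite lef_pV2 ?posrE ?normr_gt0 ?exprn_gt0 //.
    rewrite normrM !ger0_norm ?rho2_ge0 // expr2; apply: ler_pM => //; exact: ltW.
  by rewrite mulf_neq0 // gt_eqF //; exact: lt_le_trans e20 _.
Qed.

(** The factor [2] is a crude form of [sqrt 2], both coordinates of the curve being 1-Lipschitz. *)
Lemma rho_perturb s t s' t' : rho s' t' <= rho s t + 2 * `|s - s'| + 2 * `|t - t'|.
Proof.
have H a b : rho a b <= 2 * `|a - b|.
  rewrite -(@ler_pXn2r _ 2) ?nnegrE ?rho_ge0 // ?mulr_ge0 // rho_sqr /rho2.
  have h1 : (p a - p b) ^+ 2 <= `|a - b| ^+ 2.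
    by rewrite -[leLHS]real_normK ?num_real // ler_pXn2r ?nnegrE //; exact: plip.
  have h2 : (q a - q b) ^+ 2 <= `|a - b| ^+ 2.
    by rewrite -[leLHS]real_normK ?num_real // ler_pXn2r ?nnegrE //; exact: qlip.
  rewrite exprMn; have := sqr_ge0 `|a - b|; lra.
have -> : rho s' t' = normc ((gamma s' - gamma s) + (gamma s - gamma t) + (gamma t - gamma t')).
  by rewrite /rho; congr normc; ring.
apply: (le_trans (le_normcD _ _));
  apply: (@le_trans _ _ (normc (gamma s' - gamma s) + normc (gamma s - gamma t) + 2 * `|t - t'|)).
  by apply: lerD; [exact: le_normcD|exact: H].
rewrite lerD2r addrC lerD2l distrC; exact: H.
Qed.

Lemma rho_pos_neq s t : gamma s != gamma t -> 0 < rho s t.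
Proof.
move=> st; rewrite lt_neqAle rho_ge0 andbT eq_sym; apply: contra st => /eqP/eq0_normc.
by move=> /eqP; rewrite subr_eq0.
Qed.

(** After reduction to a fundamental domain, equal values would make [(t - s) / l] an integer
    strictly between [0] and [1]. *)
Lemma gamma_inj s t : 0 < t - s < l -> gamma s != gamma t.
Proof.
move=> /andP[st tsl]; have l0 := alp_length hgamma; apply/negP => /eqP g.
have [k kP] := fundamental_domain s l0; have [m mP] := fundamental_domain t l0.
have := alp_inj hgamma kP mP.
rewrite (periodic_int _ _ (alp_periodic hgamma)) (periodic_int _ _ (alp_periodic hgamma)).
move=> /(_ g) e.
have e' : t - s = (k - m)%:~R * l by rewrite rmorphB /= mulrBl; lra.
have h1 : 0 < (k - m)%:~R :> R by rewrite -(pmulr_lgt0 _ l0) -e'.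
have h2 : (k - m)%:~R < 1 :> R by rewrite -(ltr_pM2r l0) mul1r -e'.
rewrite -[1]/(1%:~R) ltr_int in h2; rewrite ltr0z in h1; lia.
Qed.

Lemma is_derive_rho2 (a b va vb tau : R) :
  is_derive tau 1 (fun r : R => rho2 (a + r * va) (b + r * vb))
   (2 * ((p (a + tau * va) - p (b + tau * vb)) *
       (derive1 p (a + tau * va) * va - derive1 p (b + tau * vb) * vb)
     + (q (a + tau * va) - q (b + tau * vb)) *
       (derive1 q (a + tau * va) * va - derive1 q (b + tau * vb) * vb))).
Proof.
have lin c v : is_derive tau 1 (fun r : R => c + r * v) v.
  have -> : (fun r : R => c + r * v) = cst c + (id * cst v).
    by apply/funext => r.
  apply: (is_derive_eq (is_deriveD (is_derive_cst c tau 1)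
     (is_deriveM (is_derive_id tau 1) (is_derive_cst v tau 1)))).
  by rewrite add0r scaler0 add0r [_ *: _]mulr1.
have comp (f : R -> R) c v : (forall s, derivable f s 1) ->
    is_derive tau 1 (fun r => f (c + r * v)) (derive1 f (c + tau * v) * v).
  move=> df; have hf : is_derive (c + tau * v) 1 f (derive1 f (c + tau * v)).
    by rewrite derive1E; exact: derivableP.
  exact: (@is_derive1_comp R f (fun r => c + r * v) tau _ _ hf (lin c v)).
have sq (f g : R -> R) df dg : is_derive tau 1 f df -> is_derive tau 1 g dg ->
    is_derive tau 1 (fun r => (f r - g r) ^+ 2) (2 * (f tau - g tau) * (df - dg)).
  move=> Df Dg; have := is_deriveX 2 (is_deriveB Df Dg); rewrite /= expr1 => h.
  exact: h.
have h1 := sq _ _ _ _ (comp p a va pD) (comp p b vb pD).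
have h2 := sq _ _ _ _ (comp q a va qD) (comp q b vb qD).
have := is_deriveD h1 h2; rewrite -!mulrA -mulrDr; exact.
Qed.

Lemma is_derive_ln_rho (a b va vb tau : R) : 0 < rho (a + tau * va) (b + tau * vb) ->
  is_derive tau 1 (fun r : R => ln (rho (a + r * va) (b + r * vb)))
   (kern (a + tau * va) (b + tau * vb) * va + kern (b + tau * vb) (a + tau * va) * vb).
Proof.
move=> r0; have r20 : 0 < rho2 (a + tau * va) (b + tau * vb) by rewrite -rho_sqr exprn_gt0.
under eq_fun do rewrite rhoE.
have h1 := is_derive_rho2 a b va vb tau.
have h2 := @is_derive1_comp R Num.sqrt (fun r => rho2 (a + r * va) (b + r * vb)) tau _ _ (is_derive1_sqrt r20) h1.
have s0 : 0 < Num.sqrt (rho2 (a + tau * va) (b + tau * vb)) by rewrite sqrtr_gt0.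
have h3 := @is_derive1_comp R (@ln R) (Num.sqrt \o (fun r => rho2 (a + r * va) (b + r * vb))) tau _ _ (is_derive1_ln s0) h2.
apply: (@is_derive_eq _ _ _ _ _ _ _ _ h3).
rewrite !kernE (_ : rho2 (b + _) (a + _) = rho2 (a + tau * va) (b + tau * vb));
  last by rewrite /rho2; ring.
set D := rho2 _ _ in r20 *.
have sD : Num.sqrt D * Num.sqrt D = D by rewrite -expr2 sqr_sqrtr // ltW.
have sD0 : Num.sqrt D != 0 by rewrite gt_eqF // sqrtr_gt0.
rewrite -{3 4}sD; set S := Num.sqrt D; field.
exact: sD0.
Qed.

End Curve.

(** * Separation of particles, drift and potential *)

Section Drift.
Context {R : realType} (N : nat).
Variables (Gamma : set (Cplx R)) (l : R) (gamma : R -> Cplx R).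
Hypothesis hgamma : arc_length_param Gamma l gamma.
Implicit Types y z v : 'rV[R]_N.

Local Notation rho := (rho gamma).

Lemma coord_le_norm z i : `|z 0 i| <= `|z|.
Proof.
rewrite [leRHS](_ : _ = mx_norm z) // mx_normrE.
exact: (le_bigmax 0 (fun ij : 'I_1 * 'I_N => `|z ij.1 ij.2|) (0, i)).
Qed.

Lemma norm_lt_coord z e : 0 < e -> (forall i, `|z 0 i| < e) -> `|z| < e.
Proof.
move=> e0 H; rewrite [ltLHS](_ : _ = mx_norm z) // mx_normrE.
by apply/bigmax_ltP; split => // -[i j] _ /=; rewrite ord1.
Qed.

(** Separation is measured by chords and not by parameters, so that it also excludes the collision
    of the last particle with the first one across the period. *)
Definition sep (e : R) z := forall i j, i != j -> e <= rho (z 0 i) (z 0 j).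

Lemma sepW e e' z : e' <= e -> sep e z -> sep e' z.
Proof. by move=> ee h i j ij; apply: (le_trans ee); exact: h. Qed.

Lemma sep_gt0 e z i j : 0 < e -> sep e z -> i != j -> 0 < rho (z 0 i) (z 0 j).
Proof. by move=> e0 h ij; apply: lt_le_trans (h i j ij). Qed.

Lemma driftE z i : drift gamma z i = \sum_(j < N | j != i) kern gamma (z 0 i) (z 0 j).
Proof. by []. Qed.

Lemma card_le_sum (P : pred 'I_N) (F : 'I_N -> R) c : 0 <= c ->
  (forall j, P j -> F j <= c) -> \sum_(j < N | P j) F j <= N%:R * c.
Proof.
move=> c0 H; apply: (@le_trans _ _ (\sum_(j < N | P j) c)); first exact: ler_sum.
apply: (@le_trans _ _ (\sum_(j < N) c)).
  by rewrite [leRHS](bigID P) /= lerDl; apply: sumr_ge0.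
by rewrite sumr_const card_ord mulr_natl.
Qed.

Lemma drift_bound e z i : 0 < e -> sep e z -> `|drift gamma z i| <= N%:R * e^-1.
Proof.
move=> e0 h; rewrite driftE; apply: (le_trans (ler_norm_sum _ _ _)).
apply: card_le_sum; first by rewrite invr_ge0 ltW.
by move=> j ij; apply: (kern_bound hgamma) => //; apply: h; rewrite eq_sym.
Qed.

Lemma drift_lipschitz e : 0 < e -> exists2 L, 0 <= L & forall y z d,
  sep e y -> sep e z -> (forall j, `|y 0 j - z 0 j| <= d) ->
  forall i, `|drift gamma y i - drift gamma z i| <= L * d.
Proof.
move=> e0; have [L L0 HL] := kern_lipschitz hgamma e0.
exists (N%:R * (2 * L)); first by rewrite !mulr_ge0.
move=> y z d ey ez yz i; have d0 : 0 <= d by exact: le_trans (yz i).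
rewrite !driftE -sumrB; apply: (le_trans (ler_norm_sum _ _ _)); rewrite -mulrA.
apply: card_le_sum; first by rewrite !mulr_ge0.
move=> j ji; apply: (le_trans (HL _ _ _ _ _ _)).
- by apply: ey; rewrite eq_sym.
- by apply: ez; rewrite eq_sym.
have -> : 2 * L * d = L * (d + d) by ring.
by rewrite ler_wpM2l // lerD.
Qed.

Lemma sep_perturb e d y z : sep e z -> (forall j, `|y 0 j - z 0 j| <= d) -> sep (e - 4 * d) y.
Proof.
move=> ez yz i j ij; have := ez i j ij.
have := rho_perturb hgamma (y 0 i) (y 0 j) (z 0 i) (z 0 j).
have := yz i; have := yz j; lra.
Qed.

Lemma Ddom_rho z i j : Ddom l z -> i != j -> 0 < rho (z 0 i) (z 0 j).
Proof.
move=> [D1 D2]; wlog ij : i j / (i < j)%N.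
  move=> H ne; have [lt|lt|e] := ltngtP i j; first exact: H.
    by rewrite rhoC; apply: H => //; rewrite eq_sym.
  by move: ne; rewrite (val_inj e) eqxx.
move=> _; apply: rho_pos_neq; apply: (gamma_inj hgamma).
rewrite subr_gt0 (D1 _ _ ij) /= ltrBlDr.
have N0 : (0 < N)%N by apply: leq_ltn_trans (ltn_ord i).
have Nm : (N.-1 < N)%N by rewrite prednK.
have h1 : z 0 j <= z 0 (Ordinal Nm).
  have [->|ne] := eqVneq j (Ordinal Nm); first by [].
  apply/ltW/D1 => /=; have := ltn_ord j; move: ne N0; rewrite -val_eqE /=.
  by move: (nat_of_ord j) => k; lia.
have h2 : z 0 (Ordinal N0) <= z 0 i.
  have [->|ne] := eqVneq i (Ordinal N0); first by [].
  by apply/ltW/D1 => /=; rewrite lt0n; move: ne; rewrite -val_eqE.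
have := D2 (Ordinal N0) (Ordinal Nm) erefl (prednK N0); lra.
Qed.

Lemma rho_eq0 s t : gamma s = gamma t -> rho s t = 0.
Proof. by move=> e; rewrite rhoE /rho2 e !subrr expr0n addr0 sqrtr0. Qed.

(** Limits of points of [D] satisfy weak inequalities only. An equality would put two particles at
    the same point of the curve, against [sep]; for a single particle the last condition reads
    [0 < l]. *)
Lemma Ddom_closed z e : 0 < e -> sep e z ->
  (forall i j : 'I_N, (i < j)%N -> z 0 i <= z 0 j) ->
  (forall i j : 'I_N, i = 0%N :> nat -> j.+1 = N -> z 0 j <= z 0 i + l) -> Ddom l z.
Proof.
move=> e0 ez h1 h2; split => [i j ij|i j i0 jN].
  rewrite lt_neqAle h1 // andbT; apply/eqP => zz.
  have ne : i != j by rewrite -val_eqE /= ltn_eqF.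
  have := sep_gt0 e0 ez ne; by rewrite rho_eq0 ?ltxx ?zz.
have [ij|ne] := eqVneq i j; first by rewrite ij ltrDl (alp_length hgamma).
rewrite lt_neqAle h2 // andbT; apply/eqP => zz.
have := sep_gt0 e0 ez ne; by rewrite rho_eq0 ?ltxx // zz (alp_periodic hgamma).
Qed.

Lemma is_derive_Venergy z v (tau : R) :
  (forall i j, i != j -> 0 < rho ((z + tau *: v) 0 i) ((z + tau *: v) 0 j)) ->
  is_derive tau 1 (fun r : R => Venergy gamma (z + r *: v))
    (- \sum_i drift gamma (z + tau *: v) i * v 0 i).
Proof.
move=> H.
have -> : (fun r : R => Venergy gamma (z + r *: v)) = - (fun r : R =>
   \sum_(i < N) \sum_(j < N | (i < j)%N) ln (rho (z 0 i + r * v 0 i) (z 0 j + r * v 0 j))).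
  apply/funext => r; rewrite /Venergy; congr (- _).
  by apply: eq_bigr => i _; apply: eq_bigr => j _; rewrite !mxE.
apply: is_deriveN.
have -> : \sum_i drift gamma (z + tau *: v) i * v 0 i =
  \sum_(i < N) \sum_(j < N | (i < j)%N)
   (kern gamma (z 0 i + tau * v 0 i) (z 0 j + tau * v 0 j) * v 0 i
    + kern gamma (z 0 j + tau * v 0 j) (z 0 i + tau * v 0 i) * v 0 j).
  rewrite (big_pairs_sym (fun i j => kern gamma (z 0 i + tau * v 0 i) (z 0 j + tau * v 0 j) * v 0 i)).
  apply: eq_bigr => i _; rewrite driftE mulr_suml.
  by apply: eq_bigr => j _; rewrite !mxE.
apply: is_derive_bigsum => i _; apply: is_derive_bigsum => j ij.
apply: (is_derive_ln_rho hgamma).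
have ne : i != j by rewrite -val_eqE /= ltn_eqF.
by have := H i j ne; rewrite !mxE.
Qed.

Lemma grad_Venergy z i : (forall i j, i != j -> 0 < rho (z 0 i) (z 0 j)) ->
  grad (Venergy gamma) z 0 i = - drift gamma z i.
Proof.
move=> H; rewrite /grad mxE.
pose v : 'rV[R]_N := delta_mx 0 i.
have [|_] := @is_derive_Venergy z v 0; first by rewrite scale0r addr0.
rewrite scale0r addr0 => E.
transitivity (- \sum_j drift gamma z j * v 0 j); last first.
  congr (- _); rewrite (bigD1 i) //= big1 ?addr0; first by rewrite !mxE !eqxx mulr1.
  by move=> j ji; rewrite !mxE (negbTE ji) andbF mulr0.
rewrite -E /derive.
suff -> : (fun h : R => h^-1 *: ((Venergy gamma \o shift z) (h *: v) - Venergy gamma z)) =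
  (fun h : R => h^-1 *: (((fun r : R => Venergy gamma (z + r *: v)) \o shift 0) (h *: 1)
     - Venergy gamma (z + 0 *: v))) by [].
by apply/funext => h /=; rewrite addr0 scale0r addr0 -[h%:A]/(h * 1) mulr1 [z + _]addrC.
Qed.

Lemma Venergy_mvt z y : (forall (tau : R) i j, 0 <= tau <= 1 -> i != j ->
    0 < rho ((z + tau *: (y - z)) 0 i) ((z + tau *: (y - z)) 0 j)) ->
  exists2 tau, 0 <= tau <= 1 & Venergy gamma y - Venergy gamma z =
    - \sum_i drift gamma (z + tau *: (y - z)) i * (y 0 i - z 0 i).
Proof.
move=> H; set v := y - z.
have D (tau : R) : 0 <= tau <= 1 -> is_derive tau 1 (fun r : R => Venergy gamma (z + r *: v))
    (- \sum_i drift gamma (z + tau *: v) i * v 0 i).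
  by move=> t01; apply: is_derive_Venergy => i j; exact: H.
have [||tau t01 E] := @MVT R (fun r : R => Venergy gamma (z + r *: v))
   (fun tau => - \sum_i drift gamma (z + tau *: v) i * v 0 i) 0 1 ltr01.
- by move=> x; rewrite in_itv /= => /andP[/ltW x0 /ltW x1]; apply: D; rewrite x0.
- by apply: derivable_within_continuous => x; rewrite in_itv /= => /D[].
exists tau; first by move: t01; rewrite in_itv /= => /andP[/ltW -> /ltW ->].
have yE : z + 1 *: v = y by rewrite scale1r /v addrC subrK.
move: E; rewrite yE scale0r addr0 subr0 mulr1 => ->.
by congr (- _); apply: eq_bigr => i _; rewrite !mxE.
Qed.

(** Chords are bounded above, so no pair can lower [V] by more than a constant. A bound on [V] thus
    keeps each single chord away from [0]. *)
Lemma Venergy_sep M : exists2 e, 0 < e & forall z,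
  (forall i j, i != j -> 0 < rho (z 0 i) (z 0 j)) -> Venergy gamma z <= M -> sep e z.
Proof.
have [P P0 [pP qP _ _]] := curve_bounds hgamma.
(* [A >= 1] makes [B >= 0], so that sums may be padded with extra terms [B]. *)
pose A := 4 * P + 1.
have A1 : 1 <= A by rewrite /A; lra.
have rA s t : rho s t <= A.
  rewrite -(@ler_pXn2r _ 2) ?nnegrE ?rho_ge0 //; last lra.
  rewrite rho_sqr /rho2.
  have sq (a b : R) : `|a| <= P -> `|b| <= P -> (a - b) ^+ 2 <= (2 * P) ^+ 2.
    move=> aP bP; rewrite -[leLHS]real_normK ?num_real // ler_pXn2r ?nnegrE // ?mulr_ge0 //.
    by apply: (le_trans (ler_normB _ _)); lra.
  have := sq _ _ (pP s) (pP t); have := sq _ _ (qP s) (qP t); rewrite /A; nra.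
pose B := ln A; have B0 : 0 <= B by exact: ln_ge0.
(* The logarithms of the chords sum to at least [- M], and all pairs but one contribute at most
   [N * (N * B)]. *)
exists (expR (- (M + N%:R * (N%:R * B)))); first exact: expR_gt0.
move=> z rz VM i j; wlog ij : i j / (i < j)%N.
  move=> H ne; have [lt|lt|e] := ltngtP i j; first exact: H.
    by rewrite rhoC; apply: H => //; rewrite eq_sym.
  by move: ne; rewrite (val_inj e) eqxx.
move=> ne; have r0 := rz i j ne.
rewrite -[leRHS]lnK // ler_expR lerNl.
have lnB a b : a != b -> ln (rho (z 0 a) (z 0 b)) <= B.
  by move=> ab; rewrite /B ler_ln ?posrE ?rz //; exact: lt_le_trans A1.
have neq (a b : 'I_N) : (a < b)%N -> a != b by move=> h; rewrite -val_eqE /= ltn_eqF.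
move: VM; rewrite /Venergy.
rewrite (bigD1 i) //= (bigD1 j) //= -/(rho (z 0 i) (z 0 j)).
set S1 := \sum_(_ < _ | _) _; set S2 := \sum_(_ < _ | _) _ => VM.
have h1 : S1 <= N%:R * B.
  by apply: card_le_sum => // k /andP[ik _]; apply: lnB; exact: neq.
have h2 : S1 + S2 <= N%:R * (N%:R * B).
  have h2' : S2 <= \sum_(k < N | k != i) N%:R * B.
    apply: ler_sum => k _; apply: card_le_sum => // m km; apply: lnB; exact: neq.
  apply: (@le_trans _ _ (\sum_(k < N) N%:R * B)).
    by rewrite [leRHS](bigD1 i) //= lerD.
  by rewrite sumr_const card_ord [leRHS]mulr_natl.
lra.
Qed.

Section Path.
Variable u : R -> 'rV[R]_N.
Hypothesis cu : continuous u.
Hypothesis uD : forall t, Ddom l (u t).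

Lemma coord_cont i : continuous (fun t => u t 0 i).
Proof.
move=> t; apply: (@continuous_comp _ _ _ u (fun M : 'rV[R]_N => M 0 i)); first exact: cu.
exact: coord_continuous.
Qed.

Lemma gamma_cont : continuous (fun s => complex.Re (gamma s)) /\
  continuous (fun s => complex.Im (gamma s)).
Proof.
have [d1 _ _] := C3_derivable (alp_re hgamma); have [d2 _ _] := C3_derivable (alp_im hgamma).
by split => s; apply: differentiable_continuous; apply/derivable1_diffP; [exact: d1|exact: d2].
Qed.

Lemma rho_path_cont i j : continuous (fun t => rho (u t 0 i) (u t 0 j)).
Proof.
have [cp cq] := gamma_cont.
have -> : (fun t => rho (u t 0 i) (u t 0 j)) = Num.sqrt \o (fun t => rho2 gamma (u t 0 i) (u t 0 j)).
  by apply/funext => t /=; rewrite rhoE.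
move=> t; apply: continuous_comp; last exact: sqrt_continuous.
have H (f : R -> R) k : continuous f -> {for t, continuous (fun t => f (u t 0 k))}.
  move=> cf; apply: (@continuous_comp _ _ _ (fun t => u t 0 k) f); first exact: coord_cont.
  exact: cf.
have sq (f g : R -> R) : {for t, continuous f} -> {for t, continuous g} ->
    {for t, continuous (fun t => (f t - g t) ^+ 2)}.
  move=> cf cg; apply: (@continuous_comp _ _ _ (fun t => f t - g t) (fun x => x ^+ 2)).
    exact: cvgB.
  exact: exprn_continuous.
by apply: cvgD; [exact: sq (H _ i cp) (H _ j cp)|exact: sq (H _ i cq) (H _ j cq)].
Qed.

Lemma path_sep T : 0 <= T -> exists2 e, 0 < e & forall t, 0 <= t <= T -> sep e (u t).
Proof.
move=> T0.
have /choice[e eP] : forall ij : 'I_N * 'I_N, exists e, 0 < e /\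
    (ij.1 != ij.2 -> forall t, 0 <= t <= T -> e <= rho (u t 0 ij.1) (u t 0 ij.2)).
  move=> [i j] /=; have [->|ij] := eqVneq i j; first by exists 1.
  have [c _ cP] := @EVT_min R (fun t => rho (u t 0 i) (u t 0 j)) 0 T T0
     (continuous_subspaceT (@rho_path_cont i j)).
  exists (rho (u c 0 i) (u c 0 j)); split; first exact: Ddom_rho.
  by move=> _ t t0T; apply: cP; rewrite in_itv.
exists (\big[Num.min/1]_ij e ij).
  by apply/bigmin_gtP; split => // ij _; exact: (eP ij).1.
move=> t tT i j ij; apply: (@le_trans _ _ (e (i, j))); first exact: bigmin_le.
exact: (eP (i, j)).2.
Qed.

Lemma drift_cont i : continuous (fun t => drift gamma (u t) i).
Proof.
move=> t.
have [e e0 eP] : exists2 e, 0 < e & sep e (u t).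
  have [e e0 eP] := @Venergy_sep (Venergy gamma (u t)).
  by exists e => //; apply: eP => // a b; exact: Ddom_rho.
have e20 : 0 < e / 2 by lra.
have [L L0 HL] := drift_lipschitz e20.
apply/cvgrPdist_le => eps eps0.
pose d := Num.min (e / 8) (eps / (L + 1)).
have d0 : 0 < d by rewrite lt_min !divr_gt0 //; lra.
near=> s.
have us : forall j, `|u s 0 j - u t 0 j| <= d.
  move=> j; have := coord_le_norm (u s - u t) j; rewrite !mxE => h; apply: (le_trans h).
  by rewrite distrC; near: s; apply: cvgr_dist_le => //; exact: cu.
rewrite distrC; apply: (le_trans (HL _ _ d _ _ us i)).
- apply: sepW (sep_perturb eP us).
  have : d <= e / 8 by rewrite ge_min lexx.
  lra.
- by apply: sepW eP; lra.
have : d <= eps / (L + 1) by rewrite ge_min lexx orbT.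
rewrite ler_pdivlMr; last lra.
nra.
Unshelve. all: by end_near. Qed.

End Path.
End Drift.

(** * The path space *)

Section PathSpace.
Context {R : realType} (N : nat) (l : R) (x : 'rV[R]_N).
Hypothesis hx : Ddom l x.
Implicit Types u v : path_space l x.

Lemma pval0 u : pval u 0 = x.
Proof. by have := set_valP u; rewrite /path_set /= => -[]. Qed.

Lemma pval_neg u t : t < 0 -> pval u t = x.
Proof. by have := set_valP u; rewrite /path_set /= => -[_ + _ _]; apply. Qed.

Lemma pval_continuous u : continuous (pval u).
Proof. by have := set_valP u; rewrite /path_set /= => -[_ _ + _]; apply. Qed.

Lemma pval_Ddom u t : Ddom l (pval u t).
Proof.
have [t0|t0] := ltP t 0; first by rewrite pval_neg.
by have := set_valP u; rewrite /path_set /= => -[_ _ _ +]; apply.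
Qed.

Lemma path_of (f : R -> 'rV[R]_N) : f 0 = x -> (forall t, t < 0 -> f t = x) ->
  continuous f -> (forall t, 0 <= t -> Ddom l (f t)) -> exists u, pval u = f.
Proof.
move=> f0 fn fc fD.
have H : path_set l x f by [].
by exists (exist _ (f : {family initial_segments, R -> 'rV[R]_N}) (mem_set H)).
Qed.

Definition tube u (T e : R) : set (path_space l x) :=
  [set v | forall t, 0 <= t <= T -> `|pval v t - pval u t| < e].

Lemma tube_nbhs u T e : 0 < T -> 0 < e -> nbhs u (tube u T e).
Proof.
move=> T0 e0.
have H : nbhs (set_val u : {family initial_segments, R -> 'rV[R]_N})
    [set g | forall y, (`[0, T]%classic : set R) y -> ball (pval u y) e (g y)].
  apply: (@fam_nbhs R 'rV[R]_N initial_segments `[0, T]%classic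
    [set xy | ball xy.1 e xy.2]); last by exists T.
  by rewrite -entourage_ballE; exists e.
have cv := @initial_continuous (path_space l x) _ set_val u _ H.
apply: (@filterS _ (nbhs u) _ _ _ _ cv) => v vP t t0T.
have := vP t; rewrite /= in_itv /= => /(_ t0T).
by rewrite -ball_normE /= distrC.
Qed.

(** The filter generated by the tubes around [u] converges to [u] uniformly on every [[0, T]], hence
    in the topology of the space, so it contains every open set around [u]. *)
Lemma nbhs_tube u (A : set (path_space l x)) : nbhs u A ->
  exists T e, [/\ 0 < T, 0 < e & tube u T e `<=` A].
Proof.
rewrite nbhsE => -[W [oW Wu] WA]; case: oW => V oV VW.
pose D := [set Te : R * R | 0 < Te.1 /\ 0 < Te.2].
pose B (Te : R * R) : set (R -> 'rV[R]_N) :=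
  [set g | forall t, 0 <= t <= Te.1 -> `|g t - pval u t| < Te.2].
have FF : Filter (filter_from D B).
  apply: filter_from_filter; first by exists (1, 1) => /=; split.
  move=> [T e] [T' e'] [/= T0 e0] [/= T0' e0']; exists (Num.max T T', Num.min e e').
    by split => /=; rewrite ?lt_max ?lt_min ?T0 ?e0.
  move=> g /= gP; split => t /andP[t0 tT] /=.
    by have := gP t; rewrite t0 le_max tT lt_min => /(_ isT) /andP[].
  by have := gP t; rewrite t0 le_max tT orbT lt_min => /(_ isT) /andP[].
have FV : filter_from D B V.
  have : {family initial_segments, filter_from D B --> pval u}.
    apply/fam_cvgP => _ [T T0 ->] P /uniform_nbhs[E [entE EP]].
    move: entE; rewrite -entourage_ballE => -[e /= e0 eE].
    exists (T, e); first by split.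
    move=> g gP; apply: EP => y /= yT; apply: eE => /=.
    by rewrite -ball_normE /= distrC; apply: gP; move: yT; rewrite in_itv.
  apply; apply: open_nbhs_nbhs; split => //.
  by move: Wu; rewrite -VW.
have [[T e] [/= T0 e0] BV] := FV.
exists T, e; split => // v vt; apply: WA; rewrite -VW /=.
by apply: BV => t tT; exact: vt.
Qed.

Lemma path_eq u v : (forall t, 0 <= t -> pval u t = pval v t) -> u = v.
Proof.
move=> H; apply: val_inj; apply/funext => t.
rewrite -[LHS]/(pval u t) -[RHS]/(pval v t).
by have [t0|t0] := ltP t 0; [rewrite !pval_neg|exact: H].
Qed.

Lemma path_space_hausdorff : hausdorff_space (path_space l x).
Proof.
move=> u v uv; apply: path_eq => t t0; apply/eqP; rewrite -subr_eq0 -normr_eq0.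
apply/negP => /negP uvt; pose e := `|pval u t - pval v t| / 2.
have e0 : 0 < e by rewrite divr_gt0 // lt_neqAle eq_sym uvt /=.
have [w [wu wv]] := uv _ _ (@tube_nbhs u (t + 1) e ltac:(lra) e0) (@tube_nbhs v (t + 1) e ltac:(lra) e0).
have tt : 0 <= t <= t + 1 by lra.
have := wu _ tt; have := wv _ tt => h1 h2.
have : `|pval u t - pval v t| < e + e.
  rewrite -(subrKA (pval w t)); apply: (le_lt_trans (ler_normD _ _)).
  by rewrite distrC ltrD.
by rewrite /e -splitr ltxx.
Qed.

End PathSpace.

(** * Continuous induction and dyadic times *)

Section Continuity.
Context {R : realType}.

(* The set of times up to which f stays at most c is relatively open and closed. *)
Lemma continuous_induction (f : R -> R) (a b c : R) : continuous f -> f a < c ->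
  (forall s, a <= s <= b -> (forall r, a <= r <= s -> f r <= c) -> f s < c) ->
  forall s, a <= s <= b -> f s < c.
Proof.
move=> cf fa H s sab; apply: contrapT => /negP; rewrite -leNgt => fs.
pose A := [set r | a <= r <= b /\ c <= f r].
have As : A s by [].
have hA : has_inf A by split; [exists s|exists a => r [/andP[]]].
pose m := inf A.
have am : a <= m by apply: lb_le_inf; [exists s|move=> r [/andP[]]].
have mb : m <= b.
  by apply: (@le_trans _ _ s); [apply: ge_inf => //; case: hA|case/andP: sab].
have mA r : a <= r < m -> f r < c.
  move=> /andP[ar rm]; rewrite ltNge; apply/negP => cr.
  have : m <= r by apply: ge_inf; [case: hA|split => //; rewrite ar /=; apply: ltW;
    exact: lt_le_trans rm mb].
  by rewrite leNgt rm.
have fm : f m < c.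
  have fmc : f m <= c.
    have [ma|] := leP m a; first by rewrite (_ : m = a) ?ltW //; apply/le_anti/andP.
    move=> ma; rewrite leNgt; apply/negP => cm.
    have := cf m => /cvgrPdist_lt /(_ (f m - c)); rewrite subr_gt0 => /(_ cm).
    move=> [d /= d0 dP].
    pose r := Num.max a (m - d / 2).
    have rm : r < m by rewrite gt_max ma /=; lra.
    have mdr : m - d / 2 <= r by rewrite le_max lexx orbT.
    have ar : a <= r by rewrite le_max lexx.
    have := dP r; rewrite /ball_ /= ger0_norm ?subr_ge0 ?(ltW rm) //.
    have -> : m - r < d by lra.
    move=> /(_ isT) h.
    have : f r < c by apply: mA; rewrite ar.
    have := ler_norm (f m - f r); lra.
  apply: H; first by rewrite am.
  move=> r /andP[ar rm]; have [->//|rm'] := eqVneq r m.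
  by apply/ltW/mA; rewrite ar lt_neqAle rm'.
have := cf m => /cvgrPdist_lt /(_ (c - f m)); rewrite subr_gt0 => /(_ fm).
move=> [d /= d0 dP].
have : ~ lbound A (m + d).
  by move=> lA; have := lb_le_inf (ex_intro _ s As) lA; rewrite -/m; lra.
apply => r Ar; rewrite leNgt; apply/negP => rmd.
have mr : m <= r by apply: ge_inf => //; case: hA.
have := dP r; rewrite /ball_ /= distrC ger0_norm ?subr_ge0 //.
have -> : r - m < d by lra.
move=> /(_ isT) h; case: Ar => _ cr.
have := ler_norm (f r - f m); rewrite distrC in h; lra.
Qed.

Definition dyadic (j k : nat) : R := k%:R / 2 ^+ j.

Lemma dyadic_ge0 j k : 0 <= dyadic j k :> R.
Proof. by rewrite divr_ge0 // exprn_ge0. Qed.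

(** Approximation is from below, by the dyadic number preceding [t], so that it stays before [T]. *)
Lemma dyadic_dense (f : R -> R) (T c : R) : continuous f ->
  (forall j k, dyadic j k < T -> f (dyadic j k) <= c) ->
  forall t, 0 <= t < T -> f t <= c.
Proof.
move=> cf H t /andP[t0 tT]; rewrite leNgt; apply/negP => ct.
have := cf t => /cvgrPdist_lt /(_ (f t - c)); rewrite subr_gt0 => /(_ ct).
move=> [d /= d0 dP].
have [j jd] : exists j : nat, 2 ^- j < d.
  exists (Num.truncn d^-1).+1; rewrite invf_plt ?posrE ?exprn_gt0 //.
  apply: (lt_le_trans (truncnS_gt _)); rewrite -natrX ler_nat.
  by apply: ltnW; apply: ltn_expl.
have p0 : 0 < 2 ^+ j :> R by rewrite exprn_gt0.
pose k := Num.truncn (t * 2 ^+ j).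
have k1 : k%:R <= t * 2 ^+ j by rewrite truncn_le // mulr_ge0 // ltW.
have k2 : t * 2 ^+ j < k.+1%:R by exact: truncnS_gt.
have dt : dyadic j k <= t by rewrite ler_pdivrMr.
have td : t - dyadic j k < d.
  apply: le_lt_trans jd; rewrite lerBlDr -[_^-1]mul1r -mulrDl ler_pdivlMr //.
  by rewrite addrC natr1 ltW.
have := dP (dyadic j k); rewrite /ball_ /= ger0_norm ?subr_ge0 // td => /(_ isT) h.
have := H j k (le_lt_trans dt tT).
have := ler_norm (f t - f (dyadic j k)); lra.
Qed.

End Continuity.

(** * Paths of bounded energy *)

Section Grid.
Context {R : realType}.

(** Grid [p] is used with [p * 8 ^ p] cells, which cover [[0, p]]: one parameter governs both the
    mesh and the horizon. *)
Definition node (p k : nat) : R := k%:R / 8 ^+ p.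

Lemma node0 p : node p 0 = 0.
Proof. by rewrite /node mul0r. Qed.

Lemma pow8_gt0 p : 0 < 8 ^+ p :> R.
Proof. by rewrite exprn_gt0. Qed.

Lemma node_ge0 p k : 0 <= node p k.
Proof. by rewrite divr_ge0 // ltW // pow8_gt0. Qed.

Lemma nodeB p j k : (j <= k)%N -> node p k - node p j = (k - j)%:R / 8 ^+ p.
Proof. by move=> jk; rewrite natrB // mulrBl. Qed.

Lemma nodeS p k : node p k.+1 - node p k = 8 ^- p.
Proof. by rewrite nodeB // subSnn mul1r. Qed.

Lemma node_lt p k : node p k < node p k.+1.
Proof. by rewrite -subr_gt0 nodeS invr_gt0 pow8_gt0. Qed.

Lemma node_le p j k : (node p j <= node p k) = (j <= k)%N.
Proof. by rewrite ler_pM2r ?invr_gt0 ?pow8_gt0 // ler_nat. Qed.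

Lemma node_ltE p j k : (node p j < node p k) = (j < k)%N.
Proof. by rewrite ltr_pM2r ?invr_gt0 ?pow8_gt0 // ltr_nat. Qed.

Lemma node_total p : node p (p * 8 ^ p) = p%:R.
Proof. by rewrite /node natrM natrX mulfK // lt0r_neq0 // pow8_gt0. Qed.

Definition cell (p : nat) (t : R) : nat := Num.truncn (t * 8 ^+ p).

Lemma cellP p t : 0 <= t -> node p (cell p t) <= t < node p (cell p t).+1.
Proof.
move=> t0; rewrite ler_pdivrMr ?pow8_gt0 // ltr_pdivlMr ?pow8_gt0 // truncnS_gt andbT.
by rewrite truncn_le // mulr_ge0 // ltW // pow8_gt0.
Qed.

Lemma cell_le p s t : 0 <= s -> s <= t -> (cell p s <= cell p t)%N.
Proof.
move=> s0 st; rewrite -ltnS -(node_ltE p).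
have /andP[h1 _] := cellP p s0; have /andP[_ h2] := cellP p (le_trans s0 st).
exact: le_lt_trans h1 (le_lt_trans st h2).
Qed.

Lemma cell_lt p t : 0 <= t -> t < p%:R -> (cell p t < p * 8 ^ p)%N.
Proof.
move=> t0 tp; rewrite -(node_ltE p) node_total.
by have /andP[h _] := cellP p t0; exact: le_lt_trans tp.
Qed.

Lemma pow2_small (e : R) : 0 < e -> exists p0 : nat, forall p, (p0 <= p)%N -> 2 ^- p <= e.
Proof.
move=> e0; exists (Num.truncn e^-1).+1 => p pp.
rewrite invf_ple ?posrE ?exprn_gt0 //.
apply: (le_trans (ltW (truncnS_gt _))); rewrite -natrX ler_nat.
by apply: (leq_trans pp); apply: ltnW; apply: ltn_expl.
Qed.

Lemma pow8_le p : 8 ^- p <= 2 ^- p :> R.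
Proof. by rewrite lef_pV2 ?posrE ?exprn_gt0 // lerXn2r // ?nnegrE // ler_nat. Qed.

End Grid.

(** * Elementary inequalities and finite sums *)

Section FiniteSums.
Context {R : realType}.

Lemma integral_sub_continuous (f g : R -> R) (t : R) : continuous f -> continuous g ->
  \int[lebesgue_measure]_(r in `[0, t]) (f r - g r) =
  \int[lebesgue_measure]_(r in `[0, t]) f r - \int[lebesgue_measure]_(r in `[0, t]) g r.
Proof.
by move=> cf cg; rewrite RintegralB //; apply: continuous_integrable.
Qed.

Lemma drive_diff_identity (A B C D vt vs ut us b : R) :
  A - B - (C - D) =
  vt - ut - (vs - us) - (vt - b - A - (ut - b - B) - (vs - b - C - (us - b - D))).
Proof. by ring. Qed.

(** One Gronwall step: [A] is the new distance, [B] the old one, [C] and [D] are distances of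
    driving functions. The drift accounts for half of the new bound, [9 * G / 2], and the rest for
    at most [3 * G], so the growth factor [9] leaves a strict inequality. *)
Lemma step_bound (A B C D E G dl : R) : 0 < dl -> dl <= G -> E <= 2^-1 * (9 * G) ->
  `|A - B - (C - D)| <= E -> `|B| <= G -> `|C| <= dl -> `|D| <= dl -> `|A| < 9 * G.
Proof.
move=> dl0 dG EG h hB hC hD; have -> : A = (A - B - (C - D)) + (B + (C - D)) by ring.
have := ler_normD (A - B - (C - D)) (B + (C - D)).
have := ler_normD B (C - D); have := ler_normB C D; lra.
Qed.

Lemma norm_sub_near (a1 a2 b1 b2 e : R) : `|a1 - b1| <= e -> `|a2 - b2| <= e ->
  `|a1 - a2| - 2 * e <= `|b1 - b2|.
Proof.
move=> h1 h2; have -> : a1 - a2 = (a1 - b1) + ((b1 - b2) - (a2 - b2)) by ring.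
have := ler_normD (a1 - b1) ((b1 - b2) - (a2 - b2)); have := ler_normB (b1 - b2) (a2 - b2); lra.
Qed.

(** Cauchy-Schwarz for a telescoping sum, by induction with one completed square. *)
Lemma sqr_telescope_le (f : nat -> R) m n : (m <= n)%N ->
  (f n - f m) ^+ 2 <= (n - m)%:R * \sum_(m <= k < n) (f k.+1 - f k) ^+ 2.
Proof.
elim: n => [|n IH] mn.
  by rewrite (_ : m = 0%N) ?subrr ?expr0n ?subnn ?mul0r //; apply/eqP; rewrite -leqn0.
move: mn; rewrite leq_eqVlt => /predU1P[<-|]; first by rewrite subrr expr0n subnn mul0r.
rewrite ltnS => mn; have := IH mn; rewrite big_nat_recr //= subSn // -natr1.
set S := \sum_(m <= k < n) _; set d := (n - m)%N; set b := f n.+1 - f n => h.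
have -> : f n.+1 - f m = (f n - f m) + b by rewrite /b; ring.
move: (f n - f m) h => c h.
have S0 : 0 <= S by apply: sumr_ge0 => k _; exact: sqr_ge0.
have [d0|d0] := posnP d.
  move: h; rewrite d0 mul0r add0r mul1r => h.
  have : c ^+ 2 == 0 by rewrite eq_le h sqr_ge0.
  by rewrite sqrf_eq0 => /eqP ->; rewrite add0r lerDr.
have dd : 0 < d%:R :> R by rewrite ltr0n.
rewrite -(ler_pM2l dd).
have : 0 <= (c - d%:R * b) ^+ 2 by exact: sqr_ge0.
have : (d%:R + 1) * c ^+ 2 <= (d%:R + 1) * (d%:R * S) by rewrite ler_wpM2l // addr_ge0.
rewrite !expr2; move: (d%:R) dd => D D0; nra.
Qed.

Lemma sum_unique_le (J : finType) (P : pred J) (c : R) : 0 <= c ->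
  (forall i j, P i -> P j -> i = j) -> \sum_(j | P j) c <= c.
Proof.
move=> c0 H; case: (pickP P) => [i Pi|nP]; last by rewrite big_pred0.
rewrite (bigD1 i) //= big1 ?addr0 // => j /andP[Pj]; rewrite (H _ _ Pj Pi) eqxx //.
Qed.

Lemma sum_term_le (J : finType) (F : J -> R) i : (forall j, 0 <= F j) -> F i <= \sum_j F j.
Proof. by move=> F0; rewrite (bigD1 i) //= lerDl sumr_ge0. Qed.

(** After exchanging the sums, each [k] lies in at most one of the ranges. *)
Lemma sum_disjoint_nat (J : finType) (m n : J -> nat) (F : nat -> R) K :
  (forall k, 0 <= F k) -> (forall j, (n j <= K)%N) ->
  (forall i j, i != j -> (n i <= m j)%N || (n j <= m i)%N) ->
  \sum_j \sum_(m j <= k < n j) F k <= \sum_(0 <= k < K) F k.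
Proof.
move=> F0 nK H.
under eq_bigr => j _ do rewrite (big_nat_widen (m j) (n j) K) //=.
under eq_bigr => j _ do rewrite (big_nat_widenl (m j) 0) //.
rewrite (exchange_big_dep xpredT) //=.
apply: ler_sum => k _; apply: sum_unique_le => // i j.
rewrite /= => /andP[ki ik] /andP[kj jk]; apply/eqP/negPn/negP => ij.
by have /orP[] := H i j ij; lia.
Qed.

End FiniteSums.

Section Ultra.
Context {R : realType}.

Lemma ultra_bounded_cvg (E : Type) (U : set_system E) (f : E -> R) (K : R) : UltraFilter U ->
  U [set u | `|f u| <= K] -> exists y : R, f @ U --> y.
Proof.
move=> UU HK; have PU : ProperFilter U by exact: ultra_proper.
have PF : ProperFilter (f @ U) by exact: fmap_proper_filter.
have FK : (f @ U) `[- K, K]%classic.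
  by apply: (@filterS _ U _ _ _ _ HK) => u /= h; rewrite in_itv /= -ler_norml.
have [y [_ yc]] := @segment_compact R (- K) K _ PF FK.
exists y => A yA.
have [//|nA] := in_ultra_setVsetC (f @^-1` A) UU.
by have [z [nAz Az]] := yc (~` A) A nA yA.
Qed.

End Ultra.

(** * Driving functions and the paths that they determine *)

Section Dynamics.
Context {R : realType} (N : nat).
Variables (Gamma : set (Cplx R)) (l : R) (gamma : R -> Cplx R).
Hypothesis hgamma : arc_length_param Gamma l gamma.
Variable x : 'rV[R]_N.
Hypothesis hx : Ddom l x.
Implicit Types u v : path_space l x.

Local Notation sep := (sep gamma).

(* For the solution of the equation with parameter kappa this is the path
   sqrt kappa B. *)
Definition drive u (i : 'I_N) (t : R) : R :=
  pval u t 0 i - x 0 i - \int[lebesgue_measure]_(s in `[0, t]) drift gamma (pval u s) i.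

Lemma drive_def u i t : drive u i t =
  pval u t 0 i - x 0 i - \int[lebesgue_measure]_(s in `[0, t]) drift gamma (pval u s) i.
Proof. by []. Qed.

Lemma pval_drift_cont u i : continuous (fun t => drift gamma (pval u t) i).
Proof. exact: (drift_cont hgamma (@pval_continuous _ _ _ _ u) (pval_Ddom hx u)). Qed.

Lemma pval_coord_cont u i : continuous (fun t => pval u t 0 i).
Proof. exact: (coord_cont (@pval_continuous _ _ _ _ u)). Qed.

Lemma drive_neg u i t : t <= 0 -> drive u i t = 0.
Proof.
move=> t0; rewrite /drive (_ : pval u t = x); last first.
  move: t0; rewrite le_eqVlt => /predU1P[->|]; [exact: pval0|exact: pval_neg].
rewrite subrr sub0r; apply/eqP; rewrite oppr_eq0; apply/eqP.
move: t0; rewrite le_eqVlt => /predU1P[->|t0]; first by rewrite set_itv1 Rintegral_set1.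
by rewrite set_itv_ge ?Rintegral_set0 // bnd_simp -ltNge.
Qed.

Lemma drive0 u i : drive u i 0 = 0.
Proof. exact: drive_neg. Qed.

Lemma drive_incr u i s t m e : 0 <= s -> s <= t ->
  (forall r, s <= r -> r <= t -> `|drift gamma (pval u r) i - m| <= e) ->
  `|pval u t 0 i - pval u s 0 i - (drive u i t - drive u i s) - m * (t - s)| <= e * (t - s).
Proof.
move=> s0 st H.
rewrite (_ : pval u t 0 i - pval u s 0 i - (drive u i t - drive u i s) =
  \int[lebesgue_measure]_(r in `[0, t]) drift gamma (pval u r) i -
   \int[lebesgue_measure]_(r in `[0, s]) drift gamma (pval u r) i); last by rewrite /drive; ring.
rewrite integral_increment //; first exact: (integral_bound (@pval_drift_cont u i)).
by move=> T; apply: continuous_integrable; exact: pval_drift_cont.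
Qed.

Lemma drive_incr0 u i s t e : 0 <= s -> s <= t ->
  (forall r, s <= r -> r <= t -> `|drift gamma (pval u r) i| <= e) ->
  `|pval u t 0 i - pval u s 0 i - (drive u i t - drive u i s)| <= e * (t - s).
Proof.
move=> s0 st H; have := @drive_incr u i s t 0 e s0 st.
by rewrite mul0r subr0; apply => r sr rt; rewrite subr0; exact: H.
Qed.

(** The drift is bounded along the path on [[0, T]], so its integral is Lipschitz there; at negative
    times [drive] is constantly [0]. *)
Lemma drive_cont u i : continuous (drive u i).
Proof.
move=> t; pose T := Num.max t 0 + 1.
have T0 : 0 <= T by rewrite addr_ge0 // le_max lexx orbT.
have [e e0 eP] := path_sep hgamma (@pval_continuous _ _ _ _ u) (pval_Ddom hx u) T0.
pose C := N%:R * e^-1.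
have C0 : 0 <= C by rewrite mulr_ge0 // invr_ge0 ltW.
have uc := @pval_coord_cont u i.
have bnd a b : 0 <= a -> a <= b -> b <= T ->
    `|drive u i b - drive u i a| <= `|pval u b 0 i - pval u a 0 i| + C * (b - a).
  move=> a0 ab bT.
  have := @drive_incr0 u i a b C a0 ab.
  have H r : a <= r -> r <= b -> `|drift gamma (pval u r) i| <= C.
    move=> ar rb; apply: (drift_bound hgamma) => //; apply: eP.
    by rewrite (le_trans a0 ar) (le_trans rb).
  move=> /(_ H) h; rewrite -lerBlDl; apply: le_trans h.
  rewrite [leRHS]distrC; exact: lerB_dist.
have [t0|t0] := ltP t 0.
  rewrite /continuous_at drive_neg ?ltW //; apply: cvg_near_cst.
  by near=> s; apply: drive_neg; apply: ltW; near: s; exact: lt_nbhsl.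
have ineq s : s <= T -> `|drive u i t - drive u i s| <=
   `|pval u t 0 i - pval u s 0 i| + C * `|t - s|.
  move=> sT; have tT : t <= T by rewrite /T;
    have : t <= Num.max t 0 := ltac:(by rewrite le_max lexx); lra.
  have [s0|s0] := leP 0 s.
    have [st|ts] := leP s t; first by rewrite (ger0_norm (_ : 0 <= t - s)) ?subr_ge0 //; exact: bnd.
    have := bnd t s t0 (ltW ts) sT.
    rewrite (_ : `|t - s| = s - t); last by rewrite distrC ger0_norm ?subr_ge0 ?ltW.
    rewrite (_ : `|drive u i t - drive u i s| = `|drive u i s - drive u i t|); last exact: distrC.
    by rewrite (_ : `|pval u t 0 i - pval u s 0 i| = `|pval u s 0 i - pval u t 0 i|); last exact: distrC.
  rewrite (drive_neg _ _ (ltW s0)) (_ : pval u s = pval u 0); last by rewrite pval0 pval_neg.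
  have := bnd 0 t (lexx 0) t0 tT; rewrite drive0 => h; apply: (le_trans h).
  by rewrite lerD2l ler_wpM2l // subr0 ger0_norm ?subr_ge0 //; lra.
apply/cvgrPdist_lt => d d0.
have d20 : 0 < d / 2 by lra.
have dC : 0 < d / 2 / (C + 1) by rewrite divr_gt0 //; lra.
have /cvgrPdist_lt/(_ _ d20) uct := uc t.
have /cvgrPdist_lt/(_ _ dC) idt := @cvg_id R (nbhs t).
near=> s; apply: (le_lt_trans (ineq s _)).
  by apply: ltW; near: s; apply: lt_nbhsl; rewrite /T;
    have : t <= Num.max t 0 := ltac:(by rewrite le_max lexx); lra.
have h1 : `|pval u t 0 i - pval u s 0 i| < d / 2 by near: s; exact: uct.
have h2 : `|t - s| < d / 2 / (C + 1) by near: s; exact: idt.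
have : (C + 1) * `|t - s| < d / 2 by rewrite mulrC -ltr_pdivlMr //; lra.
have := normr_ge0 (t - s); lra.
Unshelve. all: by end_near. Qed.

(** Through this bridge the large deviation bounds are proved for [energy_le], in which no
    derivative occurs. *)
Lemma rate_energy u a : 0 <= a ->
  (rate gamma (pval u) <= a%:E)%E <-> energy_le (drive u) a.
Proof.
move=> a0.
have cu i : continuous (fun t => pval u t 0 i) by exact: pval_coord_cont.
have cc i : continuous (fun t => drift gamma (pval u t) i) by exact: pval_drift_cont.
(* [w] and [drive] differ by the constant [x 0 i], which increments do not see. *)
pose w i t := pval u t 0 i - \int[lebesgue_measure]_(s in `[0, t]) drift gamma (pval u s) i.
have wE : energy_le (drive u) a <-> energy_le w a.
  have E i s t : w i t - w i s = drive u i t - drive u i s by rewrite /w /drive; ring.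
  split => H J s t st ap; have := H J s t st ap; congr (_ <= _);
    by apply: eq_bigr => j _; apply: eq_bigr => k _; rewrite E.
have half (A : \bar R) : ((2^-1)%:E * A <= a%:E)%E = (A <= (2 * a)%:E)%E.
  by rewrite [in RHS]EFinM -lee_pdivrMl.
have sqE : (fun t => (\sum_(i < N) `|derive1 (fun s => pval u s 0 i) t - drift gamma (pval u t) i| ^+ 2)%:E)
   = (fun t => (\sum_(i < N) (derive1 (fun s => pval u s 0 i) t - drift gamma (pval u t) i) ^+ 2)%:E).
  by apply/funext => t; congr EFin; apply: eq_bigr => i _; rewrite real_normK ?num_real.
rewrite wE /rate sqE; split.
  case: ifPn => [/asboolP H|_]; last by rewrite leye_eq.
  rewrite half => h; apply: energy_le_of_rate => // i T T0; exact: H.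
move=> h; have [h1 h2] := rate_le_of_energy cu cc h.
rewrite (_ : `[< _ >] = true) ?half //.
by apply/asboolP => T i _; exact: h1.
Qed.

Lemma drive_diff_incr u v i s t e : 0 <= s -> s <= t ->
  (forall r, s <= r -> r <= t -> `|drift gamma (pval v r) i - drift gamma (pval u r) i| <= e) ->
  `|(pval v t 0 i - pval u t 0 i) - (pval v s 0 i - pval u s 0 i)
    - ((drive v i t - drive u i t) - (drive v i s - drive u i s))| <= e * (t - s).
Proof.
move=> s0 st H.
have cu := @pval_drift_cont u i; have cv := @pval_drift_cont v i.
pose g r := drift gamma (pval v r) i - drift gamma (pval u r) i.
have cg : continuous g by move=> r; apply: cvgB; [exact: cv|exact: cu].
have gB r : s <= r -> r <= t -> `|g r - 0| <= e by move=> r1 r2; rewrite subr0; exact: H.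
have := integral_bound cg st gB; rewrite mul0r subr0.
rewrite -(@integral_increment R g s t _ s0 st); last by move=> T; exact: continuous_integrable.
rewrite /g !(integral_sub_continuous _ cv cu); congr (`|_| <= _).
exact: drive_diff_identity.
Qed.

Section Cell.
Variables (u : path_space l x) (e delta s t : R).
Hypotheses (e0 : 0 < e) (s0 : 0 <= s) (sepu : sep (2 * e) (pval u s)).
Hypothesis osc : forall r i, s <= r <= t -> `|drive u i r - drive u i s| <= delta.
(** Displacement over the cell: the oscillation of the noise plus the drift, at most [N / e] in each
    coordinate, over the length of the cell. The condition [4 * eta < e] matches the loss in
    [sep_perturb]. *)
Let eta := delta + N%:R * e^-1 * (t - s).
Hypothesis eta_e : 4 * eta < e.

Lemma sep_close r : (forall i, `|pval u r 0 i - pval u s 0 i| <= e / 4) -> sep e (pval u r).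
Proof. by move=> H; have := sep_perturb hgamma sepu H; apply: sepW; lra. Qed.

Let cell_step r : s <= r <= t -> (forall r', s <= r' <= r -> `|pval u r' - pval u s| <= e / 4) ->
  forall i, `|pval u r 0 i - pval u s 0 i| <= eta.
Proof.
move=> /andP[sr rt] H i.
have := @drive_incr0 u i s r (N%:R * e^-1) s0 sr.
have sepr r' : s <= r' -> r' <= r -> `|drift gamma (pval u r') i| <= N%:R * e^-1.
  move=> h1 h2; apply: (drift_bound hgamma) => //; apply: sep_close => j.
  have := coord_le_norm (pval u r' - pval u s) j; rewrite !mxE => h; apply: (le_trans h).
  by apply: H; rewrite h1.
move=> /(_ sepr) h.
have := @osc r i; rewrite sr rt => /(_ isT) h'.
have := ler_normD (pval u r 0 i - pval u s 0 i - (drive u i r - drive u i s)) (drive u i r - drive u i s).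
rewrite subrK => h2.
have : N%:R * e^-1 * (r - s) <= N%:R * e^-1 * (t - s).
  by rewrite ler_wpM2l ?lerD2r // mulr_ge0 // invr_ge0 ltW.
rewrite /eta; lra.
Qed.

(** Bootstrap: while the displacement is at most [e / 4], the particles stay [e]-separated, so the
    drift is bounded and the displacement is at most [eta < e / 4]. By continuity it never reaches
    [e / 4]. *)
Lemma cell_confined r i : s <= r <= t -> `|pval u r 0 i - pval u s 0 i| <= eta.
Proof.
move=> /andP[sr rt].
suff H : forall r, s <= r <= t -> `|pval u r - pval u s| < e / 4.
  apply: cell_step; first by rewrite sr.
  by move=> r' /andP[h1 h2]; apply: ltW; apply: H; rewrite h1 (le_trans h2).
apply: (@continuous_induction R (fun r => `|pval u r - pval u s|)).
- move=> q; apply: cvg_norm; apply: cvgB; [exact: pval_continuous|exact: cvg_cst].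
- by rewrite subrr normr0 divr_gt0.
- move=> q sqt H; apply: norm_lt_coord; first by rewrite divr_gt0.
  by move=> j; rewrite !mxE; apply: (le_lt_trans (cell_step sqt H j)); rewrite ltr_pdivlMr // mulrC.
Qed.

Lemma cell_sep r : s <= r <= t -> sep e (pval u r).
Proof.
by move=> srt; apply: sep_close => i; apply: (le_trans (cell_confined i srt));
  rewrite ler_pdivlMr // mulrC ltW.
Qed.

(* Along the drift V decreases at rate |drift|^2, which absorbs the cross term
   with the increment of the noise. *)
Lemma cell_energy (L : R) : s < t -> 0 <= L ->
  (forall (y z : 'rV[R]_N) (d : R), sep e y -> sep e z -> (forall j, `|y 0 j - z 0 j| <= d) ->
     forall i, `|drift gamma y i - drift gamma z i| <= L * d) ->
  Venergy gamma (pval u t) - Venergy gamma (pval u s) <=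
  \sum_(i < N) (drive u i t - drive u i s) ^+ 2 / (4 * (t - s))
    + N%:R * (N%:R * e^-1 * (2 * L * eta)) * (t - s).
Proof.
move=> st L0 HL; set us := pval u s; set ut := pval u t.
have st' : s <= t <= t by rewrite lexx ltW.
have close tau : 0 <= tau <= 1 -> forall j, `|(us + tau *: (ut - us)) 0 j - us 0 j| <= eta.
  move=> /andP[t0 t1] j; rewrite !mxE addrC addKr normrM ger0_norm //.
  have := cell_confined j st'; rewrite -/us -/ut => h.
  by apply: le_trans h; rewrite ler_piMl.
have sepz tau : 0 <= tau <= 1 -> sep e (us + tau *: (ut - us)).
  move=> h; have := sep_perturb hgamma sepu (close tau h); apply: sepW.
  by have := ltW eta_e; move: (4 * eta) => b; lra.
(* The mean value point lies on the straight segment and not on the path, but both stay within [eta]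
   of the start of the cell. The drift there differs from the drift along the path by at most
   [2 * L * eta]. *)
have [tau taui ->] := Venergy_mvt hgamma (fun tau i j h ij => sep_gt0 e0 (sepz tau h) ij).
set z := us + _; have sz : sep e z by exact: sepz.
rewrite -sumrN.
have -> : N%:R * (N%:R * e^-1 * (2 * L * eta)) * (t - s) =
   \sum_(i < N) (N%:R * e^-1 * (2 * L * eta)) * (t - s).
  by rewrite sumr_const card_ord -mulrA mulr_natl.
rewrite -big_split /=; apply: ler_sum => i _.
set dd := drift gamma z i.
have dB : `|dd| <= N%:R * e^-1 by exact: (drift_bound hgamma).
have H r : s <= r -> r <= t -> `|drift gamma (pval u r) i - dd| <= 2 * L * eta.
  move=> sr rt; have srt : s <= r <= t by rewrite sr.
  have h1 := HL _ _ eta (cell_sep srt) (cell_sep (_ : s <= s <= t)) (fun j => cell_confined j srt) i.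
  have h2 := HL _ _ eta sz (cell_sep (_ : s <= s <= t)) (close tau taui) i.
  move: h1 h2; rewrite lexx (ltW st) => /(_ isT) h1 /(_ isT) h2.
  rewrite -(subrKA (drift gamma (pval u s) i)); apply: (le_trans (ler_normD _ _)).
  rewrite [X in _ + X]distrC -[2 * L * eta]mulrA (mulr_natl _ 2) mulr2n.
  exact: lerD h1 h2.
have := @drive_incr u i s t dd (2 * L * eta) s0 (ltW st) H.
rewrite -/us -/ut.
set q := ut 0 i - us 0 i; set w := drive u i t - drive u i s; set h := t - s.
have h0 : 0 < h by rewrite subr_gt0.
set r := q - w - dd * h => rB.
have -> : q = w + dd * h + r by rewrite /r; ring.
have B0 : 0 <= N%:R * e^-1 :> R by rewrite mulr_ge0 // invr_ge0 ltW.
have : `|dd * r| <= N%:R * e^-1 * (2 * L * eta * h) by rewrite normrM ler_pM.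
rewrite ler_norml => /andP[h1 _].
have : 0 <= (w + 2 * dd * h) ^+ 2 / (4 * h) by rewrite divr_ge0 ?sqr_ge0 // mulr_ge0 // ltW.
have -> : (w + 2 * dd * h) ^+ 2 / (4 * h) = w ^+ 2 / (4 * h) + dd * w + dd ^+ 2 * h.
  by field; rewrite lt0r_neq0.
move=> h2; have -> : N%:R * e^-1 * (2 * L * eta) * h = N%:R * e^-1 * (2 * L * eta * h) by ring.
have -> : - (dd * (w + dd * h + r)) = - (dd * w) - dd ^+ 2 * h - dd * r by ring.
lra.
Qed.

End Cell.

(* The mesh 8^-p is so much finer than the tolerance 2^-p that the driving noise
   violates the tolerance with probability about exp (- 2 ^ p / kappa). *)
Definition good (a : R) (p : nat) u : Prop :=
  \sum_(0 <= k < p * 8 ^ p) \sum_(i < N)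
     (drive u i (node p k.+1) - drive u i (node p k)) ^+ 2 <= 2 * a / 8 ^+ p /\
  forall k s i, (k < p * 8 ^ p)%N -> node p k <= s <= node p k.+1 ->
     `|drive u i s - drive u i (node p k)| <= 2 ^- p.

(** Induction over the nodes: by [cell_energy] the potential exceeds its initial value by at most
    [S k / (4 * h)], which [good] bounds by [a / 2], plus an error of at most [1] up to time [T] for
    large [p]. Bounded potential gives the [2 * e] separation that the next cell requires. *)
Lemma good_confined a T : 0 <= T -> exists2 e, 0 < e & exists p0 : nat,
  forall p u, (p0 <= p)%N -> good a p u -> forall t, 0 <= t <= T -> sep e (pval u t).
Proof.
move=> T0; pose M := Venergy gamma x + a / 2 + 1.
have [e2 e20 e2P] := @Venergy_sep R N Gamma l gamma hgamma M.
have [e e2E] : exists e, e2 = 2 * e by exists (e2 / 2); rewrite mulrC divfK.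
have e0 : 0 < e by rewrite e2E in e20; lra.
have [L L0 HL] := @drift_lipschitz R N Gamma l gamma hgamma e e0.
have [C CE] : exists C : R, C = N%:R * e^-1 by eexists.
have C0 : 0 <= C by rewrite CE mulr_ge0 // invr_ge0 ltW.
(* [K * 2 ^- p] bounds the error terms of [cell_energy] accumulated up to time [T]. *)
have [K KE] : exists K, K = T * (N%:R * (C * (2 * L * (1 + C)))) by eexists.
have K0 : 0 <= K by rewrite KE !mulr_ge0 // addr_ge0.
have ep0 : 0 < Num.min (e / (8 * (1 + C))) (1 / (K + 1)).
  by rewrite lt_min !divr_gt0 ?mulr_gt0 //; lra.
have [p1 p1P] := pow2_small ep0.
exists e => //; exists (maxn p1 (Num.truncn T).+1) => p u.
rewrite geq_max => /andP[pp1 pT] [g1 g2].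
have Tp : T < p%:R by apply: lt_le_trans (truncnS_gt T) _; rewrite ler_nat.
have := p1P p pp1; rewrite le_min => /andP[].
set eps : R := 2 ^- p; have eps0 : 0 < eps by rewrite invr_gt0 exprn_gt0.
rewrite ler_pdivlMr ?mulr_gt0 //; last lra.
rewrite ler_pdivlMr; last lra.
move=> small1 small2.
pose h : R := 8 ^- p; have h0 : 0 < h by rewrite invr_gt0 pow8_gt0.
have heps : h <= eps by exact: pow8_le.
have [eta etaE] : exists eta, eta = eps + C * h by eexists.
have eta0 : 0 <= eta by rewrite etaE; apply: addr_ge0; [exact: ltW|apply: mulr_ge0 => //; exact: ltW].
have etaB : eta <= eps * (1 + C) by rewrite etaE mulrDr mulr1 lerD2l mulrC ler_wpM2r.
have eta_e : 4 * eta < e by lra.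
have etaT : T * (N%:R * (C * (2 * L * eta))) <= 1.
  apply: (@le_trans _ _ (eps * K)); last lra.
  rewrite KE; have -> : eps * (T * (N%:R * (C * (2 * L * (1 + C))))) =
     T * (N%:R * (C * (2 * L * (eps * (1 + C))))) by ring.
  by do 5! (rewrite ler_wpM2l //; try by rewrite mulr_ge0).
have kT k : node p k <= T -> (k < p * 8 ^ p)%N.
  by move=> kT; rewrite -(@node_ltE R p) node_total; exact: le_lt_trans Tp.
pose S k := \sum_(0 <= j < k) \sum_(i < N) (drive u i (node p j.+1) - drive u i (node p j)) ^+ 2.
have S0 j k : 0 <= \sum_(j <= j < k) \sum_(i < N) (drive u i (node p j.+1) - drive u i (node p j)) ^+ 2.
  by apply: sumr_ge0 => q _; apply: sumr_ge0 => i _; exact: sqr_ge0.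
have SB k : node p k <= T -> S k / (4 * h) <= a / 2.
  move=> /kT /ltnW kp.
  have : S k <= 2 * a / 8 ^+ p.
    by apply: le_trans g1; rewrite (big_cat_nat _ kp) //= lerDl.
  rewrite -/h => hS; rewrite ler_pdivrMr ?mulr_gt0 //; lra.
have claim k : node p k <= T -> Venergy gamma (pval u (node p k)) <=
    Venergy gamma x + S k / (4 * h) + node p k * (N%:R * (C * (2 * L * eta))) /\
    sep (2 * e) (pval u (node p k)).
  have fin k' : node p k' <= T -> Venergy gamma (pval u (node p k')) <=
    Venergy gamma x + S k' / (4 * h) + node p k' * (N%:R * (C * (2 * L * eta))) ->
    sep (2 * e) (pval u (node p k')).
    move=> k'T hV; rewrite -e2E; apply: e2P.
      by move=> i j; apply: (Ddom_rho hgamma); exact: pval_Ddom.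
    apply: (le_trans hV); rewrite /M lerD //; first by rewrite lerD2l SB.
    apply: le_trans etaT; by rewrite ler_wpM2r // !mulr_ge0.
  elim: k => [|k IH] kT'.
    have V0 : Venergy gamma (pval u (node p 0)) <=
      Venergy gamma x + S 0%N / (4 * h) + node p 0 * (N%:R * (C * (2 * L * eta))).
      by rewrite node0 pval0 /S big_nil !mul0r !addr0.
    by split => //; exact: fin.
  have [hV hsep] := IH (le_trans (ltW (node_lt p k)) kT').
  suff V1 : Venergy gamma (pval u (node p k.+1)) <=
     Venergy gamma x + S k.+1 / (4 * h) + node p k.+1 * (N%:R * (C * (2 * L * eta))).
    by split => //; exact: fin.
  have osc r i : node p k <= r <= node p k.+1 -> `|drive u i r - drive u i (node p k)| <= eps.
    by apply: g2; apply: kT; apply: le_trans kT'; exact: ltW (node_lt p k).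
  have := @cell_energy u e eps (node p k) (node p k.+1) e0 (node_ge0 p k) hsep osc.
  rewrite nodeS -/h -CE -etaE => /(_ eta_e L (node_lt p k) L0 HL).
  rewrite /S big_nat_recr //= -/(S k) -mulr_suml.
  have -> : node p k.+1 = node p k + h by rewrite /h -(nodeS p k); ring.
  move: hV; move: (\sum_(i < N) _) (N%:R * _) (Venergy _ _) (Venergy _ _) (Venergy _ _) => A B V1 V2 V3.
  by rewrite (mulrDl (S k)) (mulrDl (node p k)) (mulrC B); lra.
move=> t /andP[t0 tT].
have /andP[c1 c2] := cellP p t0; set k := cell p t in c1 c2.
have kTT := le_trans c1 tT.
have [_ hsep] := claim k kTT.
have osc r i : node p k <= r <= node p k.+1 -> `|drive u i r - drive u i (node p k)| <= eps.
  by apply: g2; apply: kT.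
apply: (@cell_sep u e eps (node p k) (node p k.+1) e0 (node_ge0 p k) hsep osc).
  by rewrite nodeS -/h -CE -etaE.
by rewrite c1 ltW.
Qed.

(** Endpoints are moved down to nodes, at the cost of [2 ^- p] for each value and [8 ^- p] for the
    length; Cauchy-Schwarz then compares an increment between nodes with the cells in between. *)
Lemma good_energy a p u (J : finType) (s t : J -> R) : good a p u ->
  (forall j, 0 <= s j < t j) -> (forall j, t j < p%:R) -> apart xpredT s t ->
  \sum_j \sum_(i < N) (Num.max 0 (`|drive u i (t j) - drive u i (s j)| - 2 * 2 ^- p)) ^+ 2
     / (t j - s j + 8 ^- p) <= 2 * a.
Proof.
move=> [g1 g2] st tp ap.
pose m j := cell p (s j); pose n j := cell p (t j).
have h0 : 0 < 8 ^- p :> R by rewrite invr_gt0 pow8_gt0.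
have s0 j : 0 <= s j by case/andP: (st j).
have slt j : s j < t j by case/andP: (st j).
have t0 j : 0 <= t j by exact: le_trans (ltW (slt j)).
have mn j : (m j <= n j)%N by apply: cell_le => //; exact: ltW.
have nK j : (n j < p * 8 ^ p)%N by exact: cell_lt.
have mK j : (m j < p * 8 ^ p)%N by exact: leq_ltn_trans (nK j).
pose F k := 8 ^+ p * \sum_(i < N) (drive u i (node p k.+1) - drive u i (node p k)) ^+ 2.
have F0 k : 0 <= F k.
  by rewrite mulr_ge0 ?(ltW (pow8_gt0 p)) //; apply: sumr_ge0 => i _; exact: sqr_ge0.
have -> : 2 * a = 8 ^+ p * (2 * a / 8 ^+ p).
  by rewrite [RHS]mulrC divfK // lt0r_neq0 // pow8_gt0.
apply: (@le_trans _ _ (\sum_(0 <= k < p * 8 ^ p) F k)); last first.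
  by rewrite -mulr_sumr ler_wpM2l // ltW // pow8_gt0.
apply: (@le_trans _ _ (\sum_j \sum_(m j <= k < n j) F k)); last first.
  apply: sum_disjoint_nat => // [j|i j ij]; first exact: ltnW.
  by case: (ap i j isT isT ij) => h; apply/orP; [left|right]; exact: cell_le.
apply: ler_sum => j _; rewrite /F -mulr_sumr exchange_big /= mulr_sumr.
apply: ler_sum => i _.
set A := \sum_(m j <= k < n j) _.
have A0 : 0 <= A by apply: sumr_ge0 => k _; exact: sqr_ge0.
have /andP[m1 m2] := cellP p (s0 j); have /andP[n1 n2] := cellP p (t0 j).
have D0 : 0 < t j - s j + 8 ^- p by rewrite addr_gt0 // subr_gt0.
rewrite ler_pdivrMr //.
have hA := @sqr_telescope_le R (fun k => drive u i (node p k)) _ _ (mn j).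
have hnm : (n j - m j)%:R <= 8 ^+ p * (t j - s j + 8 ^- p).
  rewrite mulrC -ler_pdivrMr ?pow8_gt0 // -nodeB //.
  have mS : node p (m j).+1 =
    node p (m j) + 8 ^- p :> R by rewrite -[LHS](subrK (node p (m j))) nodeS addrC.
  by rewrite -/(n j) in n1; rewrite -/(m j) mS in m2; lra.
apply: (@le_trans _ _ ((drive u i (node p (n j)) - drive u i (node p (m j))) ^+ 2)); last first.
  apply: (le_trans hA); apply: (le_trans (ler_wpM2r A0 hnm)).
  by rewrite -!mulrA (mulrC A).
have e1 := @g2 (n j) (t j) i (nK j); rewrite n1 (ltW n2) in e1; have {}e1 := e1 isT.
have e2 := @g2 (m j) (s j) i (mK j); rewrite m1 (ltW m2) in e2; have {}e2 := e2 isT.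
rewrite -[leRHS]real_normK ?num_real // lerXn2r ?nnegrE ?le_max ?lexx //.
rewrite ge_max normr_ge0 /=.
exact: norm_sub_near.
Qed.

Lemma good_ge0 a p u : good a p u -> 0 <= a.
Proof.
move=> [g _]; have : 0 <= 2 * a / 8 ^+ p.
  by apply: le_trans g; apply: sumr_ge0 => k _; apply: sumr_ge0 => i _; exact: sqr_ge0.
by rewrite pmulr_lge0 ?invr_gt0 ?pow8_gt0 // pmulr_rge0.
Qed.

(** A single interval in [good_energy]: the square-root modulus of finite energy, up to terms that
    vanish as [p] grows. *)
Lemma good_drive_incr a p u s t i : good a p u -> 0 <= s -> s < t -> t < p%:R ->
  `|drive u i t - drive u i s| <= Num.sqrt (2 * a * (t - s + 8 ^- p)) + 2 * 2 ^- p.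
Proof.
move=> g s0 st tp.
have h0 : 0 < 8 ^- p :> R by rewrite invr_gt0 pow8_gt0.
have D0 : 0 < t - s + 8 ^- p by rewrite addr_gt0 // subr_gt0.
have := @good_energy a p u unit (fun _ => s) (fun _ => t) g.
rewrite s0 st => /(_ (fun _ => isT) (fun _ => tp)).
have ap : apart (xpredT : pred unit) (fun _ => s) (fun _ => t) by move=> [] [].
move=> /(_ ap) h.
set w := Num.max 0 (`|drive u i t - drive u i s| - 2 * 2 ^- p).
have : w ^+ 2 / (t - s + 8 ^- p) <= 2 * a.
  apply: le_trans h.
  have F0 j : 0 <= Num.max 0 (`|drive u j t - drive u j s| - 2 * 2 ^- p) ^+ 2 / (t - s + 8 ^- p).
    by rewrite divr_ge0 ?sqr_ge0 // ltW.
  apply: le_trans (sum_term_le i F0) _.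
  rewrite [leRHS](bigD1 tt) //= lerDl; apply: sumr_ge0 => -[] _.
  by apply: sumr_ge0 => j _; exact: F0.
rewrite ler_pdivrMr // => h'.
rewrite -lerBlDr; apply: (@le_trans _ _ w); first by rewrite le_max lexx orbT.
have w0 : 0 <= w by rewrite le_max lexx.
by rewrite -(ger0_norm w0) -sqrtr_sqr ler_wsqrtr.
Qed.

Lemma good_incr a T : 0 <= T -> exists2 C, 0 <= C & exists p0 : nat,
  forall p u, (p0 <= p)%N -> good a p u -> forall s t i, 0 <= s -> s <= t -> t <= T ->
  `|pval u t 0 i - pval u s 0 i| <= Num.sqrt (2 * a * (t - s + 8 ^- p)) + 2 * 2 ^- p + C * (t - s).
Proof.
move=> T0; have [e e0 [p1 p1P]] := good_confined a T0.
exists (N%:R * e^-1); first by rewrite mulr_ge0 // invr_ge0 ltW.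
exists (maxn p1 (Num.truncn T).+1) => p u; rewrite geq_max => /andP[pp1 pT] g s t i s0 st tT.
have Tp : T < p%:R by apply: lt_le_trans (truncnS_gt T) _; rewrite ler_nat.
move: st; rewrite le_eqVlt => /predU1P[->|st].
  by rewrite !subrr normr0 mulr0 addr0 addr_ge0 ?sqrtr_ge0 // mulr_ge0 // invr_ge0 exprn_ge0.
have h := good_drive_incr i g s0 st (le_lt_trans tT Tp).
have := @drive_incr0 u i s t (N%:R * e^-1) s0 (ltW st).
have H r : s <= r -> r <= t -> `|drift gamma (pval u r) i| <= N%:R * e^-1.
  move=> sr rt; apply: (drift_bound hgamma) => //; apply: (p1P p u) => //.
  by rewrite (le_trans s0 sr) (le_trans rt).
move=> /(_ H) h'.
have := ler_normD (pval u t 0 i - pval u s 0 i - (drive u i t - drive u i s)) (drive u i t - drive u i s).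
rewrite subrK; lra.
Qed.

Lemma good_equicontinuous a T eps : 0 <= T -> 0 < eps -> exists2 d, 0 < d & exists p0 : nat,
  forall p u, (p0 <= p)%N -> good a p u -> forall s t i, 0 <= s -> s <= t -> t <= T ->
  t - s <= d -> `|pval u t 0 i - pval u s 0 i| <= eps.
Proof.
move=> T0 eps0; have [C C0 [p1 p1P]] := good_incr a T0.
pose A := `|a| + 1; have A0 : 0 < A by rewrite /A ltr_wpDl.
have d10 : 0 < (eps / 4) ^+ 2 / (4 * A) by rewrite divr_gt0 ?exprn_gt0 ?mulr_gt0 ?divr_gt0.
have d20 : 0 < eps / (4 * (C + 1)) by rewrite divr_gt0 // mulr_gt0 //; lra.
have [p2 p2P] := pow2_small d10.
have e80 : 0 < eps / 8 by rewrite divr_gt0.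
have [p3 p3P] := pow2_small e80.
exists (Num.min ((eps / 4) ^+ 2 / (4 * A)) (eps / (4 * (C + 1)))); first by rewrite lt_min d10.
exists (maxn p1 (maxn p2 p3)) => p u; rewrite !geq_max => /and3P[pp1 pp2 pp3] g s t i s0 st tT.
rewrite le_min => /andP[].
rewrite ler_pdivlMr; last by rewrite mulr_gt0.
rewrite ler_pdivlMr; last by rewrite mulr_gt0 //; lra.
move=> ts1 ts2; apply: (le_trans (p1P p u pp1 g s t i s0 st tT)).
have h3 := p3P p pp3.
have h2 : 8 ^- p * (4 * A) <= (eps / 4) ^+ 2.
  by rewrite -ler_pdivlMr ?mulr_gt0 //; apply: (le_trans (pow8_le p)); exact: p2P.
have aA : a <= A by rewrite /A (le_trans (ler_norm a)) // lerDl.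
have h0 : 0 < 8 ^- p :> R by rewrite invr_gt0 pow8_gt0.
have ts0 : 0 <= t - s by rewrite subr_ge0.
have : Num.sqrt (2 * a * (t - s + 8 ^- p)) <= eps / 4.
  rewrite -[leRHS]ger0_norm ?(divr_ge0 (ltW eps0)) // -sqrtr_sqr ler_wsqrtr //.
  apply: (@le_trans _ _ (2 * A * (t - s + 8 ^- p))); last lra.
  by rewrite ler_wpM2r ?ler_pM2l // addr_ge0 // ltW.
have : C * (t - s) <= eps / 4 by nra.
lra.
Qed.

Lemma tube_sep v T : 0 <= T -> exists e d, [/\ 0 < e, 0 < d &
  forall u t, 0 <= t <= T -> `|pval u t - pval v t| <= d -> sep e (pval u t)].
Proof.
move=> T0; have [e e0 eP] := path_sep hgamma (@pval_continuous _ _ _ _ v) (pval_Ddom hx v) T0.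
exists (e / 2), (e / 8); split; rewrite ?divr_gt0 // => u t tT uv.
have H j : `|pval u t 0 j - pval v t 0 j| <= e / 8.
  have := coord_le_norm (pval u t - pval v t) j; rewrite !mxE => h.
  exact: (le_trans h uv).
by apply: sepW (sep_perturb hgamma (eP t tT) H); lra.
Qed.

(** In a thin tube around [v] the drift is Lipschitz, so the driving function depends continuously
    on the path. *)
Lemma drive_close v T eta : 0 <= T -> 0 < eta -> exists2 d, 0 < d & forall u, tube v T d u ->
  forall t i, 0 <= t <= T -> `|drive u i t - drive v i t| <= eta.
Proof.
move=> T0 eta0; have [e [d0 [e0 d00 sepP]]] := tube_sep v T0.
have [L L0 HL] := @drift_lipschitz R N Gamma l gamma hgamma e e0.
have LT : 0 < 1 + L * T by rewrite ltr_pwDl // mulr_ge0.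
exists (Num.min d0 (eta / (1 + L * T))); first by rewrite lt_min d00 divr_gt0.
set d := Num.min _ _ => u ut t i /andP[t0 tT].
have dd0 : d <= d0 by rewrite ge_min lexx.
have deta : d * (1 + L * T) <= eta by rewrite -ler_pdivlMr // ge_min lexx orbT.
have dpos : 0 < d by rewrite lt_min d00 divr_gt0.
have close r j : 0 <= r <= T -> `|pval u r 0 j - pval v r 0 j| <= d.
  move=> rT; have := coord_le_norm (pval u r - pval v r) j; rewrite !mxE => h.
  by apply: (le_trans h); apply: ltW; exact: ut.
have sepu r : 0 <= r <= T -> sep e (pval u r).
  by move=> rT; apply: sepP => //; apply: le_trans dd0; apply: ltW; exact: ut.
have sepv r : 0 <= r <= T -> sep e (pval v r).
  by move=> rT; apply: sepP => //; rewrite subrr normr0 ltW.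
have gB r : 0 <= r -> r <= t -> `|drift gamma (pval u r) i - drift gamma (pval v r) i| <= L * d.
  move=> r0 rt; have rT : 0 <= r <= T by rewrite r0 (le_trans rt).
  exact: HL (sepu r rT) (sepv r rT) (fun j => close r j rT) i.
have := drive_diff_incr (lexx 0) t0 gB.
have h1 := close t i (_ : 0 <= t <= T); rewrite t0 tT in h1; have {}h1 := h1 isT.
have h2 : L * d * t <= L * d * T by rewrite ler_wpM2l // mulr_ge0 // ltW.
have -> : pval u 0 0 i - pval v 0 0 i = 0 by rewrite !pval0 subrr.
have -> : drive u i 0 - drive v i 0 = 0 by rewrite !drive0 subrr.
rewrite (subr0 t); move: h1.
move: (pval u t 0 i - pval v t 0 i) (drive u i t - drive v i t) => A B h1.
rewrite !subr0 distrC => h; have := ler_normD (B - A) A; rewrite subrK; lra.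
Qed.

(** * Limits of good paths along an ultrafilter *)

Section Limit.
Variables (U : set_system (path_space l x)) (a : R).
Hypothesis UU : UltraFilter U.
(** The level [p] may vary from path to path; it only has to become large along [U]. *)
Hypothesis Ugood : forall p0 : nat, U [set u | exists2 p, (p0 <= p)%N & good a p u].

Let PU : ProperFilter U. Proof. exact: ultra_proper. Qed.

Let limit_coord t i : exists y : R, (fun u => pval u t 0 i) @ U --> y.
Proof.
pose T := Num.max t 0.
have T0 : 0 <= T by rewrite le_max lexx orbT.
have [C C0 [p0 pP]] := good_incr a T0.
apply: (@ultra_bounded_cvg R _ _ _ (`|x 0 i| + (Num.sqrt (2 * a * (T + 1)) + 2 + C * T))) => //.
apply: (filterS _ (Ugood p0)) => u [p pp g] /=.
have -> : pval u t = pval u T.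
  rewrite /T maxEle; case: ifPn => //; rewrite pval0 le_eqVlt => /predU1P[->|];
    [exact: pval0|exact: pval_neg].
have := pP p u pp g 0 T i (lexx 0) T0 (lexx T); rewrite pval0 subr0 => h.
have a0 := good_ge0 g.
have h1 : 8 ^- p <= 1 :> R by rewrite invf_le1 ?pow8_gt0 // exprn_ege1 // ler1n.
have h2 : 2 ^- p <= 1 :> R by rewrite invf_le1 ?exprn_gt0 // exprn_ege1 // ler1n.
have : Num.sqrt (2 * a * (T + 8 ^- p)) <= Num.sqrt (2 * a * (T + 1)).
  by rewrite ler_wsqrtr // ler_wpM2l ?mulr_ge0 // lerD2l.
have := ler_normD (pval u T 0 i - x 0 i) (x 0 i); rewrite subrK; lra.
Qed.

Let lim_ex : exists f : R -> 'rV[R]_N, forall t i, (fun u => pval u t 0 i) @ U --> f t 0 i.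
Proof.
have /choice[f fP] : forall ti : R * 'I_N, exists y : R, (fun u => pval u ti.1 0 ti.2) @ U --> y.
  by move=> [t i]; exact: limit_coord.
by exists (fun t => \row_i f (t, i)) => t i; rewrite mxE; exact: (fP (t, i)).
Qed.

Let lim_path : R -> 'rV[R]_N := sval (cid lim_ex).

Let lim_pathP t i : (fun u => pval u t 0 i) @ U --> lim_path t 0 i.
Proof. exact: (svalP (cid lim_ex)). Qed.

Let lim_close t d : 0 < d -> U [set u | forall i, `|pval u t 0 i - lim_path t 0 i| < d].
Proof.
move=> d0; apply: filter_forall => i.
have /cvgrPdist_lt/(_ d d0) := @lim_pathP t i.
by apply: filterS => u; rewrite distrC.
Qed.

Let lim_const t : (forall u, pval u t = x) -> lim_path t = x.
Proof.
move=> H; apply/rowP => i.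
have h1 : (fun u => pval u t 0 i) @ U --> x 0 i.
  by rewrite (_ : (fun u => pval u t 0 i) = cst (x 0 i)); [exact: cvg_cst|apply/funext => u; rewrite H].
exact: (cvg_unique _ (@lim_pathP t i) h1).
Qed.

(** The modulus is common to all paths of a set in [U], and the pointwise limit inherits it. *)
Let equi T eps : 0 <= T -> 0 < eps -> exists2 d, 0 < d &
  U [set u | forall s t i, 0 <= s -> s <= t -> t <= T -> t - s <= d ->
     `|pval u t 0 i - pval u s 0 i| <= eps] /\
  forall s t i, 0 <= s -> s <= t -> t <= T -> t - s <= d ->
     `|lim_path t 0 i - lim_path s 0 i| <= eps.
Proof.
move=> T0 eps0; have [d d0 [p0 pP]] := good_equicontinuous a T0 eps0.
have HU : U [set u | forall s t i, 0 <= s -> s <= t -> t <= T -> t - s <= d ->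
     `|pval u t 0 i - pval u s 0 i| <= eps].
  by apply: (filterS _ (Ugood p0)) => u [p pp g]; exact: pP pp g.
exists d => //; split => // s t i s0 st tT tsd.
apply/ler_addgt0Pr => e e0; have e20 : 0 < e / 2 by rewrite divr_gt0.
have [u [hu [h1 h2]]] := filter_ex (filterI HU (filterI (lim_close t e20) (lim_close s e20))).
have := hu s t i s0 st tT tsd; have := h1 i; have := h2 i.
rewrite distrC; move: (pval u t 0 i) (pval u s 0 i) (lim_path _ _ _) (lim_path _ _ _) => A B C D.
rewrite !ltr_norml !ler_norml => /andP[? ?] /andP[? ?] /andP[? ?]; apply/andP; split; lra.
Qed.

Let lim_cont : continuous lim_path.
Proof.
have maxE t : lim_path t = lim_path (Num.max t 0).
  rewrite maxEle; case: ifPn => // t0; rewrite [RHS]lim_const; last by move=> u; exact: pval0.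
  apply: lim_const => u.
  by move: t0; rewrite le_eqVlt => /predU1P[->|]; [exact: pval0|exact: pval_neg].
move=> t; apply/cvgrPdist_lt => eps eps0.
have e20 : 0 < eps / 2 by rewrite divr_gt0.
pose T := Num.max t 0 + 1.
have T0 : 0 <= T by rewrite addr_ge0 // le_max lexx orbT.
have [d d0 [_ dP]] := equi T0 e20.
have d10 : 0 < Num.min d 1 by rewrite lt_min d0 /=.
have /cvgrPdist_lt/(_ _ d10) := @cvg_id R (nbhs t).
apply: filterS => s; rewrite lt_min => /andP[ts1 ts2].
rewrite (maxE t) (maxE s).
have lip : `|Num.max t 0 - Num.max s 0| <= `|t - s|.
  have := ler_norm (t - s); have := ler_norm (s - t); rewrite distrC.
  by rewrite !maxEle ler_norml; do 2 case: ifPn; rewrite -?ltNge => *; apply/andP; split; lra.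
have s0 : 0 <= Num.max s 0 by rewrite le_max lexx orbT.
have t0 : 0 <= Num.max t 0 by rewrite le_max lexx orbT.
have sT : Num.max s 0 <= T.
  rewrite /T; move: lip; rewrite ler_norml => /andP[? _]; lra.
have tT : Num.max t 0 <= T by rewrite /T lerDl.
move: lip s0 t0 sT tT; move: (Num.max s 0) (Num.max t 0) => s' t' lip s0 t0 sT tT.
apply: norm_lt_coord => // i; rewrite !mxE.
have [st|ts] := leP s' t'.
  apply: (@le_lt_trans _ _ (eps / 2)); last by lra.
  apply: dP => //; apply: le_trans (ltW ts1); apply: le_trans lip; exact: ler_norm.
rewrite distrC; apply: (@le_lt_trans _ _ (eps / 2)); last by lra.
apply: dP => //; first exact: ltW.
apply: le_trans (ltW ts1); apply: le_trans lip; rewrite distrC; exact: ler_norm.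
Qed.

(** The weak inequalities pass to the limit, and [good_confined] supplies the separation that makes
    them strict. *)
Let lim_Ddom t : 0 <= t -> Ddom l (lim_path t).
Proof.
move=> t0; have [e e0 [p0 pP]] := good_confined a t0.
have HU : U [set u | sep e (pval u t)].
  apply: (filterS _ (Ugood p0)) => u [p pp g]; apply: (pP p u pp g).
  by rewrite t0 lexx.
have weak (f g : 'I_N) (c : R) : (forall u, pval u t 0 f <= pval u t 0 g + c) ->
    lim_path t 0 f <= lim_path t 0 g + c.
  move=> H; apply/ler_addgt0Pr => d d0; have d20 : 0 < d / 2 by rewrite divr_gt0.
  have [u hu] := filter_ex (lim_close t d20).
  have := hu f; have := hu g; have := H u; rewrite !ltr_norml => ? /andP[? ?] /andP[? ?]; lra.
have e80 : 0 < e / 8 by rewrite divr_gt0.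
apply: (@Ddom_closed R N Gamma l gamma hgamma _ (e / 2)); first by rewrite divr_gt0.
- have [u [su hu]] := filter_ex (filterI HU (lim_close t e80)).
  have H j : `|lim_path t 0 j - pval u t 0 j| <= e / 8 by rewrite distrC ltW.
  by apply: sepW (sep_perturb hgamma su H); lra.
- move=> i j ij; rewrite -[leRHS]addr0; apply: weak => u; rewrite addr0 ltW //.
  exact: (pval_Ddom hx u t).1.
- by move=> i j i0 jN; apply: weak => u; apply: ltW; exact: (pval_Ddom hx u t).2.
Qed.

(** Closeness at the finitely many times [k * d], together with equicontinuity, upgrades pointwise
    convergence to convergence in the path space. The energy bound survives because each energy sum
    is continuous in the path. *)
Lemma good_ultra_cvg : exists2 u, U --> u & energy_le (drive u) a.
Proof.
have [v vE] : exists v : path_space l x, pval v = lim_path.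
  apply: path_of => //.
  - by apply: lim_const => u; exact: pval0.
  - by move=> t t0; apply: lim_const => u; exact: pval_neg.
have Uv : U --> v.
  move=> A /nbhs_tube [T [e [T0 e0 tA]]].
  suff Ht : U (tube v T e) by exact: filterS tA Ht.
  have e40 : 0 < e / 4 by rewrite divr_gt0.
  have [d d0 [HU dP]] := equi (ltW T0) e40.
  pose K := (Num.truncn (T / d)).+1.
  have HK : U [set u | forall (k : 'I_K) i, `|pval u (k%:R * d) 0 i - lim_path (k%:R * d) 0 i| < e / 4].
    by apply: filter_forall => k; exact: lim_close.
  apply: filterS (filterI HU HK) => u [hu hK] t /andP[t0 tT].
  apply: norm_lt_coord => // i; rewrite !mxE vE.
  pose k := Num.truncn (t / d).
  have td0 : 0 <= t / d by rewrite divr_ge0 // ltW.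
  have kK : (k < K)%N by rewrite ltnS; apply: le_truncn; rewrite ler_wpM2r // invr_ge0 ltW.
  have k1 : k%:R * d <= t by rewrite -ler_pdivlMr // truncn_le.
  have k2 : t - k%:R * d <= d.
    have := truncnS_gt (t / d); rewrite -/k ltr_pdivrMr // -natr1 mulrDl mul1r; lra.
  have k0 : 0 <= k%:R * d by rewrite mulr_ge0 // ltW.
  have := hu _ _ i k0 k1 tT k2; have := dP _ _ i k0 k1 tT k2; have := hK (Ordinal kK) i => /=.
  move: (pval u t 0 i) (pval u _ 0 i) (lim_path _ _ _) (lim_path _ _ _) => A' B C D.
  rewrite !ltr_norml !ler_norml => /andP[? ?] /andP[? ?] /andP[? ?]; apply/andP; split; lra.
exists v => // J s t st ap.
rewrite leNgt; apply/negP => big.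
(* The energy sum relaxed as in [good_energy], with one tolerance for values and lengths. It is
   continuous at [0], so a violated bound [2 * a < G 0] persists for some [eta > 0]. *)
pose G (eta : R) := \sum_j \sum_(i < N)
  (Num.max 0 (`|drive v i (t j) - drive v i (s j)| - eta)) ^+ 2 / (t j - s j + eta).
have G0 : G 0 = \sum_j \sum_(i < N) (drive v i (t j) - drive v i (s j)) ^+ 2 / (t j - s j).
  apply: eq_bigr => j _; apply: eq_bigr => i _.
  by rewrite subr0 addr0 max_r // real_normK ?num_real.
have s0 j : 0 <= s j by case/andP: (st j).
have slt j : s j < t j by case/andP: (st j).
have cG : G @ nbhs 0 --> G 0.
  apply: (@cvg_big R J +%R 0 xpredT add_continuous) => j _.
  apply: (@cvg_big R 'I_N +%R 0 xpredT add_continuous) => i _.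
  have c1 : (fun eta : R => `|drive v i (t j) - drive v i (s j)| - eta) @ nbhs 0 -->
      `|drive v i (t j) - drive v i (s j)| - 0 by apply: cvgB; [exact: cvg_cst|exact: cvg_id].
  apply: cvgM.
    have cm : continuous (fun y : R => Num.max 0 y ^+ 2).
      move=> y; apply: (@continuous_comp _ _ _ (fun y : R => Num.max 0 y) (fun y : R => y ^+ 2)).
        by apply: continuous_max; [exact: cvg_cst|exact: cvg_id].
      exact: exprn_continuous.
    exact: (cvg_comp _ _ c1 (cm _)).
  apply: cvgV; first by rewrite addr0 lt0r_neq0 // subr_gt0.
  by apply: cvgD; [exact: cvg_cst|exact: cvg_id].
rewrite -G0 in big.
have [eta eta0 Geta] : exists2 eta, 0 < eta & 2 * a < G eta.
  have gap : 0 < G 0 - 2 * a by rewrite subr_gt0.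
  have /cvgrPdist_lt/(_ _ gap) [d /= d0 dP] := cG.
  exists (d / 2); first by rewrite divr_gt0.
  have := dP (d / 2); rewrite /ball_ /= sub0r normrN ger0_norm ?divr_ge0 ?(ltW d0) //.
  have -> : d / 2 < d by lra.
  move=> /(_ isT) h; have := ler_norm (G 0 - G (d / 2)); lra.
pose T := 1 + \sum_j t j.
have t0 j : 0 <= t j by exact: le_trans (ltW (slt j)).
have tT j : t j <= T by apply: (le_trans (sum_term_le j t0)); rewrite lerDr.
have T0 : 0 <= T by rewrite addr_ge0 // sumr_ge0.
(* An increment of [drive u] misses that of [drive v] by at most [eta / 2], and [good_energy] loses
   [2 * 2 ^- p <= eta / 2] more; together this is the tolerance [eta]. *)
have e40 : 0 < eta / 4 by rewrite divr_gt0.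
have [d d0 dP] := drive_close v T0 e40.
have T1 : 0 < T by rewrite ltr_wpDr // sumr_ge0.
have [p1 p1P] := pow2_small e40.
have [u [[p]]] := filter_ex (filterI (Ugood (maxn p1 (Num.truncn T).+1)) (Uv _ (tube_nbhs v T1 d0))).
rewrite geq_max => /andP[pp1 pT] g ut.
have Tp : T < p%:R by apply: lt_le_trans (truncnS_gt T) _; rewrite ler_nat.
have := good_energy g st (fun j => le_lt_trans (tT j) Tp) ap.
apply/negP; rewrite -ltNge; apply: (lt_le_trans Geta).
apply: ler_sum => j _; apply: ler_sum => i _.
have h2 := p1P p pp1; have h8 := le_trans (pow8_le p) h2.
have h80 : 0 < 8 ^- p :> R by rewrite invr_gt0 pow8_gt0.
have D0 : 0 < t j - s j by rewrite subr_gt0.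
apply: ler_pM; rewrite ?sqr_ge0 ?invr_ge0 //.
- by rewrite addr_ge0 ?(ltW D0) ?(ltW eta0).
- have max0 (y : R) : 0 <= Num.max 0 y by rewrite le_max lexx.
  rewrite lerXn2r ?nnegrE ?max0 // ge_max max0 /= le_max.
  apply/orP; right.
  have h3 := dP u ut (t j) i; have h4 := dP u ut (s j) i.
  rewrite t0 tT in h3; rewrite s0 (le_trans (ltW (slt j)) (tT j)) in h4.
  have {}h3 := h3 isT; have {}h4 := h4 isT.
  move: h3 h4; move: (drive u i (t j)) (drive u i (s j)) (drive v i (t j)) (drive v i (s j)) => A B C D.
  rewrite (distrC A) (distrC B) => h3 h4; have := norm_sub_near h3 h4; lra.
- have D1 : 0 < t j - s j + 8 ^- p by rewrite ltr_wpDr // ltW.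
  have D2 : 0 < t j - s j + eta by rewrite ltr_wpDr // ltW.
  by rewrite lef_pV2 ?posrE // lerD2l; lra.
Qed.

End Limit.

(** The energy bound makes the oscillation on a cell at most [sqrt (2 * a / 8 ^ p)], which is at
    most [2 ^- p] once [2 * a <= 2 ^ p]. *)
Lemma energy_good a u : energy_le (drive u) a -> exists p0 : nat, forall p, (p0 <= p)%N -> good a p u.
Proof.
move=> E; have a0 := energy_le_ge0 E.
have A0 : 0 < (2 * a + 1)^-1 by rewrite invr_gt0; lra.
have [p0 pP] := pow2_small A0.
exists p0 => p /pP; rewrite invf_ple ?posrE ?invr_gt0 ?exprn_gt0 //; last by lra.
rewrite invrK => ap.
have h0 : 0 < 8 ^- p :> R by rewrite invr_gt0 pow8_gt0.
split.
  have := E 'I_(p * 8 ^ p) (fun k => node p k) (fun k => node p k.+1).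
  have H1 (j : 'I_(p * 8 ^ p)) : 0 <= (node p j : R) < node p j.+1 by rewrite node_ge0 node_lt.
  have H2 : apart xpredT (fun k : 'I_(p * 8 ^ p) => node p k : R) (fun k => node p k.+1).
    move=> i j _ _; rewrite neq_ltn !node_le => /orP[]; by [left|right].
  move=> /(_ H1 H2) h; rewrite ler_pdivlMr ?pow8_gt0 //.
  apply: le_trans h; rewrite big_mkord mulr_suml; apply: ler_sum => k _.
  by rewrite mulr_suml; apply: ler_sum => i _; rewrite nodeS invrK.
move=> k s i kp /andP[ks sk].
move: ks; rewrite le_eqVlt => /predU1P[<-|ks]; first by rewrite subrr normr0 invr_ge0 exprn_ge0.
have := E unit (fun _ => node p k) (fun _ => s).
rewrite node_ge0 ks => /(_ (fun _ => isT)).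
have ap1 : apart (xpredT : pred unit) (fun _ => node p k) (fun _ => s) by move=> [] [].
move=> /(_ ap1); rewrite (bigD1 tt) //= [X in _ + X]big1 ?addr0; last by move=> [].
move=> h; have : (drive u i s - drive u i (node p k)) ^+ 2 / (s - node p k) <= 2 * a.
  apply: le_trans h; apply: (@sum_term_le R _ (fun i => (drive u i s - drive u i (node p k)) ^+ 2 / (s - node p k))).
  by move=> j; rewrite divr_ge0 ?sqr_ge0 // subr_ge0 ltW.
rewrite ler_pdivrMr ?subr_gt0 // => h'.
rewrite -ler_sqr ?nnegrE ?invr_ge0 ?exprn_ge0 // real_normK ?num_real //.
apply: (le_trans h'); apply: (@le_trans _ _ (2 ^+ p * 8 ^- p)).
  apply: ler_pM => //; first by rewrite mulr_ge0.
  - by rewrite subr_ge0 ltW.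
  - lra.
  - by have := nodeS (R:=R) p k; lra.
have -> : 8 ^+ p = 2 ^+ p * (2 ^+ p * 2 ^+ p) :> R by rewrite -!exprMn; congr (_ ^+ p); ring.
have : 2 ^+ p != 0 :> R by rewrite lt0r_neq0 // exprn_gt0.
move: (2 ^+ p) => b b0; rewrite le_eqVlt; apply/orP; left; apply/eqP; field.
exact: b0.
Qed.

Lemma rate_compact a : compact [set u : path_space l x | (rate gamma (pval u) <= a%:E)%E].
Proof.
have [a0|a0] := ltP a 0.
  rewrite (_ : [set u | _] = set0); first exact: compact0.
  apply/seteqP; split => // u /= h; suff : (0 <= a%:E)%E by rewrite lee_fin leNgt a0.
  apply: le_trans h; rewrite /rate; case: ifP => // _.
  rewrite mule_ge0 ?lee_fin // integral_ge0 // => t _.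
  by rewrite lee_fin sumr_ge0.
rewrite compact_ultra => U UU UA.
have PU : ProperFilter U by exact: ultra_proper.
have Ug p0 : U [set u | exists2 p, (p0 <= p)%N & good a p u].
  apply: filterS UA => u /= /(rate_energy u a0) /energy_good[p1 pP].
  by exists (maxn p0 p1); rewrite ?leq_maxl //; apply: pP; rewrite leq_maxr.
have [u Uu ua] := good_ultra_cvg UU Ug.
by exists u; split => //=; apply/(rate_energy u a0).
Qed.

(** Lower semicontinuity follows from compactness: the space is Hausdorff, so compact sublevel sets
    are closed. *)
Lemma rate_good : good_rate_function (fun u : path_space l x => rate gamma (pval u)).
Proof.
split; last exact: rate_compact.
- move=> u; rewrite /rate; case: ifP => // _.
  rewrite mule_ge0 ?lee_fin // integral_ge0 // => t _.
  by rewrite lee_fin sumr_ge0.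
- apply/lower_semicontinuousP => a.
  rewrite (_ : [set u | _] = ~` [set u : path_space l x | (rate gamma (pval u) <= a%:E)%E]).
    apply: closed_openC; apply: compact_closed; [exact: path_space_hausdorff|exact: rate_compact].
  by apply/seteqP; split => u /=; rewrite ltNge => /negP.
Qed.

(* Otherwise an ultrafilter of good paths in F would converge, to a point of F
   with energy at most a. *)
Lemma closed_not_good (F : set (path_space l x)) a : closed F ->
  (forall u, F u -> ~ energy_le (drive u) a) ->
  exists p0 : nat, forall p u, (p0 <= p)%N -> good a p u -> ~ F u.
Proof.
move=> cF HF; apply: contrapT => nH.
have H p0 : exists p u, [/\ (p0 <= p)%N, good a p u & F u].
  apply: contrapT => n; apply: nH; exists p0 => p u pp g Fu; apply: n.
  by exists p, u.
pose B (p0 : nat) := [set u | F u /\ exists2 p, (p0 <= p)%N & good a p u].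
have PF : ProperFilter (filter_from [set: nat] B).
  apply: filter_from_proper; last by move=> p0 _; have [p [u [pp g Fu]]] := H p0; exists u;
    split => //; exists p.
  apply: filter_from_filter; first by exists 0%N.
  move=> p q _ _; exists (maxn p q) => // u [Fu [r rr g]].
  by move: rr; rewrite geq_max => /andP[? ?]; split; split => //; exists r.
have [U [UU BU]] := ultraFilterLemma PF.
have UB p0 : U (B p0) by apply: BU; exists p0.
have PU : ProperFilter U by exact: ultra_proper.
have [u Uu ua] := good_ultra_cvg UU (fun p0 => filterS (fun _ h => proj2 h) (UB p0)).
apply: (HF u) => //; apply: cF => A /Uu UA.
by have [v [[Fv _] Av]] := filter_ex (filterI (UB 0%N) UA); exists v.
Qed.

(* Paths with close driving functions are close: Gronwall's lemma, carried out on
   time steps of length tau with L * tau <= 1 / 2. *)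
Lemma drive_stable u T eps : 0 <= T -> 0 < eps -> exists2 delta, 0 < delta &
  forall v, (forall t i, 0 <= t <= T -> `|drive v i t - drive u i t| <= delta) -> tube u T eps v.
Proof.
move=> T0 eps0; have [e [d0 [e0 d00 sepP]]] := tube_sep u T0.
have [L L0 HL] := @drift_lipschitz R N Gamma l gamma hgamma e e0.
have L1 : 0 < 2 * (L + 1) by lra.
have [tau [tau0 Ltau]] : exists tau, 0 < tau /\ L * tau <= 2^-1.
  exists (2 * (L + 1))^-1; split; first by rewrite invr_gt0.
  rewrite ler_pdivrMr //; lra.
pose K := (Num.truncn (T / tau)).+1.
have TK : T <= K%:R * tau by rewrite -ler_pdivrMr // ltW // truncnS_gt.
have [c [c0 ce cd]] : exists c, [/\ 0 < c, c < eps & c <= d0].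
  by exists (Num.min (eps / 2) d0); rewrite lt_min gt_min ge_min lexx orbT divr_gt0 //;
    split => //; apply/orP; left; lra.
have p9 k : 0 < 9 ^+ k :> R by rewrite exprn_gt0.
(* The distance may grow by the factor [9] on each of the [K] time steps, and must still be at most
   [c] at time [T], within the region where the drift is Lipschitz. *)
pose delta := c / 9 ^+ K.
have delta0 : 0 < delta by rewrite divr_gt0.
exists delta => // v vP.
have claim k : (k <= K)%N -> forall t, 0 <= t <= T -> t <= k%:R * tau ->
    `|pval v t - pval u t| <= 9 ^+ k * delta.
  elim: k => [_ t /andP[t0 _]|k IH kK t /andP[t0 tT] tk].
    rewrite mul0r => h; have -> : t = 0 by apply/le_anti/andP.
    by rewrite !pval0 subrr normr0 expr0 mul1r ltW.
  have [h|h] := leP t (k%:R * tau).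
    apply: (le_trans (IH (ltnW kK) t _ h)); first by rewrite t0.
    by rewrite ler_pM2r // ler_weXn2l // ler1n.
  pose s := k%:R * tau; have s0 : 0 <= s by rewrite mulr_ge0 // ltW.
  have sT : s <= T by exact: le_trans (ltW h) tT.
  have hs := IH (ltnW kK) s; rewrite s0 sT lexx in hs; have {}hs := hs isT isT.
  apply: ltW; apply: (@continuous_induction R (fun r => `|pval v r - pval u r|) s t) => //.
  - by move=> r; apply: cvg_norm; apply: cvgB; exact: pval_continuous.
  - by apply: (le_lt_trans hs); rewrite ltr_pM2r // ltr_eXn2l // ltr1n.
  - move=> r /andP[sr rt] H.
    have r0 := le_trans s0 sr; have rT := le_trans rt tT.
    have cB : 9 ^+ k.+1 * delta <= c.
      rewrite /delta mulrC -mulrA ler_piMr ?(ltW c0) // mulrC ler_pdivrMr // mul1r.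
      by rewrite ler_weXn2l // ler1n.
    have close q : 0 <= q <= r -> `|pval v q - pval u q| <= d0.
      move=> /andP[q0 qr]; have [qs|sq] := leP q s.
        apply: (le_trans (IH (ltnW kK) q _ qs)); first by rewrite q0 (le_trans qs).
        apply: le_trans cd; apply: le_trans cB.
        by rewrite ler_pM2r // ler_weXn2l // ler1n.
      by apply: (le_trans (H q _)); [rewrite (ltW sq)|exact: le_trans cd].
    have gB i q : s <= q -> q <= r -> `|drift gamma (pval v q) i - drift gamma (pval u q) i| <= L * (9 ^+ k.+1 * delta).
      move=> sq qr; have q0 := le_trans s0 sq; have qT := le_trans qr rT.
      have qq : 0 <= q <= T by rewrite q0.
      apply: HL => [||j].
      - by apply: sepP => //; apply: close; rewrite q0.
      - by apply: sepP => //; rewrite subrr normr0 ltW.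
      - have := coord_le_norm (pval v q - pval u q) j; rewrite !mxE => h'.
        by apply: (le_trans h'); apply: H; rewrite sq.
    apply: norm_lt_coord => [|i]; first by rewrite mulr_gt0.
    rewrite !mxE.
    have hd := drive_diff_incr s0 sr (gB i).
    have h1 := vP r i; rewrite r0 rT in h1; have {}h1 := h1 isT.
    have h2 := vP s i; rewrite s0 sT in h2; have {}h2 := h2 isT.
    have h3 : `|pval v s 0 i - pval u s 0 i| <= 9 ^+ k * delta.
      have := coord_le_norm (pval v s - pval u s) i; rewrite !mxE => h'.
      exact: le_trans h' hs.
    have h4 : L * (9 ^+ k.+1 * delta) * (r - s) <= 2^-1 * (9 ^+ k.+1 * delta).
      rewrite mulrAC; apply: ler_wpM2r; first by rewrite mulr_ge0 // ltW.
      apply: le_trans Ltau; rewrite ler_wpM2l // lerBlDr addrC.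
      by apply: (le_trans rt); apply: (le_trans tk); rewrite /s -natr1 mulrDl mul1r.
    have h5 : delta <= 9 ^+ k * delta by rewrite ler_peMl ?exprn_ege1 ?ler1n // ltW.
    have GE : 9 ^+ k.+1 * delta = 9 * (9 ^+ k * delta) by rewrite exprS mulrA.
    rewrite GE in h4 *; rewrite GE in hd.
    exact: (step_bound delta0 h5 h4 hd h3 h1 h2).
  - by rewrite lexx ltW.
move=> t /andP[t0 tT]; have := claim K (leqnn K) t; rewrite t0 tT => /(_ isT (le_trans tT TK)).
rewrite /delta mulrC divfK ?lt0r_neq0 // => h; exact: le_lt_trans ce.
Qed.

End Dynamics.

(** * Gaussian estimates *)

Section Gaussian.
Context {R : realType}.
Local Notation mu := lebesgue_measure.

(** Beyond [y], on the side away from [0], [z ^+ 2 >= y ^+ 2 + (z - y) ^+ 2]. The density centred at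
    [y] has total mass [1], so integration gives a Gaussian tail without any prefactor. *)
Lemma normal_pdf_shift (s y z : R) : s != 0 -> 0 <= y * (z - y) ->
  normal_pdf 0 s z <= expR (- y ^+ 2 / (2 * s ^+ 2)) * normal_pdf y s z.
Proof.
move=> s0 yz; rewrite !normal_pdfE // mulrCA; apply: ler_wpM2l; first exact: normal_peak_ge0.
rewrite /normal_fun -expRD ler_expR subr0.
have s2 : 0 < s ^+ 2 by rewrite exprn_even_gt0.
rewrite -subr_ge0.
have -> : - y ^+ 2 / (2 * s ^+ 2) + - (z - y) ^+ 2 / (s ^+ 2 *+ 2) - - z ^+ 2 / (s ^+ 2 *+ 2) =
  y * (z - y) / s ^+ 2.
  by field.
by rewrite divr_ge0 // ltW.
Qed.

Lemma normal_tail1 (s y : R) (A : set R) : s != 0 -> measurable A ->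
  (forall z, A z -> 0 <= y * (z - y)) ->
  (normal_prob 0 s A <= (expR (- y ^+ 2 / (2 * s ^+ 2)))%:E)%E.
Proof.
move=> s0 mA HA; rewrite /normal_prob; set c := expR _.
have mp m : measurable_fun A (EFin \o normal_pdf m s).
  by apply/measurable_EFinP; apply: measurable_funS (measurable_normal_pdf m s).
apply: (@le_trans _ _ (\int[mu]_(z in A) (c%:E * (normal_pdf y s z)%:E))%E).
  apply: ge0_le_integral => //.
  - by move=> z _; rewrite lee_fin normal_pdf_ge0.
  - exact: mp.
  - rewrite (_ : (fun z => _) = EFin \o (fun z => c * normal_pdf y s z)) //.
    by apply/measurable_EFinP; apply: measurable_funM => //; apply/measurable_EFinP; exact: mp.
  - by move=> z Az; rewrite -EFinM lee_fin; apply: normal_pdf_shift => //; exact: HA.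
rewrite ge0_integralZl_EFin ?expR_ge0 //; last 2 first.
- by move=> z _; rewrite lee_fin normal_pdf_ge0.
- exact: mp.
rewrite -[leRHS]mule1; apply: lee_wpmul2l; first by rewrite lee_fin expR_ge0.
rewrite -(integral_normal_pdf y s); apply: ge0_subset_integral => //.
- by apply/measurable_EFinP; exact: measurable_normal_pdf.
- by move=> z _; rewrite lee_fin normal_pdf_ge0.
Qed.

Lemma normal_tail (s y : R) : s != 0 -> 0 <= y ->
  (normal_prob 0 s [set z | (y <= `|z|)%R] <= (2 * expR (- y ^+ 2 / (2 * s ^+ 2)))%:E)%E.
Proof.
move=> s0 y0.
have -> : [set z : R | y <= `|z|] = `[y, +oo[%classic `|` `]-oo, (- y)]%classic.
  apply/seteqP; split => z /=; rewrite !in_itv /= andbT ler_normr.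
    by move=> /orP[|h]; [left|right; lra].
  by move=> [->//|h]; apply/orP; right; lra.
apply: (@le_trans _ _ (normal_prob 0 s `[y, +oo[%classic + normal_prob 0 s `]-oo, (- y)%R]%classic)%E).
  exact: measureU2.
have -> : 2 * expR (- y ^+ 2 / (2 * s ^+ 2)) =
  expR (- y ^+ 2 / (2 * s ^+ 2)) + expR (- (- y) ^+ 2 / (2 * s ^+ 2)).
  by rewrite sqrrN; ring.
rewrite EFinD; apply: leeD; apply: normal_tail1 => // z; rewrite /= in_itv /= ?andbT => h.
  by rewrite mulr_ge0 // subr_ge0.
by rewrite mulr_le0 //; lra.
Qed.

(** The interval has length [2 * r], and on it the density is at least its value at distance
    [|m| + r] from [0]. *)
Lemma normal_interval (s m r : R) : 0 < s -> 0 < r ->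
  ((2 * r * normal_peak s * expR (- (`|m| + r) ^+ 2 / (2 * s ^+ 2)))%:E <=
   normal_prob 0 s [set z | `|z - m| < r]%R)%E.
Proof.
move=> s0 r0; have sn0 : s != 0 by rewrite lt0r_neq0.
have E : [set z : R | `|z - m| < r] = `](m - r), (m + r)[%classic.
  apply/seteqP; split => z /=; rewrite in_itv /= ltr_norml => /andP[? ?]; apply/andP; split; lra.
have mI : measurable ([set z : R | `|z - m| < r] : set R) by rewrite E.
rewrite /normal_prob; set c := normal_peak s * expR (- (`|m| + r) ^+ 2 / (2 * s ^+ 2)).
have c0 : 0 <= c by rewrite mulr_ge0 ?expR_ge0 ?normal_peak_ge0.
apply: (@le_trans _ _ (\int[mu]_(z in [set z : R | `|z - m| < r]%R) c%:E)%E); last first.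
  apply: ge0_le_integral => //.
  - by apply/measurable_EFinP; apply: measurable_funS (measurable_normal_pdf 0 s).
  - move=> z /= zm; rewrite lee_fin normal_pdfE // /c; apply: ler_wpM2l; first exact: normal_peak_ge0.
    rewrite /normal_fun ler_expR subr0 [s ^+ 2 *+ 2]mulr2n -mulr2n -[s ^+ 2 *+ 2]mulr_natl.
    rewrite ler_pM2r ?invr_gt0 ?mulr_gt0 ?exprn_gt0 // lerN2 -[z ^+ 2]real_normK ?num_real //.
    rewrite lerXn2r ?nnegrE ?addr_ge0 ?(ltW r0) //.
    have := ler_normD (z - m) m; rewrite subrK; lra.
have muE : lebesgue_measure (`](m - r), (m + r)[%classic : set R) = (2 * r)%:E.
  rewrite lebesgue_measure_itv /= lte_fin ifT; last by lra.
  by rewrite -EFinB; congr EFin; ring.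
rewrite integral_cst // E.
apply: (@le_trans _ _ (c%:E * (2 * r)%:E)%E); last by rewrite -muE.
by rewrite -EFinM lee_fin /c le_eqVlt; apply/orP; left; apply/eqP; ring.
Qed.

End Gaussian.

Section Union.
Context {R : realType} {d : measure_display} {T : measurableType d} (P : probability T R).

Lemma finite_subadditive (J : finType) (A : J -> set T) (X : set T) :
  measurable X -> (forall j, measurable (A j)) -> X `<=` [set w | exists j, A j w] ->
  (P X <= \sum_j P (A j))%E.
Proof.
move=> mX mA XA.
suff [mU PU] : measurable (\big[setU/set0]_j A j) /\ (P (\big[setU/set0]_j A j) <= \sum_j P (A j))%E.
  apply: le_trans PU; apply: le_measure; rewrite ?inE //.
  move=> w /XA [j Ajw]; rewrite -bigcup_seq; exists j => //=.
  by rewrite mem_index_enum.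
elim/big_ind2: _ => [|X1 y1 X2 y2 [m1 h1] [m2 h2]|j _].
- by rewrite measure0.
- by split; [exact: measurableU|apply: (le_trans (measureU2 _ _ _)) => //; exact: leeD].
- by split.
Qed.

Lemma countable_subadditive (A : nat -> set T) (X : set T) (c : R) :
  measurable X -> (forall j, measurable (A j)) -> X `<=` [set w | exists j, A j w] ->
  (forall j, (P (A j) <= (c / 2 ^+ j)%:E)%E) -> (P X <= (2 * c)%:E)%E.
Proof.
move=> mX mA XA H.
have c0 : 0 <= c by have := le_trans (measure_ge0 P _) (H 0%N); rewrite lee_fin expr0 divr1.
have geo n : \sum_(0 <= j < n) c / 2 ^+ j = 2 * c - c / 2 ^+ n * 2.
  elim: n => [|n IH]; first by rewrite big_nil expr0 divr1; ring.
  by rewrite big_nat_recr //= IH exprS; field; rewrite expf_neq0.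
have XU : X `<=` \bigcup_j A j by move=> w /XA [j Aj]; exists j.
apply: (le_trans (@measure_sigma_subadditive _ _ _ P X A mA mX XU)).
apply: lime_le; first by apply: is_cvg_nneseries => n _ _; exact: measure_ge0.
near=> n; apply: (@le_trans _ _ (\sum_(0 <= j < n) (c / 2 ^+ j)%:E)%E);
  first by apply: lee_sum => j _; exact: H.
rewrite sumEFin lee_fin.
rewrite geo.
by rewrite gerBl mulr_ge0 // divr_ge0 // exprn_ge0.
Unshelve. all: by end_near. Qed.

End Union.

(** * Covering by boxes and chaining *)

Section Boxes.
Context {R : realType}.

(** The corners [y k] arise from rounding every [|Y j|] down to a multiple of [delta], capped a
    little above [sqrt r], so there are finitely many. A large sum of squares thus becomes a finite
    union of product events, on which independent tails multiply and the exponents add up to nearly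
    [r]. *)
Lemma box_cover (J : finType) (r eta : R) : 0 < eta ->
  exists (I : finType) (y : I -> J -> R),
  [/\ forall k j, 0 <= y k j, forall k, r - eta <= \sum_j y k j ^+ 2
    & forall Y : J -> R, r < \sum_j Y j ^+ 2 -> exists k, forall j, y k j <= `|Y j|].
Proof.
move=> eta0; have [r0|r0] := leP r 0.
  exists unit, (fun _ _ => 0); split => [//|_|Y _]; last by exists tt => j; exact: normr_ge0.
  by rewrite big1 => [|j _]; [lra|rewrite expr0n].
pose S := Num.sqrt r + 1; have S0 : 0 < S by rewrite ltr_wpDl // sqrtr_ge0.
have D0 : 0 < #|J|%:R * (2 * S + 1) + 1 :> R.
  by rewrite ltr_wpDl // mulr_ge0 // addr_ge0 // mulr_ge0 // ltW.
(* Rounding lowers a square by at most [(2 * S + 1) * delta], the rounded values being at most [S]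
   and [delta <= 1]. *)
have [delta [delta0 delta1 deltaeta]] : exists delta, [/\ 0 < delta, delta <= 1 &
    #|J|%:R * (2 * S + 1) * delta <= eta].
  exists (Num.min 1 (eta / (#|J|%:R * (2 * S + 1) + 1))); rewrite lt_min ltr01 divr_gt0 //=.
  split => //; first by rewrite ge_min lexx.
  set dd := Num.min _ _.
  have h1 : 0 <= dd by rewrite le_min ler01 divr_ge0 // ltW.
  have : dd * (#|J|%:R * (2 * S + 1) + 1) <= eta by rewrite -ler_pdivlMr // ge_min lexx orbT.
  by rewrite mulrDr mulr1 mulrC; lra.
pose M := (Num.truncn (Num.sqrt r / delta)).+1.
have M1 : Num.sqrt r <= M%:R * delta by rewrite -ler_pdivrMr // ltW // truncnS_gt.
have M2 : M%:R * delta <= S.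
  rewrite /M -natr1 mulrDl mul1r /S lerD // -ler_pdivlMr // truncn_le //.
  by rewrite divr_ge0 ?sqrtr_ge0 // ltW.
pose ok (k : {ffun J -> 'I_M.+1}) := r - eta <= \sum_j ((k j)%:R * delta) ^+ 2.
exists {k : {ffun J -> 'I_M.+1} | ok k}, 
  (fun (k : {k : {ffun J -> 'I_M.+1} | ok k}) j => (sval k j : nat)%:R * delta); split.
- by move=> k j; rewrite mulr_ge0 // ltW.
- by move=> [k ok_k].
move=> Y rY; have [[j0 /= hj0]|small] := pselect (exists j, M%:R * delta <= `|Y j|).
  (* One coordinate above the cap suffices: the corner has [M * delta >= sqrt r] there and [0]
     elsewhere. *)
  pose k : {ffun J -> 'I_M.+1} := [ffun j => if j == j0 then ord_max else ord0].
  have okk : ok k.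
    rewrite /ok (bigD1 j0) //= big1 => [|j /negbTE jj]; last by rewrite ffunE jj mul0r expr0n.
    rewrite ffunE eqxx addr0 /= -[r in leLHS]sqr_sqrtr ?(ltW r0) //.
    have : Num.sqrt r ^+ 2 <= (M%:R * delta) ^+ 2 by rewrite lerXn2r ?nnegrE ?sqrtr_ge0 // mulr_ge0 // ltW.
    lra.
  exists (exist _ k okk) => j /=; rewrite ffunE; case: eqVneq => [->//|_].
  by rewrite mul0r.
have small' j : `|Y j| < M%:R * delta.
  by rewrite ltNge; apply/negP => h; apply: small; exists j.
have kM j : (Num.truncn (`|Y j| / delta) < M.+1)%N.
  apply: ltnW; rewrite ltnS -(ltr_nat R); apply: le_lt_trans (_ : `|Y j| / delta < _).
    by rewrite truncn_le // divr_ge0 // ltW.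
  by rewrite ltr_pdivrMr.
pose k : {ffun J -> 'I_M.+1} := [ffun j => Ordinal (kM j)].
have k1 j : (k j)%:R * delta <= `|Y j|.
  by rewrite ffunE /= -ler_pdivlMr // truncn_le // divr_ge0 // ltW.
have k2 j : Y j ^+ 2 <= ((k j)%:R * delta) ^+ 2 + (2 * S + 1) * delta.
  have : `|Y j| < (k j)%:R * delta + delta.
    by rewrite -[X in _ + X]mul1r -mulrDl natr1 -ltr_pdivrMr // ffunE truncnS_gt.
  have := k1 j; have := small' j.
  rewrite -[Y j ^+ 2]real_normK ?num_real //; move: ((k j)%:R * delta) => z; nra.
have okk : ok k.
  rewrite /ok lerBlDr; apply: (le_trans (ltW rY)).
  apply: (@le_trans _ _ (\sum_j (((k j)%:R * delta) ^+ 2 + (2 * S + 1) * delta))).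
    by apply: ler_sum => j _.
  by rewrite big_split /= lerD2l sumr_const -[leLHS]mulr_natl mulrA.
by exists (exist _ k okk).
Qed.

(** A dyadic point of level [j + 1] is one of level [j] or the next finer point to its right, so
    each level adds at most one threshold; continuity reaches the other times. *)
Lemma chaining (f : R -> R) (lam : R) : 0 <= lam -> continuous f ->
  (forall j m, (m < 2 ^ j)%N -> `|f (dyadic j m.+1) - f (dyadic j m)| <= lam / 4 * (3 / 4) ^+ j) ->
  forall t, 0 <= t <= 1 -> `|f t - f 0| <= lam.
Proof.
move=> lam0 cf H.
have q0 j : 0 <= (3 / 4) ^+ j :> R by rewrite exprn_ge0.
have claim j k : (k <= 2 ^ j)%N -> `|f (dyadic j k) - f 0| <= lam * (1 - (3 / 4) ^+ j.+1).
  elim: j k => [|j IH] k.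
    rewrite expn0 expr1; case: k => [_|[_|//]].
      by rewrite /dyadic mul0r subrr normr0 mulr_ge0 //; lra.
    by have := H 0%N 0%N isT; rewrite {2}/dyadic mul0r expr0 mulr1; lra.
  have half m : dyadic j.+1 m.*2 = dyadic j m :> R.
    by rewrite /dyadic exprS -mul2n natrM; field; rewrite expf_neq0.
  rewrite -(odd_double_half k); case: (odd k) => /=.
    rewrite add1n expnS mul2n => k2.
    have k2' : (k./2.*2 < 2 ^ j.+1)%N by rewrite expnS mul2n.
    have := H j.+1 _ k2'; rewrite half.
    have kj : (k./2 <= 2 ^ j)%N by rewrite -leq_double ltnW.
    have := IH _ kj => h1 h2.
    have := ler_normD (f (dyadic j.+1 k./2.*2.+1) - f (dyadic j k./2)) (f (dyadic j k./2) - f 0).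
    rewrite subrKA; move: h1 h2; rewrite (exprS _ j.+1).
    move: ((3 / 4) ^+ j.+1) => z; lra.
  rewrite add0n expnS mul2n leq_double half => kj.
  apply: (le_trans (IH _ kj)); rewrite ler_wpM2l // lerD2l lerN2 (exprS _ j.+1).
  by rewrite ler_piMl //; lra.
have claim' j k : (k <= 2 ^ j)%N -> `|f (dyadic j k) - f 0| <= lam.
  move=> kj; apply: (le_trans (claim j k kj)); have := q0 j.+1.
  by rewrite ler_piMr //; lra.
move=> t /andP[t0]; rewrite le_eqVlt => /predU1P[->|t1].
  by have := claim' 0%N 1%N isT; rewrite /dyadic expr0 divr1.
apply: (@dyadic_dense R (fun t => `|f t - f 0|) 1) => //; last by rewrite t0.
  by move=> r; apply: cvg_norm; apply: cvgB; [exact: cf|exact: cvg_cst].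
move=> j k kj; apply: claim'; apply: ltnW; move: kj.
by rewrite /dyadic ltr_pdivrMr ?exprn_gt0 // mul1r -natrX ltr_nat.
Qed.

End Boxes.

(** * Estimates for Brownian increments *)

Section Brownian.
Context {R : realType} {d : measure_display} {T : measurableType d}.
Context (P : probability T R) (N : nat) (B : R -> T -> 'rV[R]_N).
Hypothesis hB : brownian_motion P B.

Lemma measurable_increment (s t : R) i (A : set R) : 0 <= s -> 0 <= t -> measurable A ->
  measurable [set w | A (B t w 0 i - B s w 0 i)].
Proof.
move=> s0 t0 mA; rewrite -[X in measurable X]setTI.
have H : measurable_fun setT (fun w => B t w 0 i - B s w 0 i).
  by apply: measurable_funB; exact: (bm_measurable hB).
exact: H.
Qed.

Lemma measurable_ge_norm (y c : R) : measurable [set z : R | y <= `|c * z|].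
Proof.
have H : measurable_fun setT (fun z : R => `|c * z|).
  by apply: measurableT_comp => //; exact: measurable_funM.
have := H measurableT `[y, +oo[%classic (measurable_itv _).
rewrite setTI; congr (measurable _).
by apply/seteqP; split => z /=; rewrite in_itv /= andbT.
Qed.

Lemma measurable_lt_norm (r m c : R) : measurable [set z : R | `|c * z - m| < r].
Proof.
have H : measurable_fun setT (fun z : R => `|c * z - m|).
  by apply: measurableT_comp => //; apply: measurable_funB => //; exact: measurable_funM.
have := H measurableT `]-oo, r[%classic (measurable_itv _).
by rewrite setTI.
Qed.

Lemma increment_tail (kappa s t y : R) i : 0 < kappa -> 0 <= s -> s < t -> 0 <= y ->
  (P [set w | (y <= `|Num.sqrt kappa * (B t w 0 i - B s w 0 i)|)%R] <=
   (2 * expR (- y ^+ 2 / (2 * kappa * (t - s))))%:E)%E.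
Proof.
move=> k0 s0 st y0; have sk0 : 0 < Num.sqrt kappa by rewrite sqrtr_gt0.
have ts0 : 0 < t - s by rewrite subr_gt0.
have := bm_gaussian hB i s0 st (measurable_ge_norm y (Num.sqrt kappa)).
rewrite -[X in P X]/([set w | (y <= `|Num.sqrt kappa * (B t w 0 i - B s w 0 i)|)%R]) => ->.
have -> : [set z : R | y <= `|Num.sqrt kappa * z|] = [set z | y / Num.sqrt kappa <= `|z|].
  by apply/seteqP; split => z; rewrite /= ler_pdivrMr // normrM (ger0_norm (ltW sk0)) mulrC.
have ss0 : Num.sqrt (t - s) != 0 by rewrite lt0r_neq0 // sqrtr_gt0.
apply: (le_trans (normal_tail ss0 (divr_ge0 y0 (ltW sk0)))).
rewrite lee_fin sqr_sqrtr ?(ltW ts0) // expr_div_n sqr_sqrtr ?(ltW k0) //.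
rewrite le_eqVlt; apply/orP; left; apply/eqP; congr (_ * expR _).
by field; rewrite !lt0r_neq0.
Qed.

(** Dividing by [sqrt kappa] widens the interval to [r / sqrt kappa >= r]; in this way [kappa <= 1]
    makes the prefactor independent of [kappa]. *)
Lemma increment_interval (kappa s t m r : R) i : 0 < kappa -> kappa <= 1 -> 0 <= s -> s < t -> 0 < r ->
  ((2 * r * normal_peak (Num.sqrt (t - s)) * expR (- (`|m| + r) ^+ 2 / (2 * kappa * (t - s))))%:E <=
   P [set w | (`|Num.sqrt kappa * (B t w 0 i - B s w 0 i) - m| < r)%R])%E.
Proof.
move=> k0 k1 s0 st r0; have sk0 : 0 < Num.sqrt kappa by rewrite sqrtr_gt0.
have sk1 : Num.sqrt kappa <= 1 by rewrite -[leRHS]sqrtr1 ler_wsqrtr.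
have ts0 : 0 < t - s by rewrite subr_gt0.
have := bm_gaussian hB i s0 st (measurable_lt_norm r m (Num.sqrt kappa)).
rewrite -[X in P X]/([set w | (`|Num.sqrt kappa * (B t w 0 i - B s w 0 i) - m| < r)%R]) => ->.
have -> : [set z : R | `|Num.sqrt kappa * z - m| < r] =
    [set z | `|z - m / Num.sqrt kappa| < r / Num.sqrt kappa].
  have E z : `|Num.sqrt kappa * z - m| = `|z - m / Num.sqrt kappa| * Num.sqrt kappa.
    transitivity `|(z - m / Num.sqrt kappa) * Num.sqrt kappa|.
      by rewrite mulrBl divfK ?lt0r_neq0 // mulrC.
    by rewrite normrM (ger0_norm (ltW sk0)).
  by apply/seteqP; split => z; rewrite /= ltr_pdivlMr // E.
have ss0 : 0 < Num.sqrt (t - s) by rewrite sqrtr_gt0.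
apply: le_trans (normal_interval (m / Num.sqrt kappa) ss0 (divr_gt0 r0 sk0)).
rewrite lee_fin normrM normfV (ger0_norm (ltW sk0)) -mulrDl expr_div_n.
rewrite !sqr_sqrtr ?(ltW ts0) ?(ltW k0) //.
have -> : - ((`|m| + r) ^+ 2 / kappa) / (2 * (t - s)) = - (`|m| + r) ^+ 2 / (2 * kappa * (t - s)).
  by field; rewrite !lt0r_neq0.
rewrite ler_wpM2r ?expR_ge0 // ler_wpM2r ?normal_peak_ge0 // ler_wpM2l //.
by rewrite ler_pdivlMr // ler_piMr // ltW.
Qed.

(* The thresholds lam / 4 * (3 / 4) ^ j sum to lam; outside this event the
   increments of sqrt kappa B from s stay below lam on [s, s + h]. *)
Definition rough (kappa s h lam : R) (i : 'I_N) : set T :=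
  [set w | exists j, exists m : 'I_(2 ^ j),
    (lam / 4 * (3 / 4) ^+ j <= `|Num.sqrt kappa * (B (s + h * dyadic j m.+1) w 0 i - B (s + h * dyadic j m) w 0 i)|)%R].

(** Union bound over the levels. At level [j] the squared threshold over twice the variance is
    [q / 32 * (9 / 8) ^+ j], as [2 * (3 / 4) ^+ 2 = 9 / 8]. This ratio exceeds [1], so the tails
    beat the number [2 ^ j] of increments. *)
Lemma rough_prob (kappa s h lam : R) i : 0 < kappa -> 0 <= s -> 0 < h -> 0 < lam ->
  3 * 2 ^+ 8 <= lam ^+ 2 / (h * kappa) ->
  measurable (rough kappa s h lam i) /\
  (P (rough kappa s h lam i) <= (4 * expR (- (lam ^+ 2 / (32 * (h * kappa)))))%:E)%E.
Proof.
move=> k0 s0 h0 lam0; set q := lam ^+ 2 / (h * kappa) => qbig0.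
(* By [(9 / 8) ^+ j >= 1 + j / 8] the exponent gains [j * q / 256] at level [j]. For [q >= 3 * 256]
   this is at least [3 * j >= j * ln 4], a factor [4 ^- j]. *)
have qbig : 3 * (16 * 16) <= q.
  by apply: le_trans qbig0; rewrite le_eqVlt; apply/orP; left; apply/eqP; ring.
clear qbig0.
have pt0 j m : 0 <= s + h * dyadic j m by rewrite addr_ge0 // mulr_ge0 ?dyadic_ge0 // ltW.
pose A j (m : 'I_(2 ^ j)) : set T := [set w | (lam / 4 * (3 / 4) ^+ j <=
   `|Num.sqrt kappa * (B (s + h * dyadic j m.+1) w 0 i - B (s + h * dyadic j m) w 0 i)|)%R].
have mA j m : measurable (A j m).
  exact: (measurable_increment i (pt0 _ _) (pt0 _ _) (measurable_ge_norm (lam / 4 * (3 / 4) ^+ j) (Num.sqrt kappa))).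
pose A' j := \bigcup_(m : 'I_(2 ^ j)) A j m.
have mA' j : measurable (A' j).
  by apply: countable_bigcupT_measurable => //; exact: countableP.
have E : rough kappa s h lam i = \bigcup_j A' j.
  by apply/seteqP; split => [w [j [m hm]]|w [j _ [m _ hm]]]; [exists j => //; exists m|exists j, m].
have mE : measurable (rough kappa s h lam i) by rewrite E; exact: bigcupT_measurable.
split => //.
have PA j m : (P (A j m) <= (2 * expR (- (q / 32)) / 4 ^+ j)%:E)%E.
  have st : s + h * dyadic j m < s + h * dyadic j m.+1.
    by rewrite ltrD2l ltr_pM2l // ltr_pM2r ?invr_gt0 ?exprn_gt0 // ltr_nat.
  have l0 : 0 <= lam / 4 * (3 / 4) ^+ j by rewrite mulr_ge0 ?exprn_ge0 // divr_ge0 // ltW.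
  apply: (le_trans (increment_tail i k0 (pt0 _ _) st l0)).
  rewrite lee_fin -[leRHS]mulrA ler_pM2l //.
  have -> : s + h * dyadic j m.+1 - (s + h * dyadic j m) = h / 2 ^+ j.
    by rewrite /dyadic -natr1; field; rewrite expf_neq0.
  have -> : - (lam / 4 * (3 / 4) ^+ j) ^+ 2 / (2 * kappa * (h / 2 ^+ j)) = - (q / 32 * (9 / 8) ^+ j).
    rewrite exprMn -exprM mulnC exprM (_ : (9 / 8 : R) = 2 * (3 / 4) ^+ 2); last by field.
    rewrite [(2 * _) ^+ j]exprMn /q; move: (((3 / 4) ^+ 2) ^+ j) => z.
    by field; rewrite expf_neq0 // !lt0r_neq0.
  have bern : 1 + j%:R / 8 <= (9 / 8) ^+ j :> R.
    elim: j {A mA A' mA' E m st l0 mE} => [|j IH]; first by rewrite expr0 mul0r addr0.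
    rewrite exprS -natr1; have j0 : 0 <= j%:R :> R by [].
    move: IH j0; move: (j%:R) ((9 / 8) ^+ j) => z y; lra.
  have -> : (4 ^+ j)^-1 = expR (ln 4^-1 * j%:R) :> R.
    by rewrite -exprVn mulrC expRM_natl lnK // posrE.
  rewrite -expRD ler_expR.
  have ln4 : - 3 <= ln 4^-1 :> R.
    rewrite lnV ?posrE // lerN2 -ler_expR lnK ?posrE //.
    by apply: le_trans (expR_ge1Dx 3); lra.
  have j0 : 0 <= j%:R :> R by [].
  move: qbig bern ln4 j0; move: (ln 4^-1) (j%:R) ((9 / 8) ^+ j) => z y u.
  move: q => q qbig; nra.
have PA' j : (P (A' j) <= (2 * expR (- (q / 32)) / 2 ^+ j)%:E)%E.
  apply: (le_trans (@finite_subadditive _ _ _ P _ (A j) (A' j) (mA' j) (mA j) _)).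
    by move=> w [m _ hm]; exists m.
  apply: (@le_trans _ _ (\sum_(m < 2 ^ j) (2 * expR (- (q / 32)) / 4 ^+ j)%:E)%E).
    by apply: lee_sum => m _.
  rewrite sumEFin lee_fin sumr_const card_ord -[leLHS]mulr_natl natrX.
  have -> : 4 ^+ j = 2 ^+ j * 2 ^+ j :> R by rewrite -exprMn; congr (_ ^+ _); ring.
  rewrite le_eqVlt; apply/orP; left; apply/eqP; field.
  by rewrite expf_neq0.
have := countable_subadditive (A := A') mE mA' _ PA'.
rewrite E; have -> : 4 * expR (- (lam ^+ 2 / (32 * (h * kappa)))) = 2 * (2 * expR (- (q / 32))).
  rewrite [RHS]mulrA; congr (_ * expR (- _)); first by ring.
  by rewrite /q; field; rewrite !lt0r_neq0.
by apply => w [j _ hj]; exists j.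
Qed.

Lemma not_rough (kappa s h lam : R) i w (f : R -> R) : 0 <= lam -> continuous f -> 0 < h ->
  (forall t, s <= t <= s + h -> f t = Num.sqrt kappa * B t w 0 i) ->
  ~ rough kappa s h lam i w -> forall t, s <= t <= s + h -> `|f t - f s| <= lam.
Proof.
move=> lam0 cf h0 fB nr t /andP[st ts].
pose g (r : R) := f (s + h * r).
have cg : continuous g.
  move=> r; apply: (@continuous_comp _ _ _ (fun r => s + h * r) f); last exact: cf.
  by apply: cvgD; [exact: cvg_cst|apply: cvgM; [exact: cvg_cst|exact: cvg_id]].
have := @chaining R g lam lam0 cg _ ((t - s) / h).
rewrite (_ : g ((t - s) / h) = f t); last by rewrite /g; congr f; field; rewrite lt0r_neq0.
rewrite (_ : g 0 = f s); last by rewrite /g mulr0 addr0.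
apply; last first.
  apply/andP; split; first by rewrite divr_ge0 ?subr_ge0 // ltW.
  by rewrite ler_pdivrMr // mul1r lerBlDl.
move=> j m mj; apply: ltW; rewrite ltNge; apply/negP => hle; apply: nr.
exists j, (Ordinal mj) => /=; move: hle.
have in01 k : (k <= 2 ^ j)%N -> s <= s + h * dyadic j k <= s + h.
  move=> kj; rewrite lerDl mulr_ge0 ?dyadic_ge0 ?(ltW h0) //= lerD2l ler_piMr ?(ltW h0) //.
  by rewrite ler_pdivrMr ?exprn_gt0 // mul1r -natrX ler_nat.
by rewrite /g !fB ?in01 // ?(ltnW mj) // mulrBr.
Qed.

End Brownian.

(** * The solution as a random element *)

Section UniformContinuity.
Context {R : realType}.

(** Phrased with [p] near infinity, so that finitely many coordinates can share one [p]. *)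
Lemma segment_uniformly_continuous (f : R -> R) (a b eps : R) : continuous f -> 0 < eps ->
  \forall p \near \oo, forall s t, a <= t <= b -> `|s - t| <= p.+1%:R^-1 -> `|f s - f t| <= eps.
Proof.
move=> cf eps0.
have /compact_near_coveringP cov := @segment_compact R a b.
have := cov nat \oo (fun p t => forall s, `|s - t| <= p.+1%:R^-1 -> `|f s - f t| <= eps) _.
have H x : `[a, b]%classic x -> \forall x' \near x & p \near \oo,
    forall s, `|s - x'| <= p.+1%:R^-1 -> `|f s - f x'| <= eps.
  move=> _; have e20 : 0 < eps / 2 by rewrite divr_gt0.
  have /cvgrPdist_lt/(_ _ e20) [dl /= dl0 dlP] := cf x.
  have d20 : 0 < dl / 2 by rewrite divr_gt0.
  exists (ball x (dl / 2), [set p | p.+1%:R^-1 < dl / 2]).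
    split => /=; first exact: nbhsx_ballx.
    exact: (near_infty_natSinv_lt (PosNum d20)).
  move=> [x' p] [/= xx' pd] s ss.
  rewrite /ball /= in xx'.
  have h1 : `|f x - f x'| < eps / 2 by apply: dlP; rewrite /ball_ /=; lra.
  have h2 : `|f x - f s| < eps / 2.
    apply: dlP; rewrite /ball_ /= -(subrKA x'); apply: (le_lt_trans (ler_normD _ _)).
    rewrite (splitr dl); apply: ltrD => //; rewrite distrC; exact: le_lt_trans ss pd.
  rewrite -(subrKA (f x)); apply: (le_trans (ler_normD _ _)); rewrite distrC; lra.
move=> /(_ _ H); apply: filterS => p hp s t tab; apply: hp.
by rewrite /= in_itv.
Qed.

End UniformContinuity.

(** * Measurability of path-valued maps *)

Section Measurability.
Context {R : realType} (N : nat) (l : R) (x : 'rV[R]_N).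
Context {d : measure_display} {T : measurableType d}.
Variable Z : T -> path_space l x.
Hypothesis mZ : forall (t : R) i, 0 <= t -> measurable_fun setT (fun w => pval (Z w) t 0 i).

(* Paths which on [0, n[ stay close to a step function with values in
   (m + 1)^-1 Z and steps of length (p + 1)^-1, encoded by a list of integers. *)
Definition step_value (m p : nat) (a : seq (seq int)) (t : R) (i : nat) : R :=
  (nth 0 (nth [::] a (Num.truncn (t * p.+1%:R))) i)%:~R / m.+1%:R.

Definition step_tube (c : nat * nat * nat * seq (seq int)) : set (path_space l x) :=
  let: (n, m, p, a) := c in
  [set u | forall j k, (dyadic j k : R) < n%:R -> forall i : 'I_N,
     `|pval u (dyadic j k) 0 i - step_value m p a (dyadic j k) i| <= 2 / m.+1%:R].

Lemma measurable_step_tube c : measurable (Z @^-1` step_tube c).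
Proof.
case: c => [[[n m] p] a].
have -> : Z @^-1` step_tube (n, m, p, a) =
  \bigcap_(jki : nat * nat * 'I_N) [set w | (dyadic jki.1.1 jki.1.2 : R) < n%:R ->
     `|pval (Z w) (dyadic jki.1.1 jki.1.2) 0 jki.2
       - step_value m p a (dyadic jki.1.1 jki.1.2) jki.2| <= 2 / m.+1%:R].
  apply/seteqP; split => w /= H; first by move=> [[j k] i] _ /= jk; exact: H.
  by move=> j k jk i; exact: (H (j, k, i)).
rewrite -[X in measurable X]setCK setC_bigcap; apply: measurableC.
apply: countable_bigcupT_measurable; first exact: countableP.
move=> [[j k] i] /=; apply: measurableC.
set c := step_value _ _ _ _ _; have [h|h] := boolP ((dyadic j k : R) < n%:R); last first.
  by rewrite (_ : [set w | _] = setT) //; apply/seteqP; split.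
have t0 : 0 <= dyadic j k :> R by exact: dyadic_ge0.
have mf : measurable_fun setT (fun w => `|pval (Z w) (dyadic j k) 0 i - c|).
  by apply: measurableT_comp => //; apply: measurable_funB => //; exact: mZ.
have := mf measurableT `]-oo, (2 / m.+1%:R)]%classic (measurable_itv _).
rewrite setTI; congr measurable; apply/seteqP; split => w /=; rewrite in_itv /=; first by [].
exact.
Qed.

(** Sampling [u] at the times [q / (p + 1)] and rounding to multiples of [1 / (m + 1)] costs
    [1 / (m + 1)] each, which is the width in [step_tube]. Two paths in one step tube then differ by
    at most [4 / (m + 1) < e]. *)
Lemma open_step_tube (G : set (path_space l x)) u : open G -> G u ->
  exists2 c, step_tube c `<=` G & step_tube c u.
Proof.
move=> oG Gu; have /nbhs_tube[S [e [S0 e0 tG]]] : nbhs u G by exact: open_nbhs_nbhs.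
have e50 : 0 < e / 5 by rewrite divr_gt0.
pose n := (Num.truncn S).+1; have Sn : S < n%:R by exact: truncnS_gt.
have [m _ /(_ m (leqnn m)) /= me] := near_infty_natSinv_lt (PosNum e50).
have {}me : m.+1%:R^-1 < e / 5 := me.
have m0 : 0 < m.+1%:R :> R by rewrite ltr0n.
have mV0 : 0 < m.+1%:R^-1 :> R by rewrite invr_gt0.
have [p pP] : exists p : nat, forall (i : 'I_N) s t, 0 <= t <= n%:R -> `|s - t| <= p.+1%:R^-1 ->
    `|pval u s 0 i - pval u t 0 i| <= m.+1%:R^-1.
  have : \forall p \near \oo, forall (i : 'I_N) s t, 0 <= t <= n%:R -> `|s - t| <= p.+1%:R^-1 ->
    `|pval u s 0 i - pval u t 0 i| <= m.+1%:R^-1.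
    apply: filter_forall => i; apply: segment_uniformly_continuous => //.
    exact: (coord_cont (@pval_continuous _ _ _ _ u)).
  by move=> [p _ pP]; exists p; exact: (pP p (leqnn p)).
have p0 : 0 < p.+1%:R :> R by rewrite ltr0n.
pose a := mkseq (fun q => [seq Num.floor (pval u (q%:R / p.+1%:R) 0 i * m.+1%:R) | i <- enum 'I_N])
  (n * p.+1).
have uc : step_tube (n, m, p, a) u.
  move=> j k; set t := dyadic j k => tn i.
  have t0 : 0 <= t by exact: dyadic_ge0.
  have tp0 : 0 <= t * p.+1%:R by rewrite mulr_ge0 // ltW.
  pose q := Num.truncn (t * p.+1%:R).
  have q1 : q%:R <= t * p.+1%:R by rewrite truncn_le.
  have q2 : t * p.+1%:R < q%:R + 1 by rewrite natr1 truncnS_gt.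
  have qn : (q < n * p.+1)%N.
    by rewrite -(ltr_nat R) natrM; apply: (le_lt_trans q1); rewrite ltr_pM2r.
  have sE : step_value m p a t i = (Num.floor (pval u (q%:R / p.+1%:R) 0 i * m.+1%:R))%:~R / m.+1%:R.
    rewrite /step_value nth_mkseq // (nth_map i) ?size_enum_ord //.
    by rewrite nth_ord_enum.
  have h1 : `|pval u t 0 i - pval u (q%:R / p.+1%:R) 0 i| <= m.+1%:R^-1.
    apply: pP.
      rewrite divr_ge0 ?(ltW p0) //= ler_pdivrMr //; apply: (le_trans q1).
      by rewrite ler_pM2r // ltW.
    rewrite ger0_norm; last by rewrite subr_ge0 ler_pdivrMr.
    rewrite -(ler_pM2r p0) mulrBl divfK ?mulVf ?lt0r_neq0 //; lra.
  have := floor_itv (pval u (q%:R / p.+1%:R) 0 i * m.+1%:R).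
  rewrite sE intrD => /andP[f1 f2].
  have h2 : `|pval u (q%:R / p.+1%:R) 0 i -
      (Num.floor (pval u (q%:R / p.+1%:R) 0 i * m.+1%:R))%:~R / m.+1%:R| <= m.+1%:R^-1.
    rewrite ger0_norm; last by rewrite subr_ge0 ler_pdivrMr.
    rewrite -(ler_pM2r m0) mulrBl divfK ?mulVf ?lt0r_neq0 //; lra.
  rewrite -(subrKA (pval u (q%:R / p.+1%:R) 0 i)); apply: (le_trans (ler_normD _ _)).
  by apply: (le_trans (lerD h1 h2)); rewrite mulr2n mulrDl mul1r.
exists (n, m, p, a) => // v vc; apply: tG => t /andP[t0 tS].
apply: norm_lt_coord => // i; rewrite !mxE.
apply: (@le_lt_trans _ _ (4 / m.+1%:R)); last by move: (m.+1%:R^-1) me => z; lra.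
apply: (@dyadic_dense R (fun t => `|pval v t 0 i - pval u t 0 i|) n%:R).
- move=> r; apply: cvg_norm; apply: cvgB; exact: (coord_cont (@pval_continuous _ _ _ _ _)).
- move=> j k jk; have := vc j k jk i; have := uc j k jk i.
  move: (step_value _ _ _ _ _) (pval v _ 0 i) (pval u _ 0 i) (m.+1%:R^-1) => A b c z.
  rewrite distrC => h1 h2; rewrite -(subrKA A); apply: (le_trans (ler_normD _ _)); lra.
- by rewrite t0 (le_lt_trans tS).
Qed.

(** Only the coordinates are known to be measurable. An open set is a union of step tubes, which
    have countably many codes and involve countably many times each. *)
Lemma measurable_preimage_open (G : set (path_space l x)) : open G -> measurable (Z @^-1` G).
Proof.
move=> oG.
have -> : Z @^-1` G = \bigcup_c [set w | step_tube c `<=` G /\ step_tube c (Z w)].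
  apply/seteqP; split => [w /= Gw|w [c _ [cG cw]]]; last exact: cG.
  by have [c cG cw] := open_step_tube oG Gw; exists c.
apply: countable_bigcupT_measurable; first exact: countableP.
move=> c; have [h|h] := pselect (step_tube c `<=` G).
  rewrite (_ : [set w | _] = Z @^-1` step_tube c); first exact: measurable_step_tube.
  by apply/seteqP; split => [w []|w hw] //; split.
rewrite (_ : [set w | _] = set0) //.
by apply/seteqP; split => w // [].
Qed.

End Measurability.

Section ExtendedProducts.
Context {R : realType}.

Lemma prod_le_EFin (J : finType) (f : J -> \bar R) (b : J -> R) :
  (forall j, (0 <= f j)%E) -> (forall j, (f j <= (b j)%:E)%E) -> (\prod_j f j <= (\prod_j b j)%:E)%E.
Proof.
move=> f0 fb; have b0 j : 0 <= b j by rewrite -lee_fin (le_trans (f0 j)).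
suff [] : (0 <= \prod_j f j)%E /\ (\prod_j f j <= (\prod_j b j)%:E)%E by [].
elim/big_ind2: _ => [|x1 x2 y1 y2 [h1 h2] [h3 h4]|j _]; first by rewrite lee_fin ler01.
  by split; [exact: mule_ge0|rewrite EFinM; exact: lee_pmul].
by split.
Qed.

Lemma EFin_le_prod (J : finType) (f : J -> \bar R) (b : J -> R) :
  (forall j, 0 <= b j) -> (forall j, ((b j)%:E <= f j)%E) -> ((\prod_j b j)%:E <= \prod_j f j)%E.
Proof.
move=> b0 bf.
suff [] : (0 <= \prod_j b j)%R /\ ((\prod_j b j)%:E <= \prod_j f j)%E by [].
elim/big_ind2: _ => [|x1 x2 y1 y2 [h1 h2] [h3 h4]|j _]; first by rewrite ler01.
  by split; [exact: mulr_ge0|rewrite EFinM; apply: lee_pmul; rewrite ?lee_fin].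
by split.
Qed.

Lemma prod_scaled_expR (J : finType) (c : R) (f : J -> R) :
  \prod_j (c * expR (f j)) = c ^+ #|J| * expR (\sum_j f j).
Proof. by rewrite big_split /= prodr_const expR_sum. Qed.

End ExtendedProducts.

(** * Independent increments over the grid *)

Section GridIncrements.
Context {R : realType} {d : measure_display} {T : measurableType d}.
Context (P : probability T R) (N : nat) (B : R -> T -> 'rV[R]_N).
Hypothesis hB : brownian_motion P B.
Variables (p : nat) (kappa : R).
Hypothesis kappa0 : 0 < kappa.

Local Notation J := ('I_(p * 8 ^ p) * 'I_N)%type.

Definition noise_incr (ki : J) (w : T) : R :=
  B (node p ki.1.+1) w 0 ki.2 - B (node p ki.1) w 0 ki.2.

Definition grid_incr (ki : J) (w : T) : R := Num.sqrt kappa * noise_incr ki w.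

Lemma grid_independent (A : J -> set R) : (forall ki, measurable (A ki)) ->
  P [set w | forall ki : J, A ki (noise_incr ki w)] =
  (\prod_ki P [set w | A ki (noise_incr ki w)])%E.
Proof.
move=> mA; have := @bm_increments _ _ _ _ _ _ hB (p * 8 ^ p) (node p) (node_ge0 p 0) (fun k _ => node_lt p k) A mA.
rewrite (_ : \bigcap_j _ = [set w | forall ki : J, A ki (noise_incr ki w)]) //.
by apply/seteqP; split => w H ki => [|_]; exact: H.
Qed.

Lemma measurable_grid (A : J -> set R) : (forall ki, measurable (A ki)) ->
  measurable [set w | forall ki : J, A ki (noise_incr ki w)].
Proof.
move=> mA.
rewrite (_ : [set w | _] = \bigcap_ki [set w | A ki (noise_incr ki w)]).
  rewrite -[X in measurable X]setCK setC_bigcap; apply: measurableC.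
  apply: countable_bigcupT_measurable; first exact: countableP.
  by move=> ki; apply: measurableC; apply: (measurable_increment hB) => //; exact: node_ge0.
by apply/seteqP; split => w H ki => [_|]; exact: H.
Qed.

(** All increments have variance [kappa / 8 ^+ p], so the exponents of the independent tails add up;
    the prefactor depends on [p] and [N] but not on [kappa]. *)
Lemma grid_box_prob (y : J -> R) : (forall ki, 0 <= y ki) ->
  measurable [set w | forall ki : J, y ki <= `|grid_incr ki w|] /\
  (P [set w | forall ki : J, (y ki <= `|grid_incr ki w|)%R] <=
    (2 ^+ #|{: J}| * expR (- (\sum_ki y ki ^+ 2) / (2 * kappa / 8 ^+ p)))%:E)%E.
Proof.
move=> y0; pose A ki : set R := [set z | y ki <= `|Num.sqrt kappa * z|].
have mA ki : measurable (A ki) by exact: measurable_ge_norm.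
split; first exact: (measurable_grid mA).
rewrite -[X in P X]/([set w | forall ki : J, A ki (noise_incr ki w)]).
rewrite (grid_independent mA).
have -> : - (\sum_ki y ki ^+ 2) / (2 * kappa / 8 ^+ p) = \sum_ki - y ki ^+ 2 / (2 * kappa / 8 ^+ p).
  by rewrite -mulr_suml sumrN.
rewrite -prod_scaled_expR; apply: prod_le_EFin => ki; first exact: measure_ge0.
have := increment_tail hB ki.2 kappa0 (node_ge0 p ki.1) (node_lt p ki.1) (y0 ki).
by rewrite nodeS.
Qed.

Lemma grid_tube_prob (m : J -> R) (r : R) : kappa <= 1 -> 0 < r ->
  measurable [set w | forall ki : J, `|grid_incr ki w - m ki| < r] /\
  (((2 * r * normal_peak (Num.sqrt (8 ^- p))) ^+ #|{: J}| *
     expR (- (\sum_ki (`|m ki| + r) ^+ 2) / (2 * kappa / 8 ^+ p)))%:E <=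
   P [set w | forall ki : J, (`|grid_incr ki w - m ki| < r)%R])%E.
Proof.
move=> k1 r0; pose A ki : set R := [set z | `|Num.sqrt kappa * z - m ki| < r].
have mA ki : measurable (A ki) by exact: measurable_lt_norm.
split; first exact: (measurable_grid mA).
rewrite -[X in P X]/([set w | forall ki : J, A ki (noise_incr ki w)]).
rewrite (grid_independent mA).
have -> : - (\sum_ki (`|m ki| + r) ^+ 2) / (2 * kappa / 8 ^+ p) =
  \sum_ki - (`|m ki| + r) ^+ 2 / (2 * kappa / 8 ^+ p).
  by rewrite -mulr_suml sumrN.
rewrite -prod_scaled_expR; apply: EFin_le_prod => ki.
  by rewrite !mulr_ge0 ?expR_ge0 ?normal_peak_ge0 // ltW.
have := increment_interval hB (m ki) ki.2 kappa0 k1 (node_ge0 p ki.1) (node_lt p ki.1) r0.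
by rewrite nodeS.
Qed.

End GridIncrements.

Section Solution.
Context {R : realType} (N : nat).
Variables (Gamma : set (Cplx R)) (l : R) (gamma : R -> Cplx R).
Hypothesis hgamma : arc_length_param Gamma l gamma.
Variable x : 'rV[R]_N.
Hypothesis hx : Ddom l x.
Context {d : measure_display} {T : measurableType d} (P : probability T R).
Variable B : R -> T -> 'rV[R]_N.
Hypothesis hB : brownian_motion P B.
Variables (kappa : R) (X : T -> path_space l x).
Hypothesis hX : strong_solution P gamma B kappa X.

Local Notation drive := (drive gamma).

Lemma brownian_filtration_measurable t C : brownian_filtration P B t C -> measurable C.
Proof.
apply: smallest_sub; first exact: sigma_algebra_measurable.
move=> A [[s [i [D [s0 _ mD ->]]]]|[]//].
rewrite -[X in measurable X]setTI; exact: (bm_measurable hB i s0).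
Qed.

Lemma solution_coord_measurable t i : 0 <= t -> measurable_fun setT (fun w => pval (X w) t 0 i).
Proof.
move=> t0 _ A mA; rewrite setTI; apply: (@brownian_filtration_measurable t).
exact: (ss_adapted hX).
Qed.

Lemma solution_measurable (G : set (path_space l x)) : open G -> measurable (X @^-1` G).
Proof. by apply: measurable_preimage_open => // t i; exact: solution_coord_measurable. Qed.

Lemma solution_measurable_closed (F : set (path_space l x)) : closed F -> measurable (X @^-1` F).
Proof.
move=> cF; rewrite -[X in measurable X]setCK preimage_setC; apply: measurableC.
by apply: solution_measurable; exact: closed_openC.
Qed.

(** There are no collisions in [D], so [grad V] is [- drift] along the whole path, and the noise is
    read off the equation for all times outside one null set. *)
Lemma solution_drive : exists2 Z : set T, measurable Z /\ P Z = 0%E &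
  forall w, ~ Z w -> forall t i, 0 <= t -> drive (X w) i t = Num.sqrt kappa * B t w 0 i.
Proof.
have [Z [mZ PZ ZP]] := ss_equation hX.
exists Z => // w nZ t i t0.
have eqn : forall t, 0 <= t -> pval (X w) t = x + Num.sqrt kappa *: B t w
      - \row_i \int[lebesgue_measure]_(s in `[0, t]) grad (Venergy gamma) (pval (X w) s) 0 i.
  by apply: contrapT => h; apply: nZ; exact: ZP.
rewrite drive_def [in LHS](eqn t t0) !mxE.
under eq_Rintegral => s _.
  rewrite (grad_Venergy hgamma); last by move=> a b; apply: (Ddom_rho hgamma); exact: pval_Ddom.
  over.
rewrite (_ : Rintegral _ _ (fun s => - _) =
  - \int[lebesgue_measure]_(s in `[0, t]) drift gamma (pval (X w) s) i).
  by ring.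
rewrite -mulN1r -RintegralZl //.
  by apply: eq_Rintegral => s _; rewrite mulN1r.
by apply: continuous_integrable; exact: (pval_drift_cont hgamma hx).
Qed.

End Solution.

(** * Large deviations *)

Section LogLimits.
Context {R : realType}.
Local Notation F := (0^'+ : set_system R).

(** One unit of extra rate is worth a factor [k]; this makes rough noise negligible in the lower
    bound. *)
Lemma expR_inv_le (k : R) : 0 < k -> expR (- k^-1) <= k.
Proof.
move=> k0; rewrite expRN invf_ple ?posrE ?expR_gt0 //.
by apply: le_trans (expR_ge1Dx _); rewrite lerDr.
Qed.

Lemma half_bound (c E M z kappa : R) : 0 < M -> 0 <= E -> kappa <= c / (2 * M) ->
  c * E <= z + M * (E * kappa) -> c / 2 * E <= z.
Proof.
move=> M0 E0; rewrite ler_pdivlMr ?mulr_gt0 // => h1 h2.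
have : M * (E * kappa) <= c / 2 * E by rewrite mulrCA mulrC ler_wpM2r //; lra.
lra.
Qed.

Lemma real_dense (a b : \bar R) : (a < b)%E -> exists r : R, (a < r%:E)%E /\ (r%:E < b)%E.
Proof.
case: a b => [a| |] [b| |] //=.
- by rewrite lte_fin => ab; exists ((a + b) / 2); rewrite !lte_fin; split; lra.
- by move=> _; exists (a + 1); rewrite lte_fin ltry; split => //; lra.
- by move=> _; exists (b - 1); rewrite lte_fin ltNyr; split => //; lra.
- by move=> _; exists 0; rewrite ltNyr ltry.
Qed.

Lemma limf_esup_le (f : R -> \bar R) (c : \bar R) k0 : 0 < k0 ->
  (forall k, 0 < k -> k <= k0 -> (f k <= c)%E) -> (limf_esup f F <= c)%E.
Proof.
move=> k00 H; rewrite limf_esupE.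
apply: (@le_trans _ _ (ereal_sup (f @` [set k | 0 < k /\ k <= k0]))); last first.
  by apply: ge_ereal_sup => _ [k [h1 h2] <-]; exact: H.
apply: ereal_inf_lbound; exists [set k | 0 < k /\ k <= k0] => //.
near=> k; split; near: k; [exact: nbhs_right_gt|exact: nbhs_right_le].
Unshelve. all: by end_near. Qed.

Lemma le_limf_einf (f : R -> \bar R) (c : \bar R) k0 : 0 < k0 ->
  (forall k, 0 < k -> k <= k0 -> (c <= f k)%E) -> (c <= limf_einf f F)%E.
Proof.
move=> k00 H; rewrite /limf_einf leeNr; apply: (limf_esup_le k00) => k h1 h2.
by rewrite leeN2; exact: H.
Qed.

(** [k * ln C] tends to [0]: a prefactor that does not depend on [k] is invisible on this scale, and
    [eps] absorbs it. *)
Lemma limf_esup_exp (q : R -> \bar R) (C b k0 eps : R) : 0 < C -> 0 < k0 -> 0 < eps ->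
  (forall k, 0 <= q k)%E ->
  (forall k, 0 < k -> k <= k0 -> (q k <= (C * expR (- (b / k)))%:E)%E) ->
  (limf_esup (fun k : R => k%:E * lne (q k)) F <= (- b + eps)%:E)%E.
Proof.
move=> C0 k00 eps0 q0 H.
have D0 : 0 < `|ln C| + 1 by rewrite ltr_wpDl.
apply: (@limf_esup_le _ _ (Num.min k0 (eps / (`|ln C| + 1)))).
  by rewrite lt_min k00 divr_gt0.
move=> k kpos; rewrite le_min => /andP[kk0 keps].
have E0 : 0 < C * expR (- (b / k)) by rewrite mulr_gt0 // expR_gt0.
apply: (@le_trans _ _ (k%:E * lne ((C * expR (- (b / k)))%:E))%E).
  apply: lee_wpmul2l; first by rewrite lee_fin ltW.
  by rewrite lee_lne ?H // in_itv /= ?q0 ?leey // lee_fin ltW.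
rewrite lne_EFin // -EFinM lee_fin lnM ?posrE ?expR_gt0 // expRK mulrDr.
have -> : k * - (b / k) = - b by field; rewrite lt0r_neq0.
rewrite addrC lerD2l; apply: (@le_trans _ _ (k * (`|ln C| + 1))).
  by rewrite ler_wpM2l ?(ltW kpos) // (le_trans (ler_norm _)) // lerDl.
by rewrite -ler_pdivlMr.
Qed.

Lemma limf_einf_exp (q : R -> \bar R) (C b k0 eps : R) : 0 < C -> 0 < k0 -> 0 < eps ->
  (forall k, 0 < k -> k <= k0 -> ((C * expR (- (b / k)))%:E <= q k)%E) ->
  ((- b - eps)%:E <= limf_einf (fun k : R => k%:E * lne (q k)) F)%E.
Proof.
move=> C0 k00 eps0 H.
have D0 : 0 < `|ln C| + 1 by rewrite ltr_wpDl.
apply: (@le_limf_einf _ _ (Num.min k0 (eps / (`|ln C| + 1)))).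
  by rewrite lt_min k00 divr_gt0.
move=> k kpos; rewrite le_min => /andP[kk0 keps].
have E0 : 0 < C * expR (- (b / k)) by rewrite mulr_gt0 // expR_gt0.
apply: (@le_trans _ _ (k%:E * lne ((C * expR (- (b / k)))%:E))%E); last first.
  apply: lee_wpmul2l; first by rewrite lee_fin ltW.
  have Hk := H k kpos kk0; have E1 : (0 <= (C * expR (- (b / k)))%:E)%E by rewrite lee_fin ltW.
  by rewrite lee_lne // in_itv /= leey ?andbT // (le_trans E1).
rewrite lne_EFin // -EFinM lee_fin lnM ?posrE ?expR_gt0 // expRK mulrDr.
have -> : k * - (b / k) = - b by field; rewrite lt0r_neq0.
rewrite [leRHS]addrC lerD2l lerNl; apply: (@le_trans _ _ (k * (`|ln C| + 1))).
  by rewrite -mulrN ler_wpM2l ?(ltW kpos) // (le_trans (ler_norm _)) // normrN lerDl.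
by rewrite -ler_pdivlMr.
Qed.

End LogLimits.

Section LargeDeviations.
Context {R : realType} (N : nat).
Variables (Gamma : set (Cplx R)) (l : R) (gamma : R -> Cplx R).
Hypothesis hgamma : arc_length_param Gamma l gamma.
Variable x : 'rV[R]_N.
Hypothesis hx : Ddom l x.
Context {d : measure_display} {T : measurableType d} (P : probability T R).
Variable B : R -> T -> 'rV[R]_N.
Hypothesis hB : brownian_motion P B.
Variable X : R -> T -> path_space l x.
Hypothesis hX : forall kappa : R, 0 < kappa -> kappa <= 2 ->
  strong_solution P gamma B kappa (X kappa).

Local Notation drive := (drive gamma).
Local Notation good := (good gamma).
Lemma cell_oscillation p (kappa lam : R) (k : nat) (i : 'I_N) w (v : path_space l x) : 0 <= lam ->
  (forall t, 0 <= t -> drive v i t = Num.sqrt kappa * B t w 0 i) ->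
  ~ rough B kappa (node p k) (8 ^- p) lam i w ->
  forall t, node p k <= t <= node p k.+1 -> `|drive v i t - drive v i (node p k)| <= lam.
Proof.
move=> lam0 vB nr; have -> : node p k.+1 = node p k + 8 ^- p :> R by rewrite -(nodeS p k) addrC subrK.
apply: (not_rough lam0 (@drive_cont _ _ _ _ _ hgamma _ hx v i) _ _ nr).
  by rewrite invr_gt0 pow8_gt0.
by move=> t /andP[t0 _]; apply: vB; exact: le_trans (node_ge0 p k) t0.
Qed.

Lemma good_of_noise a p (kappa : R) w (v : path_space l x) :
  (forall t i, 0 <= t -> drive v i t = Num.sqrt kappa * B t w 0 i) ->
  \sum_(ki : 'I_(p * 8 ^ p) * 'I_N) grid_incr B kappa ki w ^+ 2 <= 2 * a / 8 ^+ p ->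
  (forall ki : 'I_(p * 8 ^ p) * 'I_N, ~ rough B kappa (node p ki.1) (8 ^- p) (2 ^- p) ki.2 w) ->
  good a p v.
Proof.
move=> vB en nr; split.
  apply: le_trans en; rewrite big_mkord pair_big /=; apply: ler_sum => -[k i] _ /=.
  by rewrite /grid_incr /noise_incr !vB ?node_ge0 // -mulrBr.
move=> k s i kp; apply: (cell_oscillation _ (vB^~ i) (nr (Ordinal kp, i))).
by rewrite invr_ge0 exprn_ge0.
Qed.

Lemma rough_prob_le p (kappa lam b : R) (k : nat) i : 0 < kappa -> 0 < lam ->
  3 * 2 ^+ 8 * kappa <= lam ^+ 2 * 8 ^+ p -> 32 * b <= lam ^+ 2 * 8 ^+ p ->
  measurable (rough B kappa (node p k) (8 ^- p) lam i) /\
  (P (rough B kappa (node p k) (8 ^- p) lam i) <= (4 * expR (- (b / kappa)))%:E)%E.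
Proof.
move=> k0 lam0 h1 h2; have h0 : 0 < 8 ^- p :> R by rewrite invr_gt0 pow8_gt0.
have qE : lam ^+ 2 / (8 ^- p * kappa) = lam ^+ 2 * 8 ^+ p / kappa by rewrite invfM invrK mulrA.
have q1 : 3 * 2 ^+ 8 <= lam ^+ 2 / (8 ^- p * kappa) by rewrite qE ler_pdivlMr.
have [mr pr] := rough_prob hB i k0 (node_ge0 p k) h0 lam0 q1.
split => //; apply: (le_trans pr); rewrite lee_fin ler_pM2l // ler_expR lerN2.
rewrite [32 * _]mulrC invfM mulrA qE ler_pdivrMr // mulrAC divfK ?lt0r_neq0 //.
by rewrite ler_pdivlMr // mulrC.
Qed.

Lemma closed_prob (F : set (path_space l x)) a eps : closed F -> 0 < eps ->
  (forall u, F u -> ~ energy_le (drive u) a) ->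
  exists C k0 : R, [/\ 0 < C, 0 < k0 & forall kappa, 0 < kappa -> kappa <= k0 ->
    (P (X kappa @^-1` F) <= (C * expR (- ((a - eps) / kappa)))%:E)%E].
Proof.
move=> cF eps0 HF; have [p0 p0P] := closed_not_good hgamma hx cF HF.
have b0 : 0 < (32 * (`|a| + 1))^-1 by rewrite invr_gt0 mulr_gt0 // ltr_wpDl.
have [p1 p1P] := pow2_small b0.
have [p pp0 pp1] : exists2 p : nat, (p0 <= p)%N & (p1 <= p)%N by exists (maxn p0 p1);
  rewrite ?leq_maxl ?leq_maxr.
(* For the tolerance [2 ^- p] the roughness exponent is [(2 ^- p) ^+ 2 * 8 ^+ p / 32 = 2 ^+ p / 32],
   which has to be at least [a]. *)
have two : 32 * a <= 2 ^+ p.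
  have := p1P p pp1; rewrite lef_pV2 ?posrE ?exprn_gt0 ?mulr_gt0 ?ltr_wpDl // => h.
  by apply: le_trans h; rewrite ler_pM2l // (le_trans (ler_norm a)) // lerDl.
have lamE : (2 ^- p) ^+ 2 * 8 ^+ p = 2 ^+ p :> R.
  have -> : 8 ^+ p = 2 ^+ p * (2 ^+ p * 2 ^+ p) :> R by rewrite -!exprMn; congr (_ ^+ p); ring.
  by field; rewrite expf_neq0.
have lam0 : 0 < 2 ^- p :> R by rewrite invr_gt0 exprn_gt0.
have h0 : 0 < 8 ^+ p :> R by exact: pow8_gt0.
pose J := ('I_(p * 8 ^ p) * 'I_N)%type.
(* Dividing by twice the variance [kappa / 8 ^+ p] of an increment turns the threshold
   [2 * a / 8 ^+ p] with slack [eta] into the exponent [(a - eps) / kappa]. *)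
have [eta etaE] : exists eta, eta = 2 * eps / 8 ^+ p by eexists.
have eta0 : 0 < eta by rewrite etaE divr_gt0 // mulr_gt0.
have [I [y [y0 yS yC]]] := box_cover J (2 * a / 8 ^+ p) eta0.
have [C CE] : exists C : R, C = #|{: option (I + J)}|%:R * (2 ^+ #|{: J}| + 4) by eexists.
have pJ0 : 0 <= 2 ^+ #|{: J}| :> R by rewrite exprn_ge0.
have C0 : 0 < C.
  by rewrite CE mulr_gt0 ?ltr_wpDl // ltr0n; apply/card_gt0P; exists None.
have c0 : 0 < 3 * 2 ^+ 8 :> R by rewrite mulr_gt0 // exprn_gt0.
have kp0 : 0 < Num.min 2 (2 ^+ p / (3 * 2 ^+ 8)) :> R.
  by rewrite lt_min ltr0n divr_gt0 // exprn_gt0.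
exists C, (Num.min 2 (2 ^+ p / (3 * 2 ^+ 8))); split; [exact: C0|exact: kp0|].
move=> kappa k0; rewrite le_min => /andP[k2 kp].
have sol := hX k0 k2.
have [Z [mZ PZ] ZP] := solution_drive hgamma hx sol.
pose box (q : I) : set T := [set w | forall ki : J, y q ki <= `|grid_incr B kappa ki w|].
pose rgh (ki : J) : set T := rough B kappa (node p ki.1) (8 ^- p) (2 ^- p) ki.2.
pose E := expR (- ((a - eps) / kappa)).
have boxP q : measurable (box q) /\ (P (box q) <= (2 ^+ #|{: J}| * E)%:E)%E.
  have [mb pb] := grid_box_prob hB k0 (y0 q); split => //; apply: (le_trans pb).
  rewrite lee_fin ler_pM2l ?exprn_gt0 // ler_expR.
  rewrite mulNr lerN2 ler_pdivrMr // mulrAC.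
  have D0 : 0 < 2 * kappa / 8 ^+ p by rewrite divr_gt0 // mulr_gt0.
  rewrite ler_pdivlMr //; have := yS q; rewrite etaE.
  have -> : (a - eps) * (2 * kappa / 8 ^+ p) = (2 * a / 8 ^+ p - 2 * eps / 8 ^+ p) * kappa by ring.
  by rewrite ler_pM2r.
have rghP ki : measurable (rgh ki) /\ (P (rgh ki) <= (4 * E)%:E)%E.
  have h1 : 3 * 2 ^+ 8 * kappa <= (2 ^- p) ^+ 2 * 8 ^+ p.
    by move: kp; rewrite lamE ler_pdivlMr // mulrC.
  have h2 : 32 * (a - eps) <= (2 ^- p) ^+ 2 * 8 ^+ p.
    by rewrite lamE; apply: le_trans two; rewrite ler_pM2l // gerBl ltW.
  exact: (rough_prob_le ki.1 ki.2 k0 lam0 h1 h2).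
(* [None] stands for the null set off which the driving function is [sqrt kappa B]. *)
pose A (j : option (I + J)) : set T :=
  match j with None => Z | Some (inl q) => box q | Some (inr ki) => rgh ki end.
have mA j : measurable (A j).
  by case: j => [[q|ki]|] //=; [case: (boxP q)|case: (rghP ki)].
have mF := solution_measurable_closed hB sol cF.
apply: (le_trans (@finite_subadditive _ _ _ P _ A _ mF mA _)).
  move=> w Fw; apply: contrapT => nA.
  have nZ : ~ Z w by move=> Zw; apply: nA; exists None.
  have nr ki : ~ rgh ki w by move=> h; apply: nA; exists (Some (inr ki)).
  apply: (p0P p (X kappa w) pp0) => //.
  apply: (good_of_noise (ZP w nZ)) => //.
  rewrite leNgt; apply/negP => /yC [q hq]; apply: nA.
  by exists (Some (inl q)).
apply: (@le_trans _ _ (\sum_(j : option (I + J)) ((2 ^+ #|{: J}| + 4) * E)%:E)%E).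
  apply: lee_sum => j _; have E0 : 0 <= E by exact: expR_ge0.
  case: j => [[q|ki]|] /=.
  - apply: le_trans (boxP q).2 _; rewrite lee_fin ler_wpM2r // lerDl //.
  - apply: le_trans (rghP ki).2 _; rewrite lee_fin ler_wpM2r // lerDr //.
  - by rewrite PZ lee_fin mulr_ge0 // addr_ge0.
by rewrite sumEFin lee_fin sumr_const -[leLHS]mulr_natl CE mulrA.
Qed.

(** Three errors of [delta / 4]: the oscillation of each driving function on a cell, and the grid
    increments, whose errors [r] accumulate over at most [p * 8 ^ p] cells. *)
Lemma drive_close_of_grid p (kappa r delta S : R) w (u v : path_space l x) : 0 <= r -> S < p%:R ->
  (p * 8 ^ p)%:R * r <= delta / 4 -> 2 ^- p <= delta / 4 ->
  (forall k s i, (k < p * 8 ^ p)%N -> node p k <= s <= node p k.+1 ->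
     `|drive u i s - drive u i (node p k)| <= 2 ^- p) ->
  (forall t i, 0 <= t -> drive v i t = Num.sqrt kappa * B t w 0 i) ->
  (forall ki : 'I_(p * 8 ^ p) * 'I_N, ~ rough B kappa (node p ki.1) (8 ^- p) (delta / 4) ki.2 w) ->
  (forall ki : 'I_(p * 8 ^ p) * 'I_N,
     `|grid_incr B kappa ki w - (drive u ki.2 (node p ki.1.+1) - drive u ki.2 (node p ki.1))| < r) ->
  forall t i, 0 <= t <= S -> `|drive v i t - drive u i t| <= delta.
Proof.
move=> r0 Sp Kr pd osc vB nr tubeP t i /andP[t0 tS].
have delta0 : 0 <= delta / 4 by apply: le_trans pd; rewrite invr_ge0 exprn_ge0.
have tp : t < p%:R by exact: le_lt_trans Sp.
have /andP[c1 c2] := cellP p t0; have kp := cell_lt t0 tp; set k := cell p t in c1 c2 kp *.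
have tk : node p k <= t <= node p k.+1 by rewrite c1 ltW.
have h1 := le_trans (osc k t i kp tk) pd.
have h2 := cell_oscillation delta0 (vB^~ i) (nr (Ordinal kp, i)) tk.
have h3 : forall j, (j <= p * 8 ^ p)%N -> `|drive v i (node p j) - drive u i (node p j)| <= j%:R * r.
  elim=> [_|j IH jK]; first by rewrite node0 !drive0 subrr normr0 mul0r.
  have := IH (ltnW jK); have := tubeP (Ordinal jK, i) => /=.
  rewrite /grid_incr /noise_incr /= mulrBr -!vB ?node_ge0 // -natr1.
  move: (drive v i _) (drive v i _) (drive u i _) (drive u i _) => A b c e h4 h5.
  rewrite mulrDl mul1r.
  have -> : b - e = (A - c) + (b - A - (e - c)) by ring.
  apply: (le_trans (ler_normD _ _)); rewrite lerD // ltW //.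
have h4 : `|drive v i (node p k) - drive u i (node p k)| <= delta / 4.
  apply: (le_trans (h3 k (ltnW kp))); apply: le_trans Kr.
  by rewrite ler_wpM2r // ler_nat ltnW.
move: h1 h2 h4 => /=.
move: (drive v i t) (drive v i (node p k)) (drive u i t) (drive u i (node p k)) => A b c e h1 h2 h4.
have -> : A - c = (A - b) + ((b - e) - (c - e)) by ring.
apply: (le_trans (ler_normD _ _)); have := lerD h2 (le_trans (ler_normB _ _) (lerD h4 h1)).
by move: delta0; lra.
Qed.

(** When the grid increments of the noise are near those of [drive u], the solution is in [G] unless
    a cell is rough or the null set is hit. These exceptions are rarer than the lower bound for the
    grid event by a factor of order [kappa], so half of that bound remains. *)
Lemma open_prob (G : set (path_space l x)) u a eps : open G -> G u -> 0 < eps ->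
  energy_le (drive u) a ->
  exists C k0 : R, [/\ 0 < C, 0 < k0 & forall kappa, 0 < kappa -> kappa <= k0 ->
    ((C * expR (- ((a + eps) / kappa)))%:E <= P (X kappa @^-1` G))%E].
Proof.
move=> oG Gu eps0 ua.
have /nbhs_tube[S [e [S0 e0 tG]]] : nbhs u G by exact: open_nbhs_nbhs.
have [delta delta0 stab] := drive_stable hgamma hx u (ltW S0) e0.
have [p1 p1P] := energy_good ua.
have d40 : 0 < delta / 4 by rewrite divr_gt0.
have [lam lamE] : exists lam, lam = delta / 4 by eexists.
have lam0 : 0 < lam by rewrite lamE.
have [p2 p2P] := pow2_small lam0.
have M0 : 0 < lam ^+ 2 / (32 * (`|a| + eps + 1)).
  by rewrite divr_gt0 ?exprn_gt0 // mulr_gt0 // ltr_wpDl // addr_ge0 // ltW.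
have [p3 p3P] := pow2_small M0.
have [p [pp1 pp2 pp3 pS]] : exists p : nat, [/\ (p1 <= p)%N, (p2 <= p)%N, (p3 <= p)%N & (Num.truncn S < p)%N].
  by exists (p1 + (p2 + (p3 + (Num.truncn S).+1)))%N; clear; split; lia.
have Sp : S < p%:R by apply: lt_le_trans (truncnS_gt S) _; rewrite ler_nat.
have h80 : 0 < 8 ^+ p :> R by exact: pow8_gt0.
have gu := p1P p pp1; case: (gu) => gen gosc.
have smallp : 2 ^- p <= delta / 4 by rewrite -lamE; exact: p2P.
(* The extra [1] is the margin that [expR_inv_le] turns into the factor [kappa]. *)
have lam32 : 32 * (a + eps + 1) <= lam ^+ 2 * 8 ^+ p.
  have := le_trans (pow8_le p) (p3P p pp3).
  rewrite ler_pdivlMr; last by rewrite mulr_gt0 // ltr_wpDl // addr_ge0 // ltW.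
  rewrite mulrC ler_pdivrMr // => h; apply: le_trans h.
  by rewrite ler_pM2l // !lerD2r ler_norm.
pose J := ('I_(p * 8 ^ p) * 'I_N)%type.
pose m (ki : J) := drive u ki.2 (node p ki.1.+1) - drive u ki.2 (node p ki.1).
have mS : \sum_ki m ki ^+ 2 <= 2 * a / 8 ^+ p.
  by apply: le_trans gen; rewrite big_mkord pair_big.
have [Q QE] : exists Q, Q = \sum_ki `|m ki| by eexists.
have Q0 : 0 <= Q by rewrite QE sumr_ge0.
have [n nE] : exists n : R, n = #|{: J}|%:R by eexists.
have n0 : 0 <= n by rewrite nE.
have [K KE] : exists K : R, K = (p * 8 ^ p)%:R by eexists.
have K0 : 0 <= K by rewrite KE.
(* For [r <= 1], [(|m| + r) ^+ 2 <= m ^+ 2 + 2 * r * |m| + r]. Summed over the [n] increments, the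
   excess over the grid energy of [u] is at most [r * (2 * Q + n)]. *)
have [r [r0 r1 rK rQ]] : exists r : R, [/\ 0 < r, r <= 1, K * r <= delta / 4 &
    r * (2 * Q + n) <= 2 * eps / 8 ^+ p].
  have Kp : 0 < K + 1 by rewrite ltr_wpDl.
  have Qp : 0 < 2 * Q + n + 1 by rewrite ltr_wpDl // addr_ge0 // mulr_ge0.
  have e80 : 0 < 2 * eps / 8 ^+ p by rewrite divr_gt0 // mulr_gt0.
  exists (Num.min 1 (Num.min (delta / 4 / (K + 1)) (2 * eps / 8 ^+ p / (2 * Q + n + 1)))).
  set r := Num.min _ _.
  have r0 : 0 < r by rewrite /r !lt_min ltr01 (divr_gt0 d40 Kp) (divr_gt0 e80 Qp).
  have h1 : r * (K + 1) <= delta / 4 by rewrite -ler_pdivlMr // /r !ge_min lexx !orbT.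
  have h2 : r * (2 * Q + n + 1) <= 2 * eps / 8 ^+ p by rewrite -ler_pdivlMr // /r !ge_min lexx !orbT.
  split => //; first by rewrite ge_min lexx.
    by move: h1; rewrite mulrDr mulr1 mulrC; lra.
  by move: h2; rewrite mulrDr mulr1; lra.
have mrS : \sum_ki (`|m ki| + r) ^+ 2 <= 2 * (a + eps) / 8 ^+ p.
  have -> : 2 * (a + eps) / 8 ^+ p = 2 * a / 8 ^+ p + 2 * eps / 8 ^+ p by rewrite mulrDr mulrDl.
  apply: (@le_trans _ _ (\sum_ki m ki ^+ 2 + r * (2 * Q + n))); last exact: lerD.
  have -> : \sum_ki m ki ^+ 2 + r * (2 * Q + n) = \sum_ki (m ki ^+ 2 + (2 * r * `|m ki| + r)).
    rewrite !big_split /= -mulr_sumr -QE sumr_const -[X in _ = _ + (_ + X)]mulr_natl -nE; ring.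
  apply: ler_sum => ki _; rewrite -[m ki ^+ 2]real_normK ?num_real //.
  by move: (`|m ki|) => z; rewrite sqrrD; nra.
have [c cE] : exists c, c = (2 * r * normal_peak (Num.sqrt (8 ^- p))) ^+ #|{: J}| by eexists.
have c0 : 0 < c.
  rewrite cE exprn_gt0 // !mulr_gt0 //; apply: normal_peak_gt0.
  by rewrite lt0r_neq0 // sqrtr_gt0 invr_gt0.
have [M ME] : exists M : R, M = #|{: option J}|%:R * 4 by eexists.
have MM0 : 0 < M by rewrite ME mulr_gt0 // ltr0n; apply/card_gt0P; exists None.
have w0 : 0 < 3 * 2 ^+ 8 :> R by rewrite mulr_gt0 // exprn_gt0.
(* For [kappa <= c / (2 * M)] the exceptional events, of probability at most [M * (E * kappa)],
   remove at most half of [c * E]. *)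
exists (c / 2), (Num.min 1 (Num.min (c / (2 * M)) (lam ^+ 2 * 8 ^+ p / (3 * 2 ^+ 8)))).
split; first by rewrite divr_gt0.
  by rewrite !lt_min ltr01 divr_gt0 ?mulr_gt0 //= divr_gt0 // mulr_gt0 // exprn_gt0.
move=> kappa k0; rewrite !le_min => /and3P[k1 kM kl].
have k2 : kappa <= 2 by rewrite (le_trans k1) // ler1n.
have sol := hX k0 k2.
have [Z [mZ PZ] ZP] := solution_drive hgamma hx sol.
have [E EE] : exists E, E = expR (- ((a + eps) / kappa)) by eexists.
have E0 : 0 < E by rewrite EE expR_gt0.
rewrite -EE.
have [mA PA] := grid_tube_prob hB k0 m k1 r0.
set A := [set w | _] in mA PA.
pose rgh (ki : J) : set T := rough B kappa (node p ki.1) (8 ^- p) lam ki.2.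
have rghP ki : measurable (rgh ki) /\ (P (rgh ki) <= (4 * (E * kappa))%:E)%E.
  have h1 : 3 * 2 ^+ 8 * kappa <= lam ^+ 2 * 8 ^+ p.
    by move: kl; rewrite ler_pdivlMr // mulrC.
  have [mr pr] := rough_prob_le ki.1 ki.2 k0 lam0 h1 lam32.
  split => //; apply: (le_trans pr); rewrite lee_fin ler_pM2l //.
  rewrite EE (mulrDl (a + eps)) opprD expRD ler_wpM2l ?expR_ge0 // mul1r.
  exact: expR_inv_le.
pose bad (j : option J) : set T := match j with None => Z | Some ki => rgh ki end.
have mbad j : measurable (bad j) by case: j => [ki|] //=; case: (rghP ki).
have mU : measurable (\bigcup_j bad j).
  by apply: countable_bigcupT_measurable => //; exact: countableP.
have mG := solution_measurable hB sol oG.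
have PU : (P (\bigcup_j bad j) <= (M * (E * kappa))%:E)%E.
  apply: (le_trans (@finite_subadditive _ _ _ P _ bad _ mU mbad _)).
    by move=> w [j _ hj]; exists j.
  apply: (@le_trans _ _ (\sum_(j : option J) (4 * (E * kappa))%:E)%E).
    apply: lee_sum => -[ki|] _ /=; first by case: (rghP ki).
    by rewrite PZ lee_fin !mulr_ge0 // ltW.
  by rewrite sumEFin lee_fin sumr_const ME -mulrA [leRHS]mulr_natl.
have AG : A `<=` (X kappa @^-1` G) `|` \bigcup_j bad j.
  move=> w Aw; have [[j hj]|nb] := pselect (exists j, bad j w); first by right; exists j.
  left; apply: tG; apply: stab.
  have nZ : ~ Z w by move=> Zw; apply: nb; exists None.
  apply: (@drive_close_of_grid p kappa r delta S w u (X kappa w) (ltW r0) Sp) => //.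
  - by rewrite -KE.
  - exact: (ZP w nZ).
  - by move=> ki h; apply: nb; exists (Some ki); rewrite /= /rgh lamE.
have PAG : (P A <= P (X kappa @^-1` G) + P (\bigcup_j bad j))%E.
  apply: le_trans (measureU2 _ mG mU).
  by apply: le_measure; rewrite ?inE //; exact: measurableU.
have lowA : ((c * E)%:E <= P A)%E.
  apply: le_trans PA; rewrite -cE lee_fin ler_pM2l // EE ler_expR.
  rewrite mulNr lerN2 ler_pdivrMr; last by rewrite divr_gt0 // mulr_gt0.
  apply: (le_trans mrS); rewrite le_eqVlt; apply/orP; left; apply/eqP; field.
  by rewrite !lt0r_neq0.
have h := le_trans (le_trans lowA PAG) (leeD (lexx _) PU).
have fG : P (X kappa @^-1` G) \is a fin_num by exact: fin_num_measure.
move: h; rewrite -(fineK fG) -EFinD !lee_fin => h.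
exact: half_bound MM0 (ltW E0) kM h.
Qed.

Local Notation I := (fun u : path_space l x => rate gamma (pval u)).

Lemma rate_ge0 u : (0 <= I u)%E.
Proof. by have [H _ _] := rate_good hgamma hx; exact: H. Qed.

(** Separating the two sides by reals [r' < r] avoids a case analysis on infinite values; the gap
    pays for two losses of [(r - r') / 3], one in the probability bound and one in the limit. *)
Lemma solution_LDP_upper (F : set (path_space l x)) : closed F ->
  (limf_esup (fun kappa : R => kappa%:E * lne (P (X kappa @^-1` F))) 0^'+ <= - ereal_inf (I @` F))%E.
Proof.
move=> cF; set L := limf_esup _ _; set b := ereal_inf _.
rewrite leNgt; apply/negP => bL.
have [r [br rL]] := real_dense bL.
have [r' [br' rr']] := real_dense br; rewrite lte_fin in rr'.
have r'b : ((- r')%:E < b)%E by rewrite EFinN lteNl.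
have nE u : F u -> ~ energy_le (drive u) (- r').
  move=> Fu E; have := (rate_energy hgamma hx u (energy_le_ge0 E)).2 E.
  rewrite leNgt => /negP; apply; apply: (lt_le_trans r'b).
  by apply: ereal_inf_lbound; exists u.
have e0 : 0 < (r - r') / 3 by rewrite divr_gt0 // subr_gt0.
have [C [k0 [C0 k00 H]]] := closed_prob cF e0 nE.
have := limf_esup_exp C0 k00 e0 (fun k => measure_ge0 P _) H.
rewrite -/L leNgt => /negP; apply; apply: le_lt_trans rL.
by rewrite lee_fin opprB opprK; lra.
Qed.

(** It suffices to treat each [u] in [G] by itself; an infinite rate makes the bound trivial. *)
Lemma solution_LDP_lower (G : set (path_space l x)) : open G ->
  (- ereal_inf (I @` G) <= limf_einf (fun kappa : R => kappa%:E * lne (P (X kappa @^-1` G))) 0^'+)%E.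
Proof.
move=> oG; set L := limf_einf _ _; rewrite leeNl.
apply: le_ereal_inf_tmp => _ [u Gu <-]; rewrite leeNl.
have := rate_ge0 u; case E : (rate gamma (pval u)) => [a| |] // a0; last by rewrite leNye.
have ua : energy_le (drive u) a by apply/(rate_energy hgamma hx u a0); rewrite E.
rewrite -EFinN; apply/lee_addgt0Pr => e e0; have e20 : 0 < e / 2 by rewrite divr_gt0.
have [C [k0 [C0 k00 H]]] := open_prob oG Gu e20 ua.
have := limf_einf_exp C0 k00 e20 H; rewrite -/L => h.
rewrite -leeBlDr //; apply: le_trans h; rewrite -EFinB lee_fin; lra.
Qed.

End LargeDeviations.

Theorem theorem1p14 (R : realType) (N : nat) (hN : (0 < N)%N)
    (Gamma : set (Cplx R)) (l : R) (gamma : R -> Cplx R)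
    (hGamma : jordan_curve Gamma) (hgamma : arc_length_param Gamma l gamma)
    (d : measure_display) (T : measurableType d) (P : probability T R)
    (B : R -> T -> 'rV[R]_N) (hB : brownian_motion P B)
    (x : 'rV[R]_N) (hx : Ddom l x)
    (X : R -> T -> path_space l x)
    (hX : forall kappa : R, 0 < kappa -> kappa <= 2 ->
      strong_solution P gamma B kappa (X kappa)) :
  good_rate_function (fun u : path_space l x => rate gamma (pval u)) /\
  LDP P X (fun u : path_space l x => rate gamma (pval u)).
Proof.
split; first exact: (rate_good hgamma hx).
split; first exact: (solution_LDP_upper hgamma hx hB hX).
exact: (solution_LDP_lower hgamma hx hB hX).
Qed.
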